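(* Let $T$ be an essentially locally compact m-tower. For every nondegenerate finite-dimensional representation $\pi$ of $C^*_0(T)$ there exists a unique element $s\in T$ such that $\pi(f)=f(s)$ for every $f\in C^*_0(T)$. What is more, $s\perp z$ for each $z\in T_{(0)}$. Conversely, for every $t\in T$ which is disjoint from every element of $T_{(0)}$, the representation $C^*_0(T)\ni f\mapsto f(t)\in M_{d(t)}$ is nondegenerate.
   Context: Conventions. All topological spaces are Hausdorff; $\mathbb N=\{1,2,\ldots\}$. $M_n$ is the $C^*$-algebra of complex $n\times n$ matrices, $\mathcal U_n$ its unitary group, $I_n$ its unit. For $U\in\mathcal U_n$, $X\in M_n$: $U.X=UXU^{-1}$. For $X\in M_n$, $Y\in M_k$, $X\oplus Y\in M_{n+k}$ is the block-diagonal matrix. An $n$-dimensional representation of a $C^*$-algebra $A$ is a $*$-homomorphism $A\to M_n$ ($n\ge1$). Towers. A tower is a topological space $T$ with a continuous function $d\colon T\to\mathbb N$, an operation $\oplus\colon T\times T\to T$ and functions $\mathcal U_n\times T_n\ni(U,x)\mapsto U.x\in T$ (where $T_n=d^{-1}(\{n\})$), such that: (T1) $\oplus$ is associative and continuous, and for each $n$ the map $T_n\times T\ni(x,y)\mapsto x\oplus y\in T$ is a closed embedding; (T2) $d(x\oplus y)=d(x)+d(y)$ and $d(U.x)=d(x)$; (T3) each $\mathcal U_n\times T_n\to T_n$ is a continuous group action; (T4) $U.x=x$ if $U\in\mathcal U_{d(x)}$ is a scalar multiple of the unit matrix; (T5) $(U\oplus V).(x\oplus y)=(U.x)\oplus(V.y)$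 for $x\in T_n$, $y\in T_k$, $U\in\mathcal U_n$, $V\in\mathcal U_k$; (T6) $U_{d(x),d(y)}.(x\oplus y)=y\oplus x$, where $U_{p,q}\in\mathcal U_{p+q}$ is given by $(w_1,\ldots,w_q,z_1,\ldots,z_p)\cdot U_{p,q}=(z_1,\ldots,z_p,w_1,\ldots,w_q)$ (row vectors). Let $T$ be a tower. An element $x$ is reducible if $V.x=a\oplus b$ for some $a,b\in T$, $V\in\mathcal U_{d(x)}$; otherwise it is irreducible. $\operatorname{stab}(x)=\{U\in\mathcal U_{d(x)}: U.x=x\}$. $x\equiv y$ means $U.x=y$ for some $U\in\mathcal U_{d(x)}$; $x\preccurlyeq y$ means that $x\equiv y$ or there are $a,b\in T$ with $x\equiv a$, $y\equiv a\oplus b$; $x\perp y$ ($x,y$ disjoint) means there is no $a\in T$ with $a\preccurlyeq x$ and $a\preccurlyeq y$. $\operatorname{core}(T)$ is the set of irreducible elements and $\overline{\operatorname{core}}(T)$ is its closure in $T$. A topological space $X$ has property $(\sigma)$ if there are sets $K_1\subset K_2\subset\cdots$ with union $X$, each compact Hausdorff in the subspace topology, such that $B\subset X$ is closed iff $B\cap K_n$ is closed for each $n$. An m-tower is a tower $T$ that has property $(\sigma)$ and satisfies for all $x,y,z\in T$: (mT1) if $z\perp x$ and $z\perp y$, then $z\perp x\oplus y$; (mT2) if $z\oplus x\equiv z\oplus y$, then $x\equiv y$; (mT3) if $x\perp y$, then $\operatorname{stab}(x\oplus y)=\{U\oplus V: U\in\operatorname{stab}(x),\ V\in\operatorname{stab}(y)\}$;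 (mT4) if $x$ is irreducible and $p=d(x)$, then for each $n>0$ the stabilizer of the $n$-fold sum $x\oplus\cdots\oplus x$ is $\{I_p\otimes U: U\in\mathcal U_n\}$, where $I_p\otimes[u_{jk}]$ is the block matrix $[u_{jk}I_p]$. $C^*(T)$ is the unital $C^*$-algebra (pointwise operations, supremum norm) of all functions $f$ on $T$ with $f(x)\in M_{d(x)}$, $f|_{T_n}\colon T_n\to M_n$ continuous for all $n$, $f(U.x)=U.f(x)$ for $U\in\mathcal U_{d(x)}$, $f(x\oplus y)=f(x)\oplus f(y)$, and $\|f\|=\sup_{x\in T}\|f(x)\|<\infty$. An m-tower $T$ is essentially locally compact if the space $\overline{\operatorname{core}}(T)$ is locally compact. Then $C^*_0(T)$ is the $*$-subalgebra of all $f\in C^*(T)$ such that for each $\varepsilon>0$ there is a compact $K\subset\overline{\operatorname{core}}(T)$ with $\|f(t)\|\le\varepsilon$ for all $t\in\overline{\operatorname{core}}(T)\setminus K$. The vanishing tower is $T_{(0)}=\{t\in T: f(t)=0 \text{ for all } f\in C^*_0(T)\}$ (possibly empty). *)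

(* Defs.v *)
From HB Require Import structures.
From mathcomp Require Import all_boot all_order all_algebra.
From mathcomp Require Import complex mxtens.
From mathcomp Require Import all_classical all_reals all_analysis.

Set Implicit Arguments.
Unset Strict Implicit.
Unset Printing Implicit Defensive.

Import Order.TTheory GRing.Theory Num.Theory numFieldNormedType.Exports.

Local Open Scope classical_set_scope.
Local Open Scope ring_scope.

(* Declared as a [numClosedFieldType], and not as the bare type [R[i]], so that
   it carries the norm topology which MathComp-Analysis attaches to such
   fields; matrices over it then carry the entrywise topology. *)
Definition Cx (R : realType) : numClosedFieldType := complex R.

Section Matrices.
Variable R : realType.
Local Notation C := (Cx R).

Definition l2norm n (v : 'cV[C]_n) : R :=
  Num.sqrt (\sum_i ComplexField.Normc.normc (v i 0) ^+ 2).

(* the C*-norm of M_n *)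
Definition opnorm n (X : 'M[C]_n) : R :=
  sup [set l2norm (X *m v) | v in [set v : 'cV[C]_n | l2norm v <= 1]].

Definition dirsum n k (X : 'M[C]_n) (Y : 'M[C]_k) : 'M[C]_(n + k) :=
  block_mx X 0 0 Y.

(* row_mx w z *m swapmx p q = row_mx z w for w : 'rV_q and z : 'rV_p, up to the
   cast between 'rV_(q + p) and 'rV_(p + q). *)
Definition swapmx p q : 'M[C]_(p + q) :=
  castmx (addnC q p, erefl (p + q)%N)
    (block_mx (0 : 'M[C]_(q, p)) (1%:M : 'M[C]_q)
              (1%:M : 'M[C]_p) (0 : 'M[C]_(p, q))).

End Matrices.

Section Topology.

Definition closed_embedding_on (X Y : topologicalType) (A : set X)
    (f : X -> Y) :=
  [/\ {within A, continuous f},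
      set_inj A f,
      (forall O : set X, open O ->
         exists2 V : set Y, open V & A `&` O = A `&` f @^-1` V)
    & closed (f @` A)].

Definition property_sigma (X : topologicalType) :=
  exists K : nat -> set X,
    [/\ (forall n, K n `<=` K n.+1),
        \bigcup_n K n = setT,
        (forall n, compact (K n) /\ hausdorff_space (K n))
      & forall B : set X, closed B <-> forall n, closed (B `&` K n)].

End Topology.

(* [act n U x] is meaningful only when U is unitary and x has degree n; no
   axiom constrains its values elsewhere. *)
Record tower (R : realType) := Tower {
  tcarrier :> topologicalType;
  deg : tcarrier -> nat;
  tsum : tcarrier -> tcarrier -> tcarrier;
  act : forall n, 'M[Cx R]_n -> tcarrier -> tcarrier;
  tower_hausdorff : hausdorff_space tcarrier;
  deg_gt0 : forall x, (0 < deg x)%N;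
  deg_continuous : continuous deg;
  tsumA : associative tsum;
  tsum_continuous :
    continuous (fun p : tcarrier * tcarrier => tsum p.1 p.2);
  tsum_closed_embedding : forall n,
    closed_embedding_on
      [set p : tcarrier * tcarrier | deg p.1 = n]
      (fun p => tsum p.1 p.2);
  deg_tsum : forall x y, deg (tsum x y) = (deg x + deg y)%N;
  deg_act : forall n (U : 'M[Cx R]_n) x,
    U \is unitarymx -> deg x = n -> deg (act U x) = n;
  act_continuous : forall n,
    {within [set p : 'M[Cx R]_n * tcarrier
               | p.1 \is unitarymx /\ deg p.2 = n],
     continuous (fun p => act p.1 p.2)};
  act1 : forall n x, deg x = n -> act (1%:M : 'M[Cx R]_n) x = x;
  actM : forall n (U V : 'M[Cx R]_n) x,
    U \is unitarymx -> V \is unitarymx -> deg x = n ->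
    act (U *m V) x = act U (act V x);
  act_scalar : forall n (c : Cx R) x,
    (c%:M : 'M[Cx R]_n) \is unitarymx -> deg x = n -> act (c%:M : 'M[Cx R]_n) x = x;
  act_tsum : forall n k (U : 'M[Cx R]_n) (V : 'M[Cx R]_k) x y,
    U \is unitarymx -> V \is unitarymx -> deg x = n -> deg y = k ->
    act (dirsum U V) (tsum x y) = tsum (act U x) (act V y);
  act_swap : forall x y,
    act (swapmx R (deg x) (deg y)) (tsum x y) = tsum y x
}.

Section Towers.
Variables (R : realType) (T : tower R).
Local Notation C := (Cx R).
Implicit Types x y z a b : T.

Definition reducible x :=
  exists (V : 'M[C]_(deg x)) a b, V \is unitarymx /\ act V x = tsum a b.

Definition irreducible x := ~ reducible x.

Definition stab n x : set 'M[C]_n :=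
  [set U | U \is unitarymx /\ act U x = x].
Arguments stab : clear implicits.

Definition tequiv x y :=
  exists2 U : 'M[C]_(deg x), U \is unitarymx & act U x = y.

Definition tprec x y :=
  tequiv x y \/ exists a b, tequiv x a /\ tequiv y (tsum a b).

Definition tdisjoint x y := ~ exists2 a, tprec a x & tprec a y.

Definition core : set T := [set x | irreducible x].

(* the n-fold sum, for 0 < n *)
Definition nsum x n := iter n.-1 (tsum x) x.

Record mtower : Prop := MTower {
  mtower_sigma : property_sigma T;
  tdisjoint_tsum : forall x y z,
    tdisjoint z x -> tdisjoint z y -> tdisjoint z (tsum x y);
  tequiv_cancel : forall x y z,
    tequiv (tsum z x) (tsum z y) -> tequiv x y;
  stab_tsum : forall x y, tdisjoint x y ->
    stab (deg x + deg y)%N (tsum x y) =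
    [set W | exists U V, [/\ stab (deg x) x U, stab (deg y) y V
                           & W = dirsum U V]];
  (* the Kronecker product U *t 1 is the block matrix of the u_jk I_p *)
  stab_nsum : forall x n, irreducible x -> (0 < n)%N ->
    stab (n * deg x)%N (nsum x n) =
    [set U *t (1%:M : 'M[C]_(deg x)) | U in [set U : 'M[C]_n | U \is unitarymx]]
}.

Definition essentially_locally_compact := locally_compact (closure core).

Definition msection := forall x : T, 'M[C]_(deg x).

(* The value f(x) read in M_n, which makes sense when deg x = n (and is 0
   otherwise). *)
Definition value_in n (f : msection) x : 'M[C]_n := conform_mx 0 (f x).

Definition in_Cstar (f : msection) :=
  [/\ (forall n, {within [set x | deg x = n], continuous (value_in n f)}),
      (forall x (U : 'M[C]_(deg x)), U \is unitarymx ->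
         value_in (deg x) f (act U x) = U *m f x *m invmx U),
      (forall x y,
         value_in (deg x + deg y)%N f (tsum x y) = dirsum (f x) (f y))
    & exists M : R, forall x, opnorm (f x) <= M].

Definition in_Cstar0 (f : msection) :=
  in_Cstar f /\
  forall e : R, 0 < e ->
    exists K : set T, [/\ compact K, K `<=` closure core
      & forall t, (closure core `\` K) t -> opnorm (f t) <= e].

Definition vanishing : set T :=
  [set t | forall f, in_Cstar0 f -> f t = 0].

(* A *-homomorphism from the *-algebra of sections satisfying in_Cstar0, with
   its pointwise operations, to M_n; the values of pi at other sections are
   irrelevant. *)
Record representation0 n (pi : msection -> 'M[C]_n) : Prop := Representation0 {
  repD : forall f g, in_Cstar0 f -> in_Cstar0 g ->
    pi (fun x => f x + g x) = pi f + pi g;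
  repZ : forall (c : C) f, in_Cstar0 f -> pi (fun x => c *: f x) = c *: pi f;
  repM : forall f g, in_Cstar0 f -> in_Cstar0 g ->
    pi (fun x => f x *m g x) = pi f *m pi g;
  repStar : forall f, in_Cstar0 f ->
    pi (fun x => map_mx Num.conj (f x)^T) = map_mx Num.conj (pi f)^T
}.

(* The vectors pi(f) xi span C^n; scalars are absorbed in the xi_i. *)
Definition nondegenerate0 n (pi : msection -> 'M[C]_n) :=
  forall v : 'cV[C]_n,
    exists (k : nat) (f : 'I_k -> msection) (xi : 'I_k -> 'cV[C]_n),
      (forall i, in_Cstar0 (f i)) /\ v = \sum_i pi (f i) *m xi i.

End Towers.

Arguments stab {R T} n x.
Arguments core {R} T.
Arguments vanishing {R} T.

(* Main.v *)
Require Import Defs.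
From HB Require Import structures.
From mathcomp Require Import all_boot all_order all_algebra.
From mathcomp Require Import complex mxtens.
From mathcomp Require Import all_classical all_reals all_analysis.
From mathcomp Require Import ring lra.

Set Implicit Arguments.
Unset Strict Implicit.
Unset Printing Implicit Defensive.

Import Order.TTheory GRing.Theory Num.Theory numFieldNormedType.Exports.

Local Open Scope classical_set_scope.
Local Open Scope ring_scope.
Local Open Scope sesquilinear_scope.

(* Every element of an m-tower is, up to unitary equivalence, a sum of
   irreducible elements, and the axioms of an m-tower make this decomposition so
   rigid that an equivariant function on the core extends uniquely to an
   equivariant additive section. Extending one degree at a time (the tower is a
   normal space, and a Tietze extension is made equivariant by taking Chebyshev
   centers of orbits) gives enough elements of C*(T) to assign arbitrary values
   at an irreducible element y and the value 0 at elements disjoint from y.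
   Since C*_0(T) is an ideal of C*(T), it has arbitrary values at each
   irreducible element outside the vanishing tower.

   A *-closed algebra of matrices that kills no common vector contains the unit
   matrix, so pi is nondegenerate iff pi(e) = 1 for some e. By a compactness
   argument there is then an irreducible y such that no f with f(y) = 0 has
   pi(f) = 1; hence pi kills some vector v on the ideal {f : f(y) = 0}, the
   vectors pi(f) v span a copy of the evaluation at y, and one splits it off and
   argues by induction on the dimension. The point s is unique since C*(T)
   separates points: multiplying by e reduces C*(T) to C*_0(T). *)

(** * Unitary conjugation and direct sums *)

Section UnitaryConj.
Variable R : realType.
Local Notation C := (Cx R).

(** The rigidity is a statement about stabilizers. A value at a point has to be fixed by the
    stabilizer of that point. By (mT3) and (mT4), a stabilizer of a sum of m copies of an
    irreducible y and some w disjoint from y is U tensor 1 on the copies of y and a stabilizer of w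
    on the rest, so values assembled from summands are fixed automatically; (mT2) makes the rest
    unique. Separation of points runs this backwards: a unitary that intertwines all values at two
    points is forced into that block form. The extension from the core ignores topology. Continuity
    can be gained degree by degree because a limit of reducible elements of one degree is reducible,
    by the closed embedding in (T1) and the compactness of unitary groups; hence the values forced
    in degree N live on a closed set. Points need not have countable neighborhood bases, so limits
    are taken along ultrafilters instead of subsequences. C*_0(T) may lack a unit and pi comes
    without a norm bound. The argument therefore stays algebraic: norms enter only to show that
    certain sections, bounded below on the core, have an inverse in C*(T). *)

Definition uconj n (U X : 'M[C]_n) : 'M[C]_n := U *m X *m invmx U.

Lemma unitarymx1 n : (1%:M : 'M[C]_n) \is unitarymx.
Proof. by apply/unitarymxP; rewrite trmx1 map_mx1 mulmx1. Qed.

Lemma mulmx_tCV n (U : 'M[C]_n) : U \is unitarymx -> U^t* *m U = 1%:M.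
Proof. by move=> uU; rewrite -invmx_unitary // mulVmx // unitarymx_unit. Qed.

Lemma unitary_inv n (U : 'M[C]_n) : U \is unitarymx -> invmx U \is unitarymx.
Proof.
move=> uU; apply/unitarymxP.
by rewrite invmx_unitary // (trmxCK U) mulmx_tCV.
Qed.

Lemma dirsumM n k (A A' : 'M[C]_n) (B B' : 'M[C]_k) :
  dirsum A B *m dirsum A' B' = dirsum (A *m A') (B *m B').
Proof. by rewrite /dirsum mulmx_block !(mul0mx, mulmx0, addr0, add0r). Qed.

Lemma dirsum_tC n k (A : 'M[C]_n) (B : 'M[C]_k) :
  (dirsum A B)^t* = dirsum (A^t*) (B^t*).
Proof. by rewrite /dirsum tr_block_mx map_block_mx !trmx0 !map_mx0. Qed.

Lemma dirsum1 n k : dirsum (1%:M : 'M[C]_n) (1%:M : 'M[C]_k) = 1%:M.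
Proof. by rewrite /dirsum -scalar_mx_block. Qed.

Lemma dirsum_inj n k (A A' : 'M[C]_n) (B B' : 'M[C]_k) :
  dirsum A B = dirsum A' B' -> A = A' /\ B = B'.
Proof. by case/eq_block_mx. Qed.

Lemma dirsum_unitary n k (U : 'M[C]_n) (V : 'M[C]_k) :
  U \is unitarymx -> V \is unitarymx -> dirsum U V \is unitarymx.
Proof.
move=> uU uV; apply/unitarymxP.
by rewrite dirsum_tC dirsumM !(unitarymxP _) // dirsum1.
Qed.

Lemma uconj1 n (X : 'M[C]_n) : uconj 1%:M X = X.
Proof. by rewrite /uconj invmx1 mul1mx mulmx1. Qed.

Lemma uconj_comp n (U V X : 'M[C]_n) : U \is unitarymx -> V \is unitarymx ->
  uconj (U *m V) X = uconj U (uconj V X).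
Proof.
move=> uU uV; have uUV := mul_unitarymx uU uV.
rewrite /uconj (invmx_unitary uU) (invmx_unitary uV) (invmx_unitary uUV).
by rewrite trmx_mul map_mxM !mulmxA.
Qed.

Lemma uconjK n (U X : 'M[C]_n) : U \is unitarymx -> uconj (invmx U) (uconj U X) = X.
Proof.
by move=> uU; rewrite -uconj_comp ?unitary_inv // mulVmx ?uconj1 ?unitarymx_unit.
Qed.

Lemma uconjVK n (U X : 'M[C]_n) : U \is unitarymx -> uconj U (uconj (invmx U) X) = X.
Proof.
by move=> uU; rewrite -uconj_comp ?unitary_inv // mulmxV ?uconj1 ?unitarymx_unit.
Qed.

Lemma uconj_inj n (U : 'M[C]_n) : U \is unitarymx -> injective (uconj U).
Proof. by move=> uU; apply: can_inj (fun X => uconjK X uU). Qed.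

Lemma uconj_fix n (U X : 'M[C]_n) : U \is unitarymx ->
  (uconj U X = X) <-> (U *m X = X *m U).
Proof.
move=> uU; rewrite /uconj; split=> [e|->].
  by rewrite -[in RHS]e mulmxKV // unitarymx_unit.
by rewrite mulmxK // unitarymx_unit.
Qed.

Lemma uconj_dirsum n k (U X : 'M[C]_n) (V Y : 'M[C]_k) :
  U \is unitarymx -> V \is unitarymx ->
  uconj (dirsum U V) (dirsum X Y) = dirsum (uconj U X) (uconj V Y).
Proof.
move=> uU uV; rewrite /uconj !invmx_unitary ?dirsum_unitary //.
by rewrite dirsum_tC !dirsumM.
Qed.

(** The two sizes of [B] are kept as distinct variables so that [e] can be eliminated; the block
    matrix behind [swapmx] has sizes q + p and p + q. *)
Lemma uconj_castmx m n (e : m = n) (B : 'M[C]_(m, n)) (Z : 'M[C]_n) (Z' : 'M[C]_m) :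
  B \is unitarymx -> B *m Z *m B^t* = Z' ->
  castmx (e, erefl n) B \is unitarymx /\
  uconj (castmx (e, erefl n) B) Z = castmx (e, e) Z'.
Proof.
case: n / e in B Z *; rewrite !castmx_id => uB <-; split=> //.
by rewrite /uconj invmx_unitary.
Qed.

Lemma uconj_swapmx p q (X : 'M[C]_p) (Y : 'M[C]_q) :
  swapmx R p q \is unitarymx /\
  uconj (swapmx R p q) (dirsum X Y) = castmx (addnC q p, addnC q p) (dirsum Y X).
Proof.
apply: uconj_castmx.
  apply/unitarymxP; rewrite tr_block_mx map_block_mx mulmx_block.
  rewrite !trmx0 !trmx1 !map_mx0 !map_mx1.
  by rewrite !(mul0mx, mulmx0, addr0, add0r, mulmx1) -scalar_mx_block.
rewrite tr_block_mx map_block_mx /dirsum !mulmx_block.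
rewrite !trmx0 !trmx1 !map_mx0 !map_mx1.
by rewrite !(mul0mx, mulmx0, addr0, add0r, mulmx1, mul1mx).
Qed.

Lemma dirsumA n k l (X : 'M[C]_n) (Y : 'M[C]_k) (Z : 'M[C]_l) :
  dirsum X (dirsum Y Z) = castmx (esym (addnA n k l), esym (addnA n k l))
                            (dirsum (dirsum X Y) Z).
Proof.
rewrite /dirsum -[block_mx Y 0 0 Z]/(block_mx Y 0 0 Z).
have := @block_mxA C n k l n k l X 0 0 0 Y 0 0 0 Z.
by rewrite !row_mx0 !col_mx0 => ->; apply: eq_castmx.
Qed.

(** Links iterated block sums with [1 *t X], which visibly commutes with the stabilizers [U *t 1] of
    (mT4). *)
Lemma dirsum_tens1 m n (X : 'M[C]_n) :
  dirsum X ((1%:M : 'M[C]_m) *t X) = (1%:M : 'M[C]_(m.+1)) *t X.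
Proof.
have -> : (1%:M : 'M[C]_(m.+1)) = (block_mx 1%:M 0 0 1%:M : 'M[C]_(1 + m)).
  by rewrite -scalar_mx_block.
rewrite tens_block_mx /dirsum !tens0mx (tens_scalar1mx X).
apply/esym; rewrite (castmx_block (mul1n n) (mul1n n) (erefl _) (erefl _)).
rewrite castmx_comp !castmx_id.
by congr block_mx; apply/matrixP=> i j; rewrite castmxE !mxE.
Qed.

End UnitaryConj.

(** * The order of a tower *)

Section TowerOrder.
Variables (R : realType) (T : tower R).
Local Notation C := (Cx R).
Implicit Types x y z a b c : T.

Lemma act_inv n (U : 'M[C]_n) x : U \is unitarymx -> deg x = n ->
  act (invmx U) (act U x) = x.
Proof.
move=> uU dx; rewrite -actM ?(unitary_inv uU) // mulVmx ?unitarymx_unit //.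
exact: act1.
Qed.

Lemma tequivI n (U : 'M[C]_n) x : U \is unitarymx -> deg x = n ->
  tequiv x (act U x).
Proof. by move=> + dx; move: U; case: n / dx => U uU; exists U. Qed.

Lemma tequiv_refl x : tequiv x x.
Proof. by exists 1%:M; [exact: unitarymx1 | exact: act1]. Qed.

Lemma tequiv_deg x y : tequiv x y -> deg y = deg x.
Proof. by case=> U uU <-; rewrite deg_act. Qed.

Lemma tequiv_sym x y : tequiv x y -> tequiv y x.
Proof.
case=> U uU <-; rewrite -[X in tequiv _ X](act_inv uU) //.
exact: tequivI (unitary_inv uU) (deg_act uU (erefl _)).
Qed.

Lemma tequiv_trans x y z : tequiv x y -> tequiv y z -> tequiv x z.
Proof.
case=> U uU <- [V]; move: V; rewrite (deg_act uU (erefl _)) => V uV <-.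
by rewrite -actM //; exact: tequivI (mul_unitarymx uV uU) (erefl _).
Qed.

Lemma tequiv_tsum x x' y y' : tequiv x x' -> tequiv y y' ->
  tequiv (tsum x y) (tsum x' y').
Proof.
case=> U uU <- [V uV <-]; rewrite -act_tsum //.
exact: tequivI (dirsum_unitary uU uV) (deg_tsum _ _).
Qed.

Lemma tequiv_tsumC x y : tequiv (tsum x y) (tsum y x).
Proof.
rewrite -[X in tequiv _ X]act_swap; apply: tequivI; last exact: deg_tsum.
by case: (@uconj_swapmx R (deg x) (deg y) 0 0).
Qed.

Lemma reducibleI x a b : tequiv x (tsum a b) -> reducible x.
Proof. by case=> V uV e; exists V, a, b. Qed.

Lemma tprec_tequivr x y z : tprec x y -> tequiv y z -> tprec x z.
Proof.
case=> [xy|[a [b [xa yab]]]] yz; first by left; exact: tequiv_trans yz.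
right; exists a, b; split=> //; apply: tequiv_trans yab; exact: tequiv_sym.
Qed.

Lemma tprec_tequivl x y z : tequiv x y -> tprec y z -> tprec x z.
Proof.
move=> xy [yz|[a [b [ya zab]]]]; first by left; exact: tequiv_trans yz.
by right; exists a, b; split=> //; apply: tequiv_trans ya.
Qed.

Lemma tprec_refl x : tprec x x.
Proof. by left; exact: tequiv_refl. Qed.

Lemma tprec_suml x a b : tprec x a -> tprec x (tsum a b).
Proof.
case=> [xa|[c [d [xc acd]]]].
  by right; exists a, b; split=> //; exact: tequiv_refl.
right; exists c, (tsum d b); split=> //; rewrite tsumA.
by apply: tequiv_tsum acd _; exact: tequiv_refl.
Qed.

Lemma tprec_sumr x a b : tprec x b -> tprec x (tsum a b).
Proof.
by move=> xb; apply: tprec_tequivr (tequiv_tsumC b a); exact: tprec_suml.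
Qed.

Lemma tprec_trans x y z : tprec x y -> tprec y z -> tprec x z.
Proof.
move=> xy [yz|[a [b [ya zab]]]]; first exact: tprec_tequivr yz.
apply: tprec_tequivr (tequiv_sym zab); apply: tprec_suml.
exact: tprec_tequivr ya.
Qed.

Lemma tprec_irreducible x y : irreducible y -> tprec x y -> tequiv x y.
Proof. by move=> iy [//|[a [b [_ /reducibleI]]]]. Qed.

Lemma tdisjoint_sym x y : tdisjoint x y -> tdisjoint y x.
Proof. by move=> xy [a ax ay]; apply: xy; exists a. Qed.

Lemma tdisjoint_precl x y z : tprec x y -> tdisjoint y z -> tdisjoint x z.
Proof. by move=> xy yz [a ax az]; apply: yz; exists a => //; exact: tprec_trans xy. Qed.

Lemma irreducible_disjointP y z : irreducible y -> ~ tprec y z <-> tdisjoint y z.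
Proof.
move=> iy; split=> [nyz [a /(tprec_irreducible iy) ay az]|yz yz'].
  by apply: nyz; apply: tprec_tequivl az; exact: tequiv_sym.
by apply: yz; exists y => //; exact: tprec_refl.
Qed.

Lemma ltn_deg_tsuml x y : (deg x < deg (tsum x y))%N.
Proof. by rewrite deg_tsum -[X in (X < _)%N]addn0 ltn_add2l deg_gt0. Qed.

Lemma ltn_deg_tsumr x y : (deg y < deg (tsum x y))%N.
Proof. by rewrite deg_tsum -[X in (X < _)%N]add0n ltn_add2r deg_gt0. Qed.

(** Both summands of a reducible element have smaller degree, since degrees are positive. *)
Lemma tower_ind (P : T -> Prop) :
  (forall y, irreducible y -> P y) ->
  (forall a b, P a -> P b -> P (tsum a b)) ->
  (forall x y, tequiv x y -> P x -> P y) -> forall x, P x.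
Proof.
move=> Pi Ps Pe x; have [n] := ubnP (deg x); elim: n x => // n IH x.
rewrite ltnS => lexn; have [rx|ix] := pselect (reducible x); last exact: Pi.
have [V [a [b [uV e]]]] := rx; have exab : tequiv x (tsum a b) by exists V.
have dx := tequiv_deg exab.
apply: Pe (tequiv_sym exab) _; apply: Ps; apply: IH; apply: leq_trans lexn.
  by rewrite -dx ltn_deg_tsuml.
by rewrite -dx ltn_deg_tsumr.
Qed.

Lemma ex_irreducible_tprec x : exists2 y, irreducible y & tprec y x.
Proof.
elim/tower_ind: x => [y iy|a b [y iy ya] _|x x' xx' [y iy yx]].
- by exists y => //; exact: tprec_refl.
- by exists y => //; exact: tprec_suml.
- by exists y => //; exact: tprec_tequivr xx'.
Qed.

Hypothesis hT : mtower T.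

(** Irreducible elements behave like primes: this is the contrapositive of (mT1), as an irreducible
    element is disjoint from everything it does not lie below. *)
Lemma tprec_tsumP y a b : irreducible y -> tprec y (tsum a b) ->
  tprec y a \/ tprec y b.
Proof.
move=> iy yab; have [ya|/(irreducible_disjointP _ iy) ya] := pselect (tprec y a).
  by left.
have [yb|/(irreducible_disjointP _ iy) yb] := pselect (tprec y b); first by right.
by have /(irreducible_disjointP _ iy) := tdisjoint_tsum hT ya yb.
Qed.

End TowerOrder.

(** * Extending equivariant maps from the core *)

(* A pair of a point of degree n and a matrix in M_n; the index is part of the
   data, so that sums are associative without transport. *)
Section PointValues.
Variables (R : realType) (T : tower R).
Local Notation C := (Cx R).

Definition pval := {n : nat & (T * 'M[C]_n)%type}.
Definition mkpv n (z : T) (X : 'M[C]_n) : pval := existT _ n (z, X).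
Definition pdim (p : pval) : nat := projT1 p.
Definition ppt (p : pval) : T := (projT2 p).1.
Definition pmx (p : pval) : 'M[C]_(pdim p) := (projT2 p).2.
Definition pwf (p : pval) := deg (ppt p) = pdim p.
Definition psum (p q : pval) : pval :=
  mkpv (tsum (ppt p) (ppt q)) (dirsum (pmx p) (pmx q)).
Definition pact (p : pval) (U : 'M[C]_(pdim p)) : pval :=
  mkpv (act U (ppt p)) (uconj U (pmx p)).
Definition psim (p q : pval) :=
  exists2 U : 'M[C]_(pdim p), U \is unitarymx & q = pact U.

Lemma mkpv_eta p : p = mkpv (ppt p) (pmx p).
Proof. by case: p => n [z X]. Qed.

Lemma mkpv_inj n (z z' : T) (X X' : 'M[C]_n) :
  mkpv z X = mkpv z' X' -> z = z' /\ X = X'.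
Proof.
move=> e; split; first exact: (congr1 ppt e).
have := congr1 (fun p => conform_mx (0 : 'M[C]_n) (pmx p)) e.
by rewrite /= !conform_mx_id.
Qed.

Lemma mkpv_cast n n' (e : n = n') (z : T) (X : 'M[C]_n) :
  mkpv z (castmx (e, e) X) = mkpv z X.
Proof. by case: n' / e; rewrite castmx_id. Qed.

Lemma psum_wf p q : pwf p -> pwf q -> pwf (psum p q).
Proof. by rewrite /pwf /= deg_tsum => -> ->. Qed.

Lemma pact_wf p (U : 'M[C]_(pdim p)) : U \is unitarymx -> pwf p -> pwf (pact U).
Proof. by move=> uU wp; rewrite /pwf /= deg_act. Qed.

Lemma psim_wf p q : psim p q -> pwf p -> pwf q.
Proof. by case=> U uU ->; exact: pact_wf. Qed.

Lemma psim_dim p q : psim p q -> pdim q = pdim p.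
Proof. by case=> U uU ->. Qed.

Lemma psim_refl p : pwf p -> psim p p.
Proof.
move=> wp; exists 1%:M; first exact: unitarymx1.
by rewrite /pact act1 // uconj1 -mkpv_eta.
Qed.

Lemma psim_sym p q : pwf p -> psim p q -> psim q p.
Proof.
move=> wp [U uU ->]; exists (invmx U); first exact: unitary_inv.
by rewrite /pact /= act_inv // uconjK // -mkpv_eta.
Qed.

Lemma psim_trans p q r : pwf p -> psim p q -> psim q r -> psim p r.
Proof.
move=> wp [U uU ->] [V uV ->]; exists (V *m U); first exact: mul_unitarymx uV uU.
by rewrite /pact /= (actM uV uU wp) (uconj_comp _ uV uU).
Qed.

Lemma psum_sim p p' q q' : pwf p -> pwf q -> psim p p' -> psim q q' ->
  psim (psum p q) (psum p' q').
Proof.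
move=> wp wq [U uU ->] [V uV ->]; exists (dirsum U V : 'M[C]_(pdim (psum p q))).
  exact: dirsum_unitary.
by rewrite /pact /= act_tsum // uconj_dirsum.
Qed.

Lemma psumC_sim p q : pwf p -> pwf q -> psim (psum p q) (psum q p).
Proof.
case: p q => n [x X] [k [y Y]]; rewrite /pwf /ppt /pdim /= => dx dy.
case: n / dx in X *; case: k / dy in Y *.
have [uS eS] := uconj_swapmx X Y.
exists (swapmx R (deg x) (deg y) : 'M[C]_(pdim (psum (mkpv x X) (mkpv y Y)))) => //.
by rewrite /pact /= eS mkpv_cast act_swap.
Qed.

Lemma psumA p q r : psum p (psum q r) = psum (psum p q) r.
Proof. by rewrite /psum /= dirsumA mkpv_cast tsumA. Qed.

Lemma psim_tequiv p q : pwf p -> psim p q -> tequiv (ppt p) (ppt q).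
Proof. by move=> wp [U uU ->]; exact: tequivI. Qed.

Lemma tequiv_psim p z : pwf p -> tequiv (ppt p) z ->
  exists2 q, psim p q & ppt q = z.
Proof.
case: p => n [x X]; rewrite /pwf /ppt /pdim /= => dx; case: n / dx in X *.
by case=> U uU <-; exists (@pact (mkpv x X) U) => //; exists U.
Qed.

End PointValues.

(** * The extension as a generated graph *)

Section Generated.
Variables (R : realType) (T : tower R) (hT : mtower T).
Local Notation C := (Cx R).
Variable phi : msection T.

Definition pfun (f : msection T) (x : T) : pval T := mkpv x (f x).

Hypothesis phi_equivariant : forall y (U : 'M[C]_(deg y)),
  irreducible y -> U \is unitarymx ->
  @pact R T (pfun phi y) U = pfun phi (act U y).

(** The graph of the extension, built first as a relation; [pgen_exists] shows that it is total and
    [pgen_inj] that it is single-valued. *)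
Inductive pgen : pval T -> Prop :=
| pgen_irr y : irreducible y -> pgen (pfun phi y)
| pgen_sum p q : pgen p -> pgen q -> pgen (psum p q)
| pgen_sim p q : pgen p -> psim p q -> pgen q.

Lemma pfun_wf f x : pwf (pfun f x). Proof. by []. Qed.

Lemma pgen_wf p : pgen p -> pwf p.
Proof.
elim=> [y iy|p' q _ wp _ wq|p' q _ wp pq] //; first exact: psum_wf.
exact: psim_wf pq wp.
Qed.

Lemma pgen_exists z : exists2 p, pgen p & ppt p = z.
Proof.
elim/tower_ind: z => [y iy|a b [p gp <-] [q gq <-]|x y xy [p gp px]].
- by exists (pfun phi y) => //; constructor.
- by exists (psum p q) => //; exact: pgen_sum.
- have [q pq qy] : exists2 q, psim p q & ppt q = y.
    by apply: tequiv_psim; [exact: pgen_wf | rewrite px].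
  by exists q => //; exact: pgen_sim pq.
Qed.

Lemma pfun_psim y z : irreducible y -> tequiv y z ->
  psim (pfun phi y) (pfun phi z).
Proof. by move=> iy [U uU <-]; exists U; rewrite ?phi_equivariant. Qed.

(** The first alternative is needed because a tower has no zero element: splitting off y may leave
    nothing. *)
Lemma pgen_split1 p y : irreducible y -> pgen p -> tprec y (ppt p) ->
  psim p (pfun phi y) \/
  exists2 q, pgen q & psim p (psum (pfun phi y) q).
Proof.
move=> iy; have wy := pfun_wf phi y.
elim=> [z iz|p1 p2 g1 IH1 g2 IH2|p1 q g1 IH1 pq] /=.
- move=> /(tprec_irreducible iz) yz; left.
  by apply: psim_sym => //; exact: pfun_psim.
- have w1 := pgen_wf g1; have w2 := pgen_wf g2.
  case/(tprec_tsumP hT iy) => [/IH1|/IH2].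
    case=> [e|[q gq e]]; right.
      by exists p2 => //; apply: psum_sim => //; exact: psim_refl.
    exists (psum q p2); first exact: pgen_sum.
    by rewrite psumA; apply: psum_sim => //; exact: psim_refl.
  have c := psumC_sim w1 w2; have w12 := psum_wf w1 w2.
  case=> [e|[q gq e]]; right.
    exists p1 => //; apply: psim_trans c _ => //.
    by apply: psum_sim => //; exact: psim_refl.
  exists (psum q p1); first exact: pgen_sum.
  rewrite psumA; apply: psim_trans c _ => //.
  by apply: psum_sim => //; exact: psim_refl.
- have w1 := pgen_wf g1; have qp := psim_sym w1 pq => yq.
  have wq := psim_wf pq w1.
  have /IH1 : tprec y (ppt p1).
    by apply: tprec_tequivr yq _; exact: psim_tequiv.
  case=> [e|[r gr e]]; [left|right; exists r => //].
    exact: psim_trans e.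
  exact: psim_trans e.
Qed.

Definition pnsum y m : pval T := mkpv (nsum y m) ((1%:M : 'M[C]_m) *t phi y).

Lemma deg_nsum (y : T) m : (0 < m)%N -> deg (nsum y m) = (m * deg y)%N.
Proof.
case: m => // m _; rewrite /nsum /=; elim: m => [|m IH]; first by rewrite mul1n.
by rewrite iterS deg_tsum IH -mulSn.
Qed.

Lemma pnsum1 y : pnsum y 1 = pfun phi y.
Proof. by rewrite /pnsum /nsum /= tens_scalar1mx mkpv_cast. Qed.

Lemma pnsumS y m : (0 < m)%N -> psum (pfun phi y) (pnsum y m) = pnsum y m.+1.
Proof. by case: m => // m _; rewrite /psum /= dirsum_tens1. Qed.

Lemma pnsum_wf y m : (0 < m)%N -> pwf (pnsum y m).
Proof. exact: deg_nsum. Qed.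

(** Copies of y are split off until the rest is disjoint from y, which is the form that (mT3) and
    (mT4) can handle; the dimension drops each time. *)
Lemma pgen_split p y : irreducible y -> pgen p -> tprec y (ppt p) ->
  exists2 m, (0 < m)%N & psim p (pnsum y m) \/
    exists q, [/\ pgen q, tdisjoint y (ppt q) & psim p (psum (pnsum y m) q)].
Proof.
move=> iy; have [n] := ubnP (pdim p); elim: n p => // n IH p.
rewrite ltnS => lepn gp yp; have wp := pgen_wf gp; have wy := pfun_wf phi y.
have [e|[q gq e]] := pgen_split1 iy gp yp.
  by exists 1%N => //; left; rewrite pnsum1.
have wq := pgen_wf gq.
have [yq|/(irreducible_disjointP _ iy) yq] := pselect (tprec y (ppt q)); last first.
  by exists 1%N => //; right; exists q; rewrite pnsum1.
have [|m m0 IHq] := IH q _ gq yq.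
  apply: leq_trans lepn; rewrite -(psim_dim e) /= -[X in (X < _)%N]add0n ltn_add2r.
  exact: deg_gt0.
exists m.+1 => //; case: IHq => [e'|[r [gr yr e']]]; [left|right; exists r; split=> //].
  rewrite -pnsumS //; apply: psim_trans e _ => //.
  by apply: psum_sim => //; exact: psim_refl.
rewrite -pnsumS // -psumA; apply: psim_trans e _ => //.
by apply: psum_sim => //; exact: psim_refl.
Qed.

Lemma tdisjoint_nsum (y z : T) m : tdisjoint y z -> tdisjoint (nsum y m) z.
Proof.
rewrite /nsum; elim: m.-1 => //= k IH yz.
by apply: tdisjoint_sym; apply: tdisjoint_tsum => //; apply: tdisjoint_sym => //; exact: IH.
Qed.

(** The condition under which an equivalent pair over the same point must be the pair itself. *)
Definition prigid (p : pval T) := forall U : 'M[C]_(pdim p),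
  U \is unitarymx -> act U (ppt p) = ppt p -> uconj U (pmx p) = pmx p.

Lemma prigid_sim p q : pwf p -> psim p q -> prigid q -> prigid p.
Proof.
move=> wp [V uV ->] rq U uU eU.
have uVi := unitary_inv uV; have uUV := mul_unitarymx uU uVi.
have uW := mul_unitarymx uV uUV; have dV := deg_act uV wp.
have eW : act (V *m (U *m invmx V)) (act V (ppt p)) = act V (ppt p).
  by rewrite (actM uV uUV dV) (actM uU uVi dV) (act_inv uV wp) eU.
have /= := rq _ uW eW.
rewrite (uconj_comp _ uV uUV) (uconj_comp _ uU uVi) (uconjK _ uV).
exact: uconj_inj.
Qed.

(** By (mT4) the stabilizer consists of matrices [V *t 1], and these commute with [1 *t phi y]. *)
Lemma prigid_pnsum y m : (0 < m)%N -> irreducible y -> prigid (pnsum y m).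
Proof.
move=> m0 iy U uU eU.
have : stab (m * deg y)%N (nsum y m) U by split.
rewrite stab_nsum // => -[V uV VU]; apply/uconj_fix => //.
by rewrite -VU /= !tensmx_mul !mul1mx !mulmx1.
Qed.

Lemma pgen_rigid_inj p q : pgen p -> pgen q -> ppt p = ppt q ->
  psim p q -> prigid p -> p = q.
Proof.
move=> gp gq epq [U uU e] rp.
have eU : act U (ppt p) = ppt p by rewrite {2}epq e.
by rewrite e /pact (rp _ uU eU) eU -mkpv_eta.
Qed.

(** Induction on the dimension, in two halves: the pairs are equivalent, because both contain a copy
    of the same irreducible y and the rests agree; and equivalent pairs coincide, because p is
    rigid. *)
Lemma pgen_inj p q : pgen p -> pgen q -> ppt p = ppt q -> p = q.
Proof.
have [n] := ubnP (pdim p); elim: n p q => // n IH p q.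
rewrite ltnS => lepn gp gq epq; have wp := pgen_wf gp; have wq := pgen_wf gq.
have [y iy yp] := ex_irreducible_tprec (ppt p); have wy := pfun_wf phi y.
have edim : pdim p = pdim q by rewrite -wp -wq epq.
have ltdim p' q' : psim p (psum p' q') -> pwf p -> pwf p' -> pwf q' -> (pdim q' < n)%N.
  move=> e w w' _; apply: leq_trans lepn; rewrite -(psim_dim e) /=.
  by rewrite -[X in (X < _)%N]add0n ltn_add2r -w' deg_gt0.
apply: pgen_rigid_inj => //.
  have yq : tprec y (ppt q) by rewrite -epq.
  have [e1|[p' gp' e1]] := pgen_split1 iy gp yp;
  have [e2|[q' gq' e2]] := pgen_split1 iy gq yq.
  - by apply: psim_trans e1 _ => //; apply: psim_sym.
  - have := psim_dim e2; rewrite -edim -(psim_dim e1) /= => /eqP.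
    by rewrite -[X in _ == X]addn0 eqn_add2l -(pgen_wf gq') -leqn0 leqNgt deg_gt0.
  - have := psim_dim e1; rewrite edim -(psim_dim e2) /= => /eqP.
    by rewrite -[X in _ == X]addn0 eqn_add2l -(pgen_wf gp') -leqn0 leqNgt deg_gt0.
  - have wp' := pgen_wf gp'; have wq' := pgen_wf gq'.
    (* (mT2) cancels y, so the rests lie over equivalent points; after moving one of them by a
       unitary, the induction hypothesis makes them equal. *)
    have eqv : tequiv (ppt p') (ppt q').
      apply: (tequiv_cancel hT (z := y)).
      apply: tequiv_trans (tequiv_sym (psim_tequiv wp e1)) _.
      by rewrite epq; exact: psim_tequiv wq e2.
    have [r p'r rq'] := tequiv_psim wp' eqv.
    have gr : pgen r by exact: pgen_sim p'r.
    have er : r = q'.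
      by apply: IH => //; rewrite (psim_dim p'r); exact: ltdim e1 _ _ _.
    apply: psim_trans e1 _ => //; apply: psim_sym => //.
    apply: psim_trans e2 _ => //.
    apply: psum_sim => //; first exact: psim_refl.
    by rewrite -er; exact: psim_sym p'r.
have [m m0 []] := pgen_split iy gp yp => [e|[q' [gq' yq' e]]].
  by apply: prigid_sim e _ => //; exact: prigid_pnsum.
have wq' := pgen_wf gq'; have wm := pnsum_wf y m0.
have ltq := ltdim _ _ e wp wm wq'.
apply: prigid_sim e _ => //.
move=> U uU eU.
have nq' : tdisjoint (nsum y m) (ppt q') by exact: tdisjoint_nsum.
have dm : deg (nsum y m) = (m * deg y)%N := wm.
have dq : deg (ppt q') = pdim q' := wq'.
have := stab_tsum hT nq'; rewrite dm dq => /(congr1 (fun A => A U)) /= eS.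
have : stab (m * deg y + pdim q')%N (tsum (nsum y m) (ppt q')) U by split.
rewrite eS => -[V [W [[uV eV] [uW eW] eUVW]]].
rewrite eUVW /= (uconj_dirsum _ _ uV uW); congr dirsum.
  exact: (prigid_pnsum m0 iy).
(* The rest is rigid by uniqueness in smaller dimension: [pact W] of [q'] is again generated and
   lies over the same point. *)
have gW : pgen (@pact _ _ q' W) by apply: pgen_sim gq' _; exists W.
have := IH (@pact _ _ q' W) q' ltq gW gq' eW.
by rewrite [RHS]mkpv_eta => /mkpv_inj[].
Qed.

Definition equiv_additive (f : msection T) :=
  (forall x (U : 'M[C]_(deg x)), U \is unitarymx ->
     @pact R T (pfun f x) U = pfun f (act U x)) /\
  (forall x y, pfun f (tsum x y) = psum (pfun f x) (pfun f y)).

Lemma core_extension : exists2 f : msection T, equiv_additive f &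
  (forall y, irreducible y -> f y = phi y) /\ (forall x, pgen (pfun f x)).
Proof.
have ex x : exists X : 'M[C]_(deg x), pgen (mkpv x X).
  have [[n [z X]] gp /= ez] := pgen_exists x.
  have := pgen_wf gp; rewrite /pwf /ppt /pdim /= => dz.
  by move: ez; rewrite /ppt /= => <-; case: n / dz in X gp *; exists X.
pose f : msection T := fun x => projT1 (cid (ex x)).
have fP x : pgen (pfun f x) := projT2 (cid (ex x)).
exists f; last split=> //.
  split=> [x U uU|x y].
    apply: pgen_inj => //; apply: pgen_sim (fP x) _; exists U => //.
  apply: pgen_inj => //; exact: pgen_sum.
move=> y iy; have := pgen_inj (fP y) (pgen_irr iy) erefl.
by move/mkpv_inj => [].
Qed.

End Generated.

(** * Limits of matrices *)

Section ComplexTopology.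
Variable R : realType.
Local Notation C := (Cx R).
Local Notation nrm := (@ComplexField.Normc.normc R).
Local Notation cRe := (@complex.Re R).
Local Notation cIm := (@complex.Im R).

Lemma normCxE (z : C) : `|z| = (nrm z)%:C%C.
Proof. by rewrite [LHS]normc_def; case: z. Qed.

Lemma nrm_ge0 (z : C) : 0 <= nrm z.
Proof. by case: z => a b; exact: sqrtr_ge0. Qed.

Lemma nrm_sq (z : C) : nrm z ^+ 2 = cRe z ^+ 2 + cIm z ^+ 2.
Proof. by case: z => a b /=; rewrite sqr_sqrtr // addr_ge0 ?sqr_ge0. Qed.

Lemma nrmM (z w : C) : nrm (z * w) = nrm z * nrm w.
Proof. exact: ComplexField.Normc.normcM. Qed.

Lemma ler_nrmD (z w : C) : nrm (z + w) <= nrm z + nrm w.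
Proof. exact: le_normcD. Qed.

Lemma nrmN (z : C) : nrm (- z) = nrm z.
Proof. exact: normcN. Qed.

Lemma nrm_eq0 (z : C) : nrm z = 0 -> z = 0.
Proof. exact: ComplexField.Normc.eq0_normc. Qed.

Lemma nrm0 : nrm (0 : C) = 0.
Proof. exact: ComplexField.Normc.normc0. Qed.

Lemma nrm1 : nrm (1 : C) = 1.
Proof. exact: ComplexField.Normc.normc1. Qed.

Lemma nrm_conj (z : C) : nrm (z^*) = nrm z.
Proof. by case: z => a b /=; rewrite sqrrN. Qed.

Lemma ler_Re_nrm (z : C) : `|cRe z| <= nrm z.
Proof.
case: z => a b /=; rewrite -sqrtr_sqr ler_wsqrtr //.
by rewrite lerDl sqr_ge0.
Qed.

Lemma ler_Im_nrm (z : C) : `|cIm z| <= nrm z.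
Proof.
case: z => a b /=; rewrite -sqrtr_sqr ler_wsqrtr //.
by rewrite lerDr sqr_ge0.
Qed.

Lemma nrm_le_ReIm (z : C) : nrm z <= `|cRe z| + `|cIm z|.
Proof.
rewrite -(ger0_norm (nrm_ge0 z)) -ler_sqr ?nnegrE ?addr_ge0 //.
rewrite real_normK ?num_real // nrm_sq sqrrD !real_normK ?num_real //.
by rewrite lerD2r lerDl mulrn_wge0 // mulr_ge0.
Qed.

(** The norm of [Cx R] takes its values in [Cx R] itself; from here on the radii are real. *)
Lemma cvgCx_nrmP (Y : Type) (F : set_system Y) {FF : Filter F} (f : Y -> C) (l : C) :
  f @ F --> l <-> forall e : R, 0 < e -> \forall x \near F, nrm (l - f x) < e.
Proof.
rewrite (cvgrPdist_lt (FF := FF)); split=> [h e e0|h e e0].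
  have e0' : 0 < (e%:C%C : C) by rewrite ltcR.
  by apply: filterS (h _ e0') => x; rewrite normCxE ltcR.
have er := gtr0_real e0; have eE := RRe_real er.
have e0' : 0 < cRe e by rewrite -ltcR eE.
by apply: filterS (h _ e0') => x; rewrite -eE normCxE ltcR.
Qed.

Lemma cvg_Re (Y : Type) (F : set_system Y) {FF : Filter F} (f : Y -> C) (l : C) :
  f @ F --> l -> (fun x => cRe (f x)) @ F --> cRe l.
Proof.
move=> /cvgCx_nrmP h; apply/cvgrPdist_lt => e e0; apply: filterS (h _ e0) => x.
apply: le_lt_trans; apply: le_trans _ (ler_Re_nrm _).
by case: (l) => a b; case: (f x).
Qed.

Lemma cvg_Im (Y : Type) (F : set_system Y) {FF : Filter F} (f : Y -> C) (l : C) :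
  f @ F --> l -> (fun x => cIm (f x)) @ F --> cIm l.
Proof.
move=> /cvgCx_nrmP h; apply/cvgrPdist_lt => e e0; apply: filterS (h _ e0) => x.
apply: le_lt_trans; apply: le_trans _ (ler_Im_nrm _).
by case: (l) => a b; case: (f x).
Qed.

Lemma cvg_Cx (Y : Type) (F : set_system Y) {FF : Filter F} (f : Y -> C) (l : C) :
  (fun x => cRe (f x)) @ F --> cRe l -> (fun x => cIm (f x)) @ F --> cIm l ->
  f @ F --> l.
Proof.
move=> /cvgrPdist_lt h1 /cvgrPdist_lt h2; apply/cvgCx_nrmP => e e0.
have e2 : 0 < e / 2 by rewrite divr_gt0.
apply: filterS2 (h1 _ e2) (h2 _ e2) => x a1 a2.
apply: le_lt_trans (nrm_le_ReIm _) _; rewrite (splitr e).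
by apply: ltrD; [move: a1|move: a2]; case: (l) => a b; case: (f x).
Qed.

Lemma cvg_nrm (Y : Type) (F : set_system Y) {FF : Filter F} (f : Y -> C) (l : C) :
  f @ F --> l -> (fun x => nrm (f x)) @ F --> nrm l.
Proof.
move=> /cvgCx_nrmP h; apply/cvgrPdist_lt => e e0; apply: filterS (h _ e0) => x.
apply: le_lt_trans; rewrite ler_norml; apply/andP; split.
  rewrite lerNl opprB lerBlDr -[nrm (l - f x)]nrmN opprB.
  by apply: le_trans _ (ler_nrmD _ _); rewrite subrK.
by rewrite lerBlDr; apply: le_trans _ (ler_nrmD _ _); rewrite subrK.
Qed.

Lemma cvg_conj (Y : Type) (F : set_system Y) {FF : Filter F} (f : Y -> C) (l : C) :
  f @ F --> l -> (fun x => (f x)^*) @ F --> l^*.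
Proof.
move=> /cvgCx_nrmP h; apply/cvgCx_nrmP => e e0; apply: filterS (h _ e0) => x.
by rewrite -rmorphB nrm_conj.
Qed.

End ComplexTopology.

Section MatrixTopology.
Variable R : realType.
Local Notation C := (Cx R).
Variables (Y : Type) (F : set_system Y).
Context {FF : Filter F}.

Lemma cvg_mxP m n (f : Y -> 'M[C]_(m, n)) (X : 'M[C]_(m, n)) :
  f @ F --> X <-> forall i j, (fun y => f y i j) @ F --> X i j.
Proof.
split=> [h i j|h].
  apply: (cvg_comp f (fun M : 'M[C]_(m, n) => M i j) h).
  exact: coord_continuous.
move=> A [P nP sPA]; rewrite /nbhs /=.
have : \forall y \near F, forall ij : 'I_m * 'I_n, P ij.1 ij.2 (f y ij.1 ij.2).
  by apply: filter_forall => -[i j]; exact: (h i j).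
by apply: filterS => y Py; apply: sPA => i j; exact: (Py (i, j)).
Qed.

Lemma cvg_mxD m n (f g : Y -> 'M[C]_(m, n)) (X Z : 'M[C]_(m, n)) :
  f @ F --> X -> g @ F --> Z -> (fun y => f y + g y) @ F --> X + Z.
Proof.
move=> /cvg_mxP hf /cvg_mxP hg; apply/cvg_mxP => i j; rewrite mxE.
under eq_fun do rewrite mxE.
exact: (cvgD (hf i j) (hg i j)).
Qed.

Lemma cvg_mxN m n (f : Y -> 'M[C]_(m, n)) (X : 'M[C]_(m, n)) :
  f @ F --> X -> (fun y => - f y) @ F --> - X.
Proof.
move=> /cvg_mxP hf; apply/cvg_mxP => i j; rewrite mxE.
by under eq_fun do rewrite mxE; exact: (cvgN (hf i j)).
Qed.

Lemma cvg_mxB m n (f g : Y -> 'M[C]_(m, n)) (X Z : 'M[C]_(m, n)) :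
  f @ F --> X -> g @ F --> Z -> (fun y => f y - g y) @ F --> X - Z.
Proof. by move=> hf hg; exact: cvg_mxD hf (cvg_mxN hg). Qed.

Lemma cvg_bigsum (K : numFieldType) (I : Type) (r : seq I) (f : I -> Y -> K) (l : I -> K) :
  (forall i, f i @ F --> l i) ->
  (fun y => \sum_(i <- r) f i y) @ F --> \sum_(i <- r) l i.
Proof.
move=> h; elim: r => [|i r IH].
  by rewrite big_nil; under eq_fun do rewrite big_nil; exact: cvg_cst.
by rewrite big_cons; under eq_fun do rewrite big_cons; exact: (cvgD (h i) IH).
Qed.

Lemma cvg_cprod (I : Type) (r : seq I) (f : I -> Y -> C) (l : I -> C) :
  (forall i, f i @ F --> l i) ->
  (fun y => \prod_(i <- r) f i y) @ F --> \prod_(i <- r) l i.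
Proof.
move=> h; elim: r => [|i r IH].
  by rewrite big_nil; under eq_fun do rewrite big_nil; exact: cvg_cst.
by rewrite big_cons; under eq_fun do rewrite big_cons; exact: (cvgM (h i) IH).
Qed.

Lemma cvg_mxM m n p (f : Y -> 'M[C]_(m, n)) (g : Y -> 'M[C]_(n, p))
  (X : 'M[C]_(m, n)) (Z : 'M[C]_(n, p)) :
  f @ F --> X -> g @ F --> Z -> (fun y => f y *m g y) @ F --> X *m Z.
Proof.
move=> /cvg_mxP hf /cvg_mxP hg; apply/cvg_mxP => i j; rewrite mxE.
under eq_fun do rewrite mxE.
by apply: cvg_bigsum => k; exact: (cvgM (hf i k) (hg k j)).
Qed.

Lemma cvg_mxZ m n (c : C) (f : Y -> 'M[C]_(m, n)) (X : 'M[C]_(m, n)) :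
  f @ F --> X -> (fun y => c *: f y) @ F --> c *: X.
Proof.
move=> /cvg_mxP hf; apply/cvg_mxP => i j; rewrite mxE.
under eq_fun do rewrite mxE.
exact: (cvgM (cvg_cst c) (hf i j)).
Qed.

Lemma cvg_mx_tC m n (f : Y -> 'M[C]_(m, n)) (X : 'M[C]_(m, n)) :
  f @ F --> X -> (fun y => (f y)^t*) @ F --> X^t*.
Proof.
move=> /cvg_mxP hf; apply/cvg_mxP => i j; rewrite !mxE.
under eq_fun do rewrite !mxE.
exact: (cvg_conj (hf j i)).
Qed.

Lemma cvg_det n (f : Y -> 'M[C]_n) (X : 'M[C]_n) :
  f @ F --> X -> (fun y => \det (f y)) @ F --> \det X.
Proof.
move=> /cvg_mxP hf; rewrite /determinant; apply: cvg_bigsum => s.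
apply: cvgM; first exact: cvg_cst.
by apply: cvg_cprod => i; exact: hf.
Qed.

Lemma cvg_invmx n (f : Y -> 'M[C]_n) (X : 'M[C]_n) : X \in unitmx ->
  (forall y, f y \in unitmx) ->
  f @ F --> X -> (fun y => invmx (f y)) @ F --> invmx X.
Proof.
move=> uX uf hf; apply/cvg_mxP => i j; rewrite /invmx uX mxE.
have -> : (fun y => (if f y \in unitmx then (\det (f y))^-1 *: \adj (f y) else f y) i j)
        = (fun y => (\det (f y))^-1 * cofactor (f y) j i).
  by apply/funext => y; rewrite uf !mxE.
rewrite mxE; apply: cvgM.
  apply: cvgV; last exact: (cvg_det hf).
  by move: uX; rewrite unitmxE unitfE.
rewrite /cofactor; apply: cvgM; first exact: cvg_cst.
apply: cvg_det; apply/cvg_mxP => k l; rewrite !mxE.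
under eq_fun do rewrite !mxE.
by move/cvg_mxP: hf; exact.
Qed.

Lemma cvg_uconj n (f g : Y -> 'M[C]_n) (X Z : 'M[C]_n) : X \is unitarymx ->
  (forall y, f y \is unitarymx) ->
  f @ F --> X -> g @ F --> Z -> (fun y => uconj (f y) (g y)) @ F --> uconj X Z.
Proof.
move=> uX uf hf hg; apply: (cvg_mxM (cvg_mxM hf hg)).
apply: cvg_invmx hf; first exact: unitarymx_unit.
by move=> y; exact: unitarymx_unit (uf y).
Qed.

End MatrixTopology.

(** Dependent choice with an invariant [P n] along the sequence. It serves both the separating sets
    in the proof of normality and the recursion over degrees. *)
Lemma dependent_sequence (S : Type) (P : nat -> S -> Prop)
    (Q : nat -> S -> S -> Prop) (s0 : S) : P 0%N s0 ->
  (forall n s, P n s -> exists2 s', P n.+1 s' & Q n s s') ->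
  exists u : nat -> S, forall n, P n (u n) /\ Q n (u n) (u n.+1).
Proof.
move=> P0 H; pose step n s :=
  if pselect (P n s) is left h then projT1 (cid2 (H n s h)) else s.
have stepP n s : P n s -> P n.+1 (step n s) /\ Q n s (step n s).
  by rewrite /step; case: pselect => // h _; case: cid2.
pose u := fix u n := if n is m.+1 then step m (u m) else s0.
have uP n : P n (u n) by elim: n => //= n /stepP[].
by exists u => n; split=> //=; case: (stepP _ _ (uP n)).
Qed.

(** * Ultrafilters and normality *)

Section Ultrafilters.
Implicit Types X Y : topologicalType.

Lemma filter_setC_false (A : Type) (F : set_system A) (D : set A) :
  ProperFilter F -> F D -> F (~` D) -> False.
Proof.
by move=> PF FD FnD; have /filter_ex[x []] : F (D `&` ~` D) by exact: filterI.
Qed.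

Lemma sub_within (A : Type) (F : set_system A) (D : set A) :
  Filter F -> F `<=` within D F.
Proof. by move=> FF B FB; rewrite /within /=; apply: filterS FB => a Ba _. Qed.

Lemma ultra_fmap (A B : Type) (f : A -> B) (F : set_system A) :
  UltraFilter F -> UltraFilter (f @ F).
Proof.
move=> FU; split=> [|G PG sFG]; first exact: fmap_proper_filter.
apply/seteqP; split=> // D GD.
have [//|FnD] := in_ultra_setVsetC (f @^-1` D) FU.
have GnD : G (~` D) by apply: sFG.
by case: (filter_setC_false PG GD GnD).
Qed.

Lemma compact_ultra_cvg (A : Type) X (f : A -> X) (K : set X) (F : set_system A) :
  compact K -> UltraFilter F -> F (f @^-1` K) -> exists2 x, K x & f @ F --> x.
Proof.
rewrite compact_ultra => cK FU FK; have fU := ultra_fmap f FU.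
by have [x [Kx fx]] := cK _ fU FK; exists x.
Qed.

Lemma ultra_bigcup (A : Type) (I : eqType) (F : set_system A) (r : seq I)
    (D : I -> set A) : UltraFilter F ->
  F [set a | exists2 i, i \in r & D i a] -> exists2 i, i \in r & F (D i).
Proof.
move=> FU; elim: r => [|i r IH] h.
  by have /filter_ex[a []] := h.
have [FD|FnD] := in_ultra_setVsetC (D i) FU; first by exists i; rewrite ?mem_head.
have [|j jr FD] := IH; last by exists j => //; rewrite inE jr orbT.
apply: filterS (filterI h FnD) => a [[j]]; rewrite inE => /orP[/eqP-> //|jr Da _].
by exists j.
Qed.

(** If the preimage of W is not in G, the trace of G on its complement is proper and extends to an
    ultrafilter. Along ultrafilters every choice in a compact set converges, which replaces passing
    to a subsequence. *)
Lemma cvg_ultraP (A : Type) Y (f : A -> Y) (G : set_system A) (y : Y) :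
  ProperFilter G ->
  (forall F, UltraFilter F -> G `<=` F -> f @ F --> y) -> f @ G --> y.
Proof.
move=> PG h W Wy; apply: contrapT => nGW.
have PG' : ProperFilter (within (~` (f @^-1` W)) G).
  apply: Build_ProperFilter_ex => B GB; apply: contrapT => nB; apply: nGW.
  suff : G (f @^-1` W) by [].
  have GB' : G [set a | (~` (f @^-1` W)) a -> B a] := GB.
  apply: filterS GB' => a Ba; apply: contrapT => nWa; apply: nB.
  by exists a; apply: Ba.
have [F [FU sF]] := ultraFilterLemma PG'.
have FnW : F (~` (f @^-1` W)) by apply: sF; exact: withinT.
have FW : F (f @^-1` W).
  by apply: (h F FU _ W Wy) => B GB; apply: sF; exact: sub_within.
exact: filter_setC_false FW FnW.
Qed.

Lemma within_ultraP X Y (f : X -> Y) (A : set X) :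
  (forall (F : set_system X) x, UltraFilter F -> F A -> A x -> F --> x ->
     f @ F --> f x) ->
  {within A, continuous f}.
Proof.
move=> h; apply/subspace_continuousP => x Ax.
have PG : ProperFilter (within A (nbhs x)).
  by apply: within_nbhs_proper; exact: subset_closure.
apply: cvg_ultraP => F FU sF; apply: h => //; first by apply: sF; exact: withinT.
by move=> B xB; apply: sF; exact: sub_within.
Qed.

Lemma within_cvg X Y (f : X -> Y) (A : set X) (F : set_system X) x :
  {within A, continuous f} -> Filter F -> F A -> A x -> F --> x -> f @ F --> f x.
Proof.
move=> /subspace_continuousP cf FF FA Ax Fx W /(cf x Ax) h.
by apply: filterS (filterI FA (Fx _ h)) => a [Aa]; exact.
Qed.

Lemma closed_ultraP X (A : set X) :
  (forall (F : set_system X) x, UltraFilter F -> F A -> F --> x -> A x) -> closed A.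
Proof.
move=> h x clx; have PG := within_nbhs_proper clx.
have [F [FU sF]] := ultraFilterLemma PG.
apply: (h F) => //; first by apply: sF; exact: withinT.
by move=> B xB; apply: sF; exact: sub_within.
Qed.

Lemma cvg_comp_within (A : Type) X Y (g : A -> X) (f : X -> Y) (D : set X)
    (F : set_system A) x : Filter F ->
  {within D, continuous f} -> F (g @^-1` D) -> D x -> g @ F --> x ->
  (f \o g) @ F --> f x.
Proof.
move=> FF cf FD Dx gx; apply: (within_cvg (F := g @ F) cf) => //.
Qed.

(** The sets [W x] need not be open. Without a finite subcover the complements of finite unions
    generate a proper filter on K, and an ultrafilter above it would converge to some x in K while
    avoiding [W x]. *)
Lemma compact_finite_cover X (K : set X) (W : X -> set X) : compact K ->
  (forall x, K x -> nbhs x (W x)) ->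
  exists2 r : seq X, {in r, forall x, K x} &
    K `<=` [set y | exists2 x, x \in r & W x y].
Proof.
rewrite compact_ultra => cK KW; apply: contrapT => hn.
pose G := filter_from [set r : seq X | {in r, forall x, K x}]
  (fun r => K `\` [set y | exists2 x, x \in r & W x y]).
have PG : ProperFilter G.
  apply: filter_from_proper; last first.
    move=> r rK; apply: contrapT => h; apply: hn; exists r => // y Ky.
    by apply: contrapT => ny; apply: h; exists y.
  apply: filter_from_filter; first by exists [::].
  move=> r s rK sK; exists (r ++ s).
    by move=> x; rewrite mem_cat => /orP[/rK|/sK].
  move=> y [Ky nW]; split; split=> // -[x xr Wx]; apply: nW; exists x => //.
    by rewrite mem_cat xr.
  by rewrite mem_cat xr orbT.
have [F [FU sF]] := ultraFilterLemma PG.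
have FK : F K by apply: sF; exists [::] => // y [].
have [x [Kx Fx]] := cK F FU FK.
have Fn : F (~` W x).
  apply: sF; exists [:: x] => [y|y [_ nW] Wy]; first by rewrite inE => /eqP->.
  by apply: nW; exists x; rewrite ?mem_head.
exact: filter_setC_false (Fx _ (KW x Kx)) Fn.
Qed.

(** Otherwise each point of K has an open neighborhood outside F; finitely many of them cover K,
    their union is in F, and an ultrafilter must then contain one of them. *)
Lemma compact_ultra_nbhs X (K : set X) (F : set_system X) :
  compact K -> UltraFilter F -> (forall O, open O -> K `<=` O -> F O) ->
  exists2 x, K x & F --> x.
Proof.
move=> cK FU h; apply: contrapT => hn.
have ex x : exists O, open O /\ (K x -> O x /\ ~ F O).
  have [Kx|nKx] := pselect (K x); last by exists setT; split => //; exact: openT.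
  have : ~ (F --> x) by move=> Fx; apply: hn; exists x.
  move=> /existsNP[B /not_implyP[xB nFB]].
  move: xB; rewrite nbhsE => -[W [oW Wx] WB]; exists W; split=> // _; split=> //.
  by move=> FW; apply: nFB; exact: (filterS WB FW).
have [W WP] := choice ex.
have [x Kx|r rK cov] := compact_finite_cover (W := W) cK.
  by apply: open_nbhs_nbhs; case: (WP x) => oW /(_ Kx)[].
have FW : F [set a | exists2 i, i \in r & W i a].
  apply: h => //.
  rewrite (_ : [set a | _] = \bigcup_(i in [set` r]) W i).
    by apply: bigcup_open => i _; case: (WP i).
  by apply/seteqP; split=> a [i ir Wi]; exists i.
have [i ir FWi] := ultra_bigcup FU FW.
by case: (WP i) => _ /(_ (rK i ir))[].
Qed.

(** If all neighborhoods of K and L met, an ultrafilter containing every such intersection would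
    converge to a point of K and to a point of L. *)
Lemma compact_separation X (K L : set X) : hausdorff_space X ->
  compact K -> compact L -> K `&` L = set0 ->
  exists U V, [/\ open U, open V, K `<=` U, L `<=` V & U `&` V = set0].
Proof.
move=> hX cK cL KL; apply: contrapT => hn.
pose B := [set UV : set X * set X | [/\ open UV.1, open UV.2, K `<=` UV.1 & L `<=` UV.2]].
have PG : ProperFilter (filter_from B (fun UV => UV.1 `&` UV.2)).
  apply: filter_from_proper; last first.
    move=> [U V] [oU oV KU LV]; apply/set0P; apply/eqP => UV0.
    by apply: hn; exists U, V.
  apply: filter_from_filter; first by exists (setT, setT); split=> //; exact: openT.
  move=> [U V] [U' V'] [oU oV KU LV] [oU' oV' KU' LV'].
  exists (U `&` U', V `&` V'); last by move=> x [] [? ?] [? ?].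
  by split; [exact: openI|exact: openI|rewrite subsetI|rewrite subsetI].
have [F [FU sF]] := ultraFilterLemma PG.
have [x Kx Fx] : exists2 x, K x & F --> x.
  apply: compact_ultra_nbhs => // O oO KO; apply: sF.
  by exists (O, setT) => [|x []//]; split=> //; exact: openT.
have [y Ly Fy] : exists2 y, L y & F --> y.
  apply: compact_ultra_nbhs => // O oO LO; apply: sF.
  by exists (setT, O) => [|z []//]; split=> //; exact: openT.
have xy : x = y by exact: (@cvg_unique X hX F _ x y Fx Fy).
have : (K `&` L) x by split=> //; rewrite xy.
by rewrite KL.
Qed.

Lemma setI0_false (A : Type) (D E : set A) a : D `&` E = set0 -> D a -> E a -> False.
Proof. by move=> DE Da Ea; have : (D `&` E) a by []; rewrite DE. Qed.

(* Shrinking once more inside [M] makes both neighborhoods compact. *)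
Lemma compact_neighborhoods X (K L M : set X) : hausdorff_space X ->
  compact M -> compact K -> compact L -> K `&` L = set0 ->
  exists P Q U V, [/\ compact P /\ compact Q, P `<=` M /\ Q `<=` M, P `&` Q = set0,
    [/\ open U, K `<=` U & U `&` M `<=` P] & [/\ open V, L `<=` V & V `&` M `<=` Q]].
Proof.
move=> hX cM cK cL KL; have clM := compact_closed hX cM.
have [U [V [oU oV KU LV UV]]] := compact_separation hX cK cL KL.
have clUV : closure U `&` V = set0.
  apply/seteqP; split=> // x [clU Vx]; have [y [Uy Vy]] := clU V (open_nbhs_nbhs (conj oV Vx)).
  by case: (setI0_false UV Uy Vy).
have cP : compact (closure U `&` M).
  by rewrite setIC; apply: compact_closedI => //; exact: closed_closure.
have PL : (closure U `&` M) `&` L = set0.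
  apply/seteqP; split=> // x [[clU _] Lx]; rewrite -clUV; split=> //; exact: LV.
have [U2 [V2 [oU2 oV2 PU2 LV2 UV2]]] := compact_separation hX cP cL PL.
have clUV2 : U2 `&` closure V2 = set0.
  apply/seteqP; split=> // x [Ux clV]; have [y [Vy Uy]] := clV U2 (open_nbhs_nbhs (conj oU2 Ux)).
  by case: (setI0_false UV2 Uy Vy).
exists (closure U `&` M), (closure V2 `&` M), U, V2; split=> //.
- by split=> //; rewrite setIC; apply: compact_closedI => //; exact: closed_closure.
- apply/seteqP; split=> // x [xP [xV _]]; rewrite -clUV2; split=> //; exact: PU2.
- by split=> // x [Ux Mx]; split=> //; exact: subset_closure.
- by split=> // x [Vx Mx]; split=> //; exact: subset_closure.
Qed.

(* The separating sets are built on K_0, K_1, ... one compact at a time. *)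
Lemma property_sigma_normal (R : realType) X : hausdorff_space X -> property_sigma X ->
  normal_space X.
Proof.
move=> hX [K [Kmono Kcov Kcpt Ktop]].
have Kmon m n : (m <= n)%N -> K m `<=` K n.
  move=> mn; rewrite -(subnKC mn); elim: (n - m)%N => [|k IH]; first by rewrite addn0.
  by rewrite addnS; apply: subset_trans IH _; exact: Kmono.
have Kclosed n : closed (K n) by apply: compact_closed => //; case: (Kcpt n).
apply/(@normal_openP R) => A B clA clB AB.
pose good n (PQ : set X * set X) :=
  [/\ compact PQ.1, compact PQ.2, PQ.1 `&` PQ.2 = set0,
      PQ.1 `<=` K n /\ PQ.2 `<=` K n
    & A `&` K n `<=` PQ.1 /\ B `&` K n `<=` PQ.2].
(* Each new set contains a neighborhood, relative to [K n.+1], of the preceding one; this is what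
   makes the unions open. *)
pose ext n (PQ PQ' : set X * set X) :=
  (exists U, [/\ open U, PQ.1 `<=` U & U `&` K n.+1 `<=` PQ'.1]) /\
  (exists U, [/\ open U, PQ.2 `<=` U & U `&` K n.+1 `<=` PQ'.2]).
have cI (D : set X) n : closed D -> compact (D `&` K n).
  by move=> clD; rewrite setIC; apply: compact_closedI => //; case: (Kcpt n).
have good0 : good 0%N (A `&` K 0%N, B `&` K 0%N).
  split=> //=; [exact: cI|exact: cI| |by split=> x []].
  by rewrite setIACA AB set0I.
have step n PQ : good n PQ -> exists2 PQ', good n.+1 PQ' & ext n PQ PQ'.
  case: PQ => P Q [/= cP cQ PQ0 [PK QK] [AP BQ]].
  have c1 : compact (P `|` (A `&` K n.+1)) by apply: compactU => //; exact: cI.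
  have c2 : compact (Q `|` (B `&` K n.+1)) by apply: compactU => //; exact: cI.
  have dis : (P `|` (A `&` K n.+1)) `&` (Q `|` (B `&` K n.+1)) = set0.
    apply/seteqP; split=> // x [[Px|[Ax Kx]] [Qx|[Bx Kx']]].
    - by rewrite -PQ0.
    - by rewrite -PQ0; split=> //; apply: BQ; split=> //; exact: PK.
    - by rewrite -PQ0; split=> //; apply: AP; split=> //; exact: QK.
    - by rewrite -AB.
  have [P' [Q' [U [V [[cP' cQ'] [P'K Q'K] PQ' [oU KU UP] [oV KV VQ]]]]]] :=
    compact_neighborhoods hX (Kcpt n.+1).1 c1 c2 dis.
  exists (P', Q'); split=> //=.
  - split=> x [Dx Kx]; [apply: UP|apply: VQ]; split=> //; [apply: KU|apply: KV];
    by right.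
  - by exists U; split=> //; apply: subset_trans KU; exact: subsetUl.
  - by exists V; split=> //; apply: subset_trans KV; exact: subsetUl.
have [u uP] := dependent_sequence good0 step.
have mono1 m n : (m <= n)%N -> (u m).1 `<=` (u n).1.
  move=> mn; rewrite -(subnKC mn); elim: (n - m)%N => [|k IH]; first by rewrite addn0.
  rewrite addnS; apply: subset_trans IH _ => x ux.
  have [[_ _ _ [uK _] _] [[U [oU uU UK]] _]] := uP (m + k)%N.
  by apply: UK; split; [exact: uU|apply: Kmono; exact: uK].
have mono2 m n : (m <= n)%N -> (u m).2 `<=` (u n).2.
  move=> mn; rewrite -(subnKC mn); elim: (n - m)%N => [|k IH]; first by rewrite addn0.
  rewrite addnS; apply: subset_trans IH _ => x ux.
  have [[_ _ _ [_ uK] _] [_ [U [oU uU UK]]]] := uP (m + k)%N.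
  by apply: UK; split; [exact: uU|apply: Kmono; exact: uK].
have opn (v : nat -> set X) : (forall m n, (m <= n)%N -> v m `<=` v n) ->
    (forall n, exists U, [/\ open U, v n `<=` U & U `&` K n.+1 `<=` v n.+1]) ->
    open (\bigcup_n v n).
  move=> vm vU; rewrite -[\bigcup_n _]setCK; apply: closed_openC.
  apply/Ktop => m; have [U UP] := choice vU.
  (* A point of [K m] lies in the union iff it lies in some [U n] with m <= n: such a [U n] only
     promises points of [K n.+1], and larger n suffice because the [v n] increase. *)
  rewrite (_ : _ `&` _ = K m `&` \bigcap_(n in [set n | (m <= n)%N]) ~` U n).
    apply: closedI => //; apply: closed_bigI => n _; apply: open_closedC.
    by case: (UP n).
  apply/seteqP; split=> x [].
    move=> nx Kx; split=> // n /= mn Ux; apply: nx; exists n.+1 => //.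
    case: (UP n) => _ _; apply; split=> //.
    by apply: (Kmon m) => //; exact: leqW.
  move=> Kx nU; split=> // -[n _ vx]; apply: (nU (maxn m n)); first exact: leq_maxl.
  case: (UP (maxn m n)) => _ vU' _; apply: vU'.
  by apply: (vm n) => //; exact: leq_maxr.
exists (\bigcup_n (u n).1), (\bigcup_n (u n).2); split.
- by apply: opn => // n; case: (uP n) => _ [].
- by apply: opn => // n; case: (uP n) => _ [].
- move=> x Ax; have [n _ Kx] : (\bigcup_n K n) x by rewrite Kcov.
  by exists n => //; case: (uP n) => -[_ _ _ _ [h _]] _; apply: h.
- move=> x Bx; have [n _ Kx] : (\bigcup_n K n) x by rewrite Kcov.
  by exists n => //; case: (uP n) => -[_ _ _ _ [_ h]] _; apply: h.
- apply/seteqP; split=> // x [[m _ x1] [n _ x2]].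
  case: (uP (maxn m n)) => -[_ _ <- _ _] _; split.
    by apply: mono1 x1; exact: leq_maxl.
  by apply: mono2 x2; exact: leq_maxr.
Qed.

End Ultrafilters.

(** * Norms of matrices *)

Section HilbertSchmidt.
Variable R : realType.
Local Notation C := (Cx R).
Local Notation nrm := (@ComplexField.Normc.normc R).

(** The squared Hilbert-Schmidt norm, and on columns the squared Euclidean norm. It comes from an
    inner product, so the parallelogram law is available. *)
Definition hs m n (X : 'M[C]_(m, n)) : R := \sum_i \sum_j nrm (X i j) ^+ 2.

Lemma hs_ge0 m n (X : 'M[C]_(m, n)) : 0 <= hs X.
Proof. by apply: sumr_ge0 => i _; apply: sumr_ge0 => j _; exact: sqr_ge0. Qed.

Lemma hs_eq0 m n (X : 'M[C]_(m, n)) : hs X = 0 -> X = 0.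
Proof.
move=> /eqP; rewrite psumr_eq0 => [/allP h|i _]; last first.
  by apply: sumr_ge0 => j _; exact: sqr_ge0.
apply/matrixP => i j; rewrite mxE; apply: nrm_eq0.
have := h i (mem_index_enum i); rewrite /= psumr_eq0 => [/allP h'|k _]; last exact: sqr_ge0.
by have := h' j (mem_index_enum j); rewrite /= sqrf_eq0 => /eqP.
Qed.

Lemma hs0 m n : hs (0 : 'M[C]_(m, n)) = 0.
Proof.
rewrite /hs big1 // => i _; rewrite big1 // => j _.
by rewrite mxE nrm0 expr0n.
Qed.

Lemma ler_nrm_hs m n (X : 'M[C]_(m, n)) i j : nrm (X i j) ^+ 2 <= hs X.
Proof.
rewrite /hs (bigD1 i) //= (bigD1 j) //= -addrA lerDl addr_ge0 //.
  by apply: sumr_ge0 => k _; exact: sqr_ge0.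
by apply: sumr_ge0 => k _; apply: sumr_ge0 => l _; exact: sqr_ge0.
Qed.

Lemma nrm_parallelogram (z w : C) :
  nrm (z + w) ^+ 2 + nrm (z - w) ^+ 2 = nrm z ^+ 2 *+ 2 + nrm w ^+ 2 *+ 2.
Proof. by rewrite !nrm_sq; case: z w => [a b] [c d] /=; ring. Qed.

Lemma hs_parallelogram m n (X Y : 'M[C]_(m, n)) :
  hs (X + Y) + hs (X - Y) = hs X *+ 2 + hs Y *+ 2.
Proof.
rewrite /hs -!sumrMnl -!big_split /=; apply: eq_bigr => i _.
rewrite -!sumrMnl -!big_split /=; apply: eq_bigr => j _.
by rewrite !mxE nrm_parallelogram.
Qed.

Lemma hsZ m n (c : C) (X : 'M[C]_(m, n)) : hs (c *: X) = nrm c ^+ 2 * hs X.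
Proof.
rewrite /hs mulr_sumr; apply: eq_bigr => i _; rewrite mulr_sumr.
by apply: eq_bigr => j _; rewrite mxE nrmM exprMn.
Qed.

Lemma hsD_le m n (X Y : 'M[C]_(m, n)) : hs (X + Y) <= hs X *+ 2 + hs Y *+ 2.
Proof. by rewrite -hs_parallelogram lerDl hs_ge0. Qed.

Lemma nrm_sqC (z : C) : (nrm z ^+ 2)%:C%C = z^* * z.
Proof. by rewrite rmorphXn /= -normCxE normCK mulrC. Qed.

Lemma hs_trace m n (X : 'M[C]_(m, n)) : (hs X)%:C%C = \tr (X^t* *m X) :> C.
Proof.
rewrite /mxtrace /hs exchange_big /= rmorph_sum /=; apply: eq_bigr => j _.
by rewrite mxE rmorph_sum; apply: eq_bigr => i _; rewrite !mxE; exact: nrm_sqC.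
Qed.

Lemma hs_isometry m n p (U : 'M[C]_(p, m)) (X : 'M[C]_(m, n)) :
  U^t* *m U = 1%:M -> hs (U *m X) = hs X.
Proof.
move=> uU; apply: complexI; rewrite !hs_trace.
by rewrite trmx_mul map_mxM mulmxA -(mulmxA _ (U^t*)) uU mulmx1.
Qed.

Lemma hs_unitaryl m n (U : 'M[C]_m) (X : 'M[C]_(m, n)) : U \is unitarymx ->
  hs (U *m X) = hs X.
Proof. by move=> uU; apply: hs_isometry; exact: mulmx_tCV. Qed.

Lemma hs_tC m n (X : 'M[C]_(m, n)) : hs (X^t*) = hs X.
Proof.
rewrite /hs exchange_big /=; apply: eq_bigr => i _; apply: eq_bigr => j _.
by rewrite !mxE nrm_conj.
Qed.

Lemma hs_unitaryr m n (U : 'M[C]_n) (X : 'M[C]_(m, n)) : U \is unitarymx ->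
  hs (X *m U) = hs X.
Proof.
move=> uU; rewrite -hs_tC trmx_mul map_mxM hs_isometry ?hs_tC //.
by rewrite (trmxCK U); apply/unitarymxP.
Qed.

Lemma hs_uconj n (U X : 'M[C]_n) : U \is unitarymx -> hs (uconj U X) = hs X.
Proof.
by move=> uU; rewrite /uconj (hs_unitaryr _ (unitary_inv uU)) hs_unitaryl.
Qed.

Lemma hs_col_mx m1 m2 n (X : 'M[C]_(m1, n)) (Y : 'M[C]_(m2, n)) :
  hs (col_mx X Y) = hs X + hs Y.
Proof.
rewrite /hs big_split_ord /=; congr (_ + _); apply: eq_bigr => i _;
  apply: eq_bigr => j _; by rewrite ?col_mxEu ?col_mxEd.
Qed.

Lemma cvg_hs (Y : Type) (F : set_system Y) {FF : Filter F} m n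
    (f : Y -> 'M[C]_(m, n)) (X : 'M[C]_(m, n)) :
  f @ F --> X -> (fun y => hs (f y)) @ F --> hs X.
Proof.
move=> /cvg_mxP h; apply: cvg_bigsum => i; apply: cvg_bigsum => j.
exact: (cvgM (cvg_nrm (h i j)) (cvg_nrm (h i j))).
Qed.

(** The operator norm bound in squared form, which avoids suprema and roots; see [opnorm_leP]. *)
Definition bounded_by (M : R) n (X : 'M[C]_n) :=
  forall v : 'cV[C]_n, hs (X *m v) <= M ^+ 2 * hs v.

Lemma l2norm_sq n (v : 'cV[C]_n) : l2norm v ^+ 2 = hs v.
Proof.
rewrite /l2norm sqr_sqrtr; last by apply: sumr_ge0 => i _; exact: sqr_ge0.
by apply: eq_bigr => i _; rewrite big_ord1.
Qed.

Lemma l2norm_ge0 n (v : 'cV[C]_n) : 0 <= l2norm v.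
Proof. exact: sqrtr_ge0. Qed.

Lemma bounded_by_sum_nrm n (X : 'M[C]_n) :
  bounded_by (\sum_i \sum_j nrm (X i j)) X.
Proof.
pose r i := \sum_j nrm (X i j).
have r0 i : 0 <= r i by apply: sumr_ge0 => j _; exact: nrm_ge0.
have nsum (s : seq 'I_n) (F : 'I_n -> C) :
    nrm (\sum_(j <- s) F j) <= \sum_(j <- s) nrm (F j).
  elim: s => [|j s IH]; first by rewrite !big_nil nrm0.
  by rewrite !big_cons; apply: le_trans (ler_nrmD _ _) _; rewrite lerD2l.
rewrite -[X in bounded_by X _]/(\sum_i r i) => v.
apply: (@le_trans _ _ (\sum_i r i ^+ 2 * hs v)).
  rewrite /hs; apply: ler_sum => i _; rewrite big_ord1 -/(hs v).
  rewrite -l2norm_sq -exprMn ler_sqr ?nnegrE ?nrm_ge0 ?mulr_ge0 ?l2norm_ge0 //.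
  rewrite mxE; apply: le_trans (nsum _ _) _; rewrite mulr_suml.
  apply: ler_sum => j _; rewrite nrmM ler_wpM2l ?nrm_ge0 //.
  rewrite -ler_sqr ?nnegrE ?nrm_ge0 ?l2norm_ge0 // l2norm_sq.
  exact: ler_nrm_hs.
rewrite -mulr_suml ler_wpM2r ?hs_ge0 //.
rewrite expr2 mulr_suml; apply: ler_sum => i _; rewrite expr2 ler_wpM2l //.
by rewrite (bigD1 i) //= lerDl sumr_ge0.
Qed.

Lemma bounded_by_ex n (X : 'M[C]_n) : exists2 M, 0 <= M & bounded_by M X.
Proof.
exists (\sum_i \sum_j nrm (X i j)); last exact: bounded_by_sum_nrm.
by apply: sumr_ge0 => i _; apply: sumr_ge0 => j _; exact: nrm_ge0.
Qed.

Lemma opnorm_leP n (X : 'M[C]_n) (M : R) : 0 <= M ->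
  opnorm X <= M <-> bounded_by M X.
Proof.
move=> M0; pose S := [set l2norm (X *m v) | v in [set v : 'cV[C]_n | l2norm v <= 1]].
have S0 : S !=set0.
  exists (l2norm (X *m 0)), 0 => //=.
  by rewrite -ler_sqr ?nnegrE ?l2norm_ge0 // l2norm_sq hs0 expr1n.
have inS v : hs v <= 1 -> S (l2norm (X *m v)).
  move=> v1; exists v => //=.
  by rewrite -ler_sqr ?nnegrE ?l2norm_ge0 // l2norm_sq expr1n.
have ubS N : 0 <= N -> bounded_by N X -> ubound S N.
  move=> N0 bN _ [v /= v1 <-]; rewrite -ler_sqr ?nnegrE ?l2norm_ge0 // l2norm_sq.
  apply: le_trans (bN v) _; rewrite -[leRHS]mulr1 ler_wpM2l ?sqr_ge0 //.
  by rewrite -l2norm_sq exprn_ile1 // l2norm_ge0.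
split=> [le v|bM]; last first.
  by rewrite /opnorm -/S; apply: ge_sup => //; exact: ubS.
have [N N0 bN] := bounded_by_ex X.
have supS : has_sup S by split=> //; exists N; exact: ubS.
have [/eqP v0|v0] := boolP (hs v == 0).
  by rewrite (hs_eq0 v0) mulmx0 !hs0 mulr0.
have lv : 0 < l2norm v.
  by rewrite lt_def l2norm_ge0 andbT; apply: contraNneq v0 => e; rewrite -l2norm_sq e expr0n.
pose c : C := ((l2norm v)^-1)%:C%C.
have nc : nrm c = (l2norm v)^-1.
  by apply: complexI; rewrite -normCxE ger0_norm // ler0c invr_ge0 ltW.
have : hs (X *m (c *: v)) <= M ^+ 2.
  rewrite -l2norm_sq ler_sqr ?nnegrE ?l2norm_ge0 //; apply: le_trans le.
  apply: sup_upper_bound => //; apply: inS.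
  by rewrite hsZ nc -l2norm_sq -exprMn mulVf ?expr1n // gt_eqF.
rewrite -scalemxAr hsZ nc exprVn -l2norm_sq mulrC ler_pdivrMr ?exprn_gt0 //.
by rewrite !l2norm_sq.
Qed.

Lemma bounded_byM n (X Y : 'M[C]_n) M N :
  bounded_by M X -> bounded_by N Y -> bounded_by (M * N) (X *m Y).
Proof.
move=> bX bY v; rewrite -mulmxA; apply: le_trans (bX _) _.
by rewrite exprMn -(mulrA (M ^+ 2)); apply: ler_wpM2l; [exact: sqr_ge0|exact: bY].
Qed.

(** The crude factor 2 stems from [hsD_le]; no later argument depends on a sharp constant. *)
Lemma bounded_byD n (X Y : 'M[C]_n) M N : 0 <= M -> 0 <= N ->
  bounded_by M X -> bounded_by N Y -> bounded_by (M *+ 2 + N *+ 2) (X + Y).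
Proof.
move=> M0 N0 bX bY v; rewrite mulmxDl; apply: le_trans (hsD_le _ _) _.
apply: (@le_trans _ _ ((M ^+ 2 *+ 2 + N ^+ 2 *+ 2) * hs v)).
  by rewrite mulrDl !mulrnAl lerD // lerMn2r ?bX ?bY orbT.
rewrite ler_wpM2r ?hs_ge0 //; have := mulr_ge0 M0 N0.
have := sqr_ge0 M; have := sqr_ge0 N; rewrite !expr2; nra.
Qed.

Lemma bounded_byZ n (X : 'M[C]_n) (c : C) M :
  bounded_by M X -> bounded_by (nrm c * M) (c *: X).
Proof.
move=> bX v; rewrite -scalemxAl hsZ exprMn -(mulrA (nrm c ^+ 2)).
by apply: ler_wpM2l; [exact: sqr_ge0|exact: bX].
Qed.

Lemma bounded_by1 n : bounded_by 1 (1%:M : 'M[C]_n).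
Proof. by move=> v; rewrite mul1mx expr1n mul1r. Qed.

Lemma bounded_by_le n (X : 'M[C]_n) M N : 0 <= M -> M <= N ->
  bounded_by M X -> bounded_by N X.
Proof.
move=> M0 MN bX v; apply: le_trans (bX v) _; rewrite ler_wpM2r ?hs_ge0 //.
by rewrite ler_sqr ?nnegrE // (le_trans M0).
Qed.

Lemma bounded_by_uconj n (U X : 'M[C]_n) M : U \is unitarymx ->
  bounded_by M X -> bounded_by M (uconj U X).
Proof.
move=> uU bX v; rewrite /uconj -!mulmxA hs_unitaryl //.
by apply: le_trans (bX _) _; rewrite (hs_unitaryl _ (unitary_inv uU)).
Qed.

Lemma bounded_by_dirsum n k (X : 'M[C]_n) (Y : 'M[C]_k) M :
  bounded_by M X -> bounded_by M Y -> bounded_by M (dirsum X Y).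
Proof.
move=> bX bY v; rewrite -[v]vsubmxK /dirsum mul_block_col !mul0mx addr0 add0r.
by rewrite !hs_col_mx mulrDr lerD.
Qed.

(** Midpoint convexity of the operator norm ball, for the uniqueness of Chebyshev centers. *)
Lemma bounded_by_conv n (X Y : 'M[C]_n) M :
  bounded_by M X -> bounded_by M Y -> bounded_by M ((2^-1 : C) *: (X + Y)).
Proof.
move=> bX bY v; rewrite -scalemxAl hsZ mulmxDl.
have -> : nrm (2^-1 : C) ^+ 2 = 4^-1.
  have -> : nrm (2^-1 : C) = 2^-1.
    by apply: complexI; rewrite -normCxE ger0_norm ?invr_ge0 ?ler0n // fmorphV rmorph_nat.
  by rewrite exprVn -natrX.
have := hsD_le (X *m v) (Y *m v); have := bX v; have := bY v; lra.
Qed.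

End HilbertSchmidt.

Section BoundedMatrices.
Variable R : realType.
Local Notation C := (Cx R).
Local Notation nrm := (@ComplexField.Normc.normc R).

Lemma tCZ m n (c : C) (X : 'M[C]_(m, n)) : (c *: X)^t* = c^* *: X^t*.
Proof. by apply/matrixP => i j; rewrite !mxE rmorphM. Qed.

Lemma tCB m n (X Y : 'M[C]_(m, n)) : (X - Y)^t* = X^t* - Y^t*.
Proof. by apply/matrixP => i j; rewrite !mxE rmorphB. Qed.

Lemma tCM m n p (X : 'M[C]_(m, n)) (Y : 'M[C]_(n, p)) :
  (X *m Y)^t* = Y^t* *m X^t*.
Proof. by rewrite trmx_mul map_mxM. Qed.

Lemma trace_subZ m n (a b : 'M[C]_(m, n)) (c : C) : c^* = c ->
  \tr ((a - c *: b)^t* *m (a - c *: b)) =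
  \tr (a^t* *m a) + c * (c * \tr (b^t* *m b))
  - c * (\tr (a^t* *m b) + \tr (b^t* *m a)).
Proof.
move=> cc; rewrite tCB tCZ cc mulmxBl !mulmxBr -!scalemxAl -!scalemxAr.
have trB (Y Z : 'M[C]_n) : \tr (Y - Z) = \tr Y - \tr Z by exact: raddfB.
by rewrite !trB !mxtraceZ opprB mulrDr opprD addrACA.
Qed.

(** With w = X^* v and t = M^2, expanding 0 <= |X w - t v|^2 gives 2 t |w|^2 <= |X w|^2 + t^2 |v|^2
    <= t |w|^2 + t^2 |v|^2, which is then divided by t. *)
Lemma bounded_by_tC n (X : 'M[C]_n) M : 0 < M ->
  bounded_by M X -> bounded_by M (X^t*).
Proof.
move=> M0 bX v; have [w wE] : exists w, w = X^t* *m v by exists (X^t* *m v).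
rewrite -wE; have M2 : 0 < M ^+ 2 by rewrite exprn_gt0.
have h1 := bX w; move: (M ^+ 2) M2 h1 => t t0 h1.
have cc : (t%:C%C : C)^* = t%:C%C by exact: conjc_real.
have e : (hs (X *m w - (t%:C%C : C) *: v))%:C%C =
    (hs (X *m w) + t * (t * hs v) - t * (hs w + hs w))%:C%C :> C.
  rewrite rmorphB !rmorphD !rmorphM /= rmorphD !hs_trace trace_subZ //.
  have -> : \tr ((X *m w)^t* *m v) = \tr (w^t* *m w) by rewrite (tCM X) -mulmxA wE.
  have -> : \tr (v^t* *m (X *m w)) = \tr (w^t* *m w); last by rewrite -(hs_trace w).
  by rewrite {2}wE (tCM (X^t*)) (trmxCK X) mulmxA.
have := hs_ge0 (X *m w - (t%:C%C : C) *: v); rewrite (complexI e) => h2.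
by rewrite -(ler_pM2l t0); lra.
Qed.

Lemma bounded_below_inv n (X : 'M[C]_n) M : 0 <= M ->
  (forall v : 'cV[C]_n, hs v <= M ^+ 2 * hs (X *m v)) ->
  X \in unitmx /\ bounded_by M (invmx X).
Proof.
move=> M0 h; have uX : X \in unitmx.
  rewrite -unitmx_tr -row_free_unit -kermx_eq0; apply/rowV0P => v.
  rewrite sub_kermx => /eqP vX; apply: trmx_inj; rewrite trmx0; apply: hs_eq0.
  have := h v^T; rewrite -[X]trmxK -trmx_mul vX trmx0 hs0 mulr0 => le0.
  by apply/eqP; rewrite eq_le le0 hs_ge0.
by split=> // v; apply: le_trans (h _) _; rewrite mulKVmx.
Qed.

Lemma bounded_ultra_cvg (A : Type) (F : set_system A) m n (f : A -> 'M[C]_(m, n))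
    (r : R) : UltraFilter F -> F [set a | forall i j, nrm (f a i j) <= r] ->
  exists X : 'M[C]_(m, n), f @ F --> X.
Proof.
move=> FU Fr.
have seg (g : A -> R) : F [set a | `|g a| <= r] -> exists x : R, g @ F --> x.
  move=> Fg; have [x _ gx] : exists2 x, (`[- r, r]%classic : set R) x & g @ F --> x.
    apply: compact_ultra_cvg; first exact: segment_compact.
    by apply: filterS Fg => a /=; rewrite in_itv /= ler_norml.
  by exists x.
have ex (ij : 'I_m * 'I_n) : exists l : C, (fun a => f a ij.1 ij.2) @ F --> l.
  have [x Rx] : exists x : R, (fun a => complex.Re (f a ij.1 ij.2)) @ F --> x.
    by apply: seg; apply: filterS Fr => a h; apply: le_trans (ler_Re_nrm _) (h _ _).
  have [y Iy] : exists x : R, (fun a => complex.Im (f a ij.1 ij.2)) @ F --> x.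
    by apply: seg; apply: filterS Fr => a h; apply: le_trans (ler_Im_nrm _) (h _ _).
  by exists (x +i* y)%C; apply: cvg_Cx.
have [l lP] := choice ex.
exists (\matrix_(i, j) l (i, j)); apply/cvg_mxP => i j; rewrite mxE.
exact: (lP (i, j)).
Qed.

Lemma cvg_mx_unique (A : Type) (F : set_system A) m n (f : A -> 'M[C]_(m, n))
    (X Z : 'M[C]_(m, n)) : ProperFilter F -> f @ F --> X -> f @ F --> Z -> X = Z.
Proof.
move=> PF /cvg_mxP fX /cvg_mxP fZ; apply/matrixP => i j.
by apply: (cvg_unique (@norm_hausdorff _ C)) (fX i j) (fZ i j).
Qed.

Lemma unitary_nrm_le1 n (U : 'M[C]_n) i j : U \is unitarymx -> nrm (U i j) <= 1.
Proof.
move=> /unitarymxP uU; rewrite -(expr_le1 (n := 2)) ?nrm_ge0 //.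
have : (\sum_k nrm (U i k) ^+ 2)%:C%C = 1 :> C.
  rewrite rmorph_sum /=; transitivity ((U *m U^t*) i i); last by rewrite uU mxE eqxx.
  by rewrite mxE; apply: eq_bigr => k _; rewrite !mxE nrm_sqC mulrC.
move=> /complexI <-; rewrite (bigD1 j) //= lerDl.
by apply: sumr_ge0 => k _; exact: sqr_ge0.
Qed.

(** Compactness of the unitary group, in the form used throughout: unitaries chosen pointwise
    converge along any ultrafilter. *)
Lemma unitary_ultra_cvg (A : Type) (F : set_system A) n (u : A -> 'M[C]_n) :
  UltraFilter F -> F [set a | u a \is unitarymx] ->
  exists2 U : 'M[C]_n, U \is unitarymx & u @ F --> U.
Proof.
move=> FU Fu; have [|U uU] := @bounded_ultra_cvg A F n n u 1 FU.
  by apply: filterS Fu => a ua i j; exact: unitary_nrm_le1.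
exists U => //; apply/unitarymxP.
have c1 : (fun a => u a *m (u a)^t*) @ F --> U *m U^t*.
  exact: cvg_mxM uU (cvg_mx_tC uU).
have FF : Filter F by exact _.
apply: (cvg_mx_unique _ c1).
have c2 : (fun=> 1%:M : 'M[C]_n) @ F --> (1%:M : 'M[C]_n) by exact: cvg_cst.
apply: cvg_trans c2.
apply: (near_eq_cvg (FF := FF)); apply: filterS Fu => a /unitarymxP; exact: esym.
Qed.

Lemma bounded_by_nrm n (X : 'M[C]_n) M i j : 0 <= M -> bounded_by M X ->
  nrm (X i j) <= M.
Proof.
move=> M0 bX; rewrite -ler_sqr ?nnegrE ?nrm_ge0 //.
have := bX (delta_mx j 0); rewrite -colE.
have -> : hs (delta_mx j 0 : 'cV[C]_n) = 1.
  rewrite /hs (bigD1 j) //= big_ord1 mxE !eqxx nrm1 expr1n big1 ?addr0 // => k kj.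
  by rewrite big_ord1 mxE (negbTE kj) nrm0 expr0n.
rewrite mulr1; apply: le_trans.
by have := ler_nrm_hs (col j X) i 0; rewrite mxE.
Qed.

Lemma cvg_upper_bound (A : Type) (F : set_system A) (f : A -> R) (l M : R) :
  ProperFilter F -> f @ F --> l -> F [set a | f a <= M] -> l <= M.
Proof.
move=> PF /cvgrPdist_lt fl FM; rewrite leNgt; apply/negP => Ml.
have e0 : 0 < l - M by rewrite subr_gt0.
have /filter_ex[a [/= h1 h2]] : F ([set a | `|l - f a| < l - M] `&` [set a | f a <= M]).
  by apply: filterI FM; exact: fl.
have := le_lt_trans (ler_norm _) h1; lra.
Qed.

Lemma bounded_by_cvg (A : Type) (F : set_system A) n (f : A -> 'M[C]_n)
    (X : 'M[C]_n) M : ProperFilter F -> F [set a | bounded_by M (f a)] ->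
  f @ F --> X -> bounded_by M X.
Proof.
move=> PF Fb fX v.
have c : (fun a => hs (f a *m v)) @ F --> hs (X *m v).
  by apply: cvg_hs; exact: cvg_mxM fX (cvg_cst v).
apply: (cvg_upper_bound PF c); apply: filterS Fb => a; exact.
Qed.

End BoundedMatrices.

(** * Equivariant extension *)

Section ChebyshevCenter.
Variables (R : realType) (n : nat) (M : R).
Hypothesis M0 : 0 <= M.
Local Notation C := (Cx R).
Local Notation nrm := (@ComplexField.Normc.normc R).
Implicit Types (S : set 'M[C]_n) (c : 'M[C]_n).

Definition hs_enclosed S c (r : R) := forall X, S X -> hs (X - c) <= r.

(** The center of a smallest Hilbert-Schmidt ball around S, where r is a squared radius and only
    centers of operator norm at most M compete. The constraint keeps the norm bound; the
    Hilbert-Schmidt norm supplies strict convexity and unitary invariance. *)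
Definition chebyshev S c := bounded_by M c /\ exists2 r, hs_enclosed S c r &
  forall c' r', bounded_by M c' -> hs_enclosed S c' r' -> r <= r'.

Lemma bounded_by0 : bounded_by M (0 : 'M[C]_n).
Proof. by move=> v; rewrite mul0mx hs0 mulr_ge0 ?sqr_ge0 ?hs_ge0. Qed.

Lemma hs_enclosed_cvg S c r (A : Type) (F : set_system A) (f : A -> 'M[C]_n) :
  ProperFilter F -> f @ F --> c ->
  (forall e, 0 < e -> F [set a | hs_enclosed S (f a) (r + e)]) -> hs_enclosed S c r.
Proof.
move=> PF fc h X SX; apply/ler_addgt0Pr => e e0.
have d : (fun a => hs (X - f a)) @ F --> hs (X - c).
  exact: cvg_hs (cvg_mxB (cvg_cst X) fc).
by apply: (cvg_upper_bound PF d); apply: filterS (h e e0) => a; exact.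
Qed.

(** Nearly optimal centers stay in the compact operator norm ball, so they converge along an
    ultrafilter, and the limit attains the infimum. *)
Lemma chebyshev_exists S (r0 : R) : S !=set0 -> (forall X, S X -> hs X <= r0) ->
  exists c, chebyshev S c.
Proof.
move=> [X0 SX0] Sr0.
pose E := [set r | exists2 c, bounded_by M c & hs_enclosed S c r].
have E0 : E r0.
  by exists 0; [exact: bounded_by0 | move=> X SX; rewrite subr0; exact: Sr0].
have lbE : has_lbound E.
  by exists 0 => r [c _ /(_ _ SX0)]; apply: le_trans; exact: hs_ge0.
have iE : has_inf E by split=> //; exists r0.
pose G := filter_from [set e : R | 0 < e]
  (fun e => [set c | bounded_by M c /\ hs_enclosed S c (inf E + e)]).
have PG : ProperFilter G.
  apply: filter_from_proper; last first.
    move=> e e0; have [r [c bc Sc] lt] := inf_adherent e0 iE.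
    by exists c; split=> // X /Sc; move/le_trans; apply; exact: ltW.
  apply: filter_from_filter; first by exists 1; rewrite /= ltr01.
  move=> d e d0 e0; exists (Num.min d e); first by rewrite /= lt_min d0.
  move=> c [bc Sc]; split; split=> // X /Sc; move/le_trans; apply; rewrite lerD2l.
    by rewrite ge_min lexx.
  by rewrite ge_min lexx orbT.
have [F [FU sF]] := ultraFilterLemma PG.
have FE e : 0 < e -> F [set c | bounded_by M c /\ hs_enclosed S c (inf E + e)].
  by move=> e0; apply: sF; exists e.
have Fb : F [set c | bounded_by M c] by apply: filterS (FE _ ltr01) => c [].
have [|c Fc] := @bounded_ultra_cvg R _ F n n id M FU.
  by apply: filterS Fb => c bc i j; exact: bounded_by_nrm.
exists c; split; first exact: bounded_by_cvg Fc.
exists (inf E); last by move=> c' r' bc' Sc'; apply: ge_inf => //; exists c'.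
apply: (hs_enclosed_cvg _ Fc) => e e0; by apply: filterS (FE e e0) => c' [].
Qed.

Lemma hs_midpoint (X c c' : 'M[C]_n) :
  hs (X - (2^-1 : C) *: (c + c')) =
  2^-1 * hs (X - c) + 2^-1 * hs (X - c') - 4^-1 * hs (c' - c).
Proof.
have h2 : nrm (2^-1 : C) ^+ 2 = 4^-1.
  have -> : nrm (2^-1 : C) = 2^-1.
    by apply: complexI; rewrite -normCxE ger0_norm ?invr_ge0 ?ler0n // fmorphV rmorph_nat.
  by rewrite exprVn -natrX.
have -> : X - (2^-1 : C) *: (c + c') = (2^-1 : C) *: ((X - c) + (X - c')).
  have eX : (2^-1 : C) *: (X + X) = X.
    rewrite scalerDr -scalerDl -[RHS]scale1r; congr (_ *: _).
    by rewrite [RHS]splitr div1r.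
  by rewrite addrACA -opprD scalerBr eX.
rewrite hsZ h2; have := hs_parallelogram (X - c) (X - c').
have -> : X - c - (X - c') = c' - c by rewrite opprB addrC addrA subrK.
lra.
Qed.

(** By [hs_midpoint] the midpoint of two optimal centers would lower the squared radius by a quarter
    of their squared distance. *)
Lemma chebyshev_unique S c c' r : S !=set0 -> bounded_by M c -> bounded_by M c' ->
  hs_enclosed S c r -> hs_enclosed S c' r ->
  (forall d r', bounded_by M d -> hs_enclosed S d r' -> r <= r') -> c = c'.
Proof.
move=> [X0 SX0] bc bc' Sc Sc' rmin.
have /rmin : hs_enclosed S ((2^-1 : C) *: (c + c')) (r - 4^-1 * hs (c' - c)).
  by move=> X SX; rewrite hs_midpoint; have := Sc X SX; have := Sc' X SX; lra.
move=> /(_ (bounded_by_conv bc bc')) h; have := hs_ge0 (c' - c) => h'.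
have /hs_eq0/subr0_eq -> // : hs (c' - c) = 0.
by apply/eqP; rewrite eq_le h' andbT; lra.
Qed.

Lemma chebyshev_uconj S c (U : 'M[C]_n) : U \is unitarymx ->
  chebyshev S c -> chebyshev (uconj U @` S) (uconj U c).
Proof.
move=> uU [bc [r Sc rmin]]; split; first exact: bounded_by_uconj.
have uV := unitary_inv uU.
have uB (V X Y : 'M[C]_n) : uconj V X - uconj V Y = uconj V (X - Y).
  by rewrite /uconj mulmxBr mulmxBl.
exists r => [_ [X SX <-]|c' r' bc' Sc'].
  by rewrite uB hs_uconj //; exact: Sc.
apply: (rmin (uconj (invmx U) c')); first exact: bounded_by_uconj.
move=> X SX; rewrite -(hs_uconj _ uU) -uB uconjVK //; apply: Sc'; by exists X.
Qed.

End ChebyshevCenter.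

Lemma invmxM (R : realType) n (U V : 'M[Cx R]_n) :
  U \is unitarymx -> V \is unitarymx ->
  invmx (U *m V) = invmx V *m invmx U.
Proof.
move=> uU uV; have uUV := mul_unitarymx uU uV.
by rewrite (invmx_unitary uU) (invmx_unitary uV) (invmx_unitary uUV) (tCM U V).
Qed.

Section EquivariantExtension.
Variables (R : realType) (T : tower R) (n : nat).
Hypothesis normalT : normal_space T.
Local Notation C := (Cx R).
Local Notation Tn := [set x : T | deg x = n].

Lemma act_cvg (A : Type) (F : set_system A) (u : A -> 'M[C]_n) (g : A -> T)
    (U : 'M[C]_n) (x : T) : Filter F ->
  (forall a, u a \is unitarymx) -> U \is unitarymx -> F (g @^-1` Tn) -> deg x = n ->
  u @ F --> U -> g @ F --> x -> (fun a => act (u a) (g a)) @ F --> act U x.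
Proof.
move=> FF uu uU FT dx uF gF.
have Fu : F [set a | (u a \is unitarymx) /\ deg (g a) = n].
  by apply: filterS FT => a Ta; split; [exact: uu|exact: Ta].
exact: (@cvg_comp_within A _ _ (fun a => (u a, g a)) (fun p : 'M[C]_n * T => act p.1 p.2)
  [set p | p.1 \is unitarymx /\ deg p.2 = n] F (U, x) FF (@act_continuous R T n)
  Fu (conj uU dx) (cvg_pair uF gF)).
Qed.

Lemma tietze_matrix (S : set T) (F : T -> 'M[C]_n) (M : R) : 0 < M -> closed S ->
  {within S, continuous F} -> (forall x, S x -> bounded_by M (F x)) ->
  exists g : T -> 'M[C]_n, [/\ forall x, S x -> g x = F x, continuous g &
    exists r, forall x, hs (g x) <= r].
Proof.
move=> M0 clS cF bF.
(* [p] stands for the real or the imaginary part. *)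
have ext (p : C -> R) : (forall A (G : set_system A) (FG : Filter G) (f : A -> C) l,
      f @ G --> l -> (p \o f) @ G --> p l) ->
    (forall z, `|p z| <= ComplexField.Normc.normc z) ->
    exists e : 'I_n * 'I_n -> T -> R, forall ij, [/\ forall x, S x -> e ij x = p (F x ij.1 ij.2),
      continuous (e ij) & forall x, `|e ij x| <= M].
  move=> cp bp.
  have /choice [e eP] : forall ij : 'I_n * 'I_n, exists g : T -> R, [/\ forall x, S x -> g x = p (F x ij.1 ij.2),
      continuous g & forall x, `|g x| <= M].
    move=> ij.
    have [||g [gE cg bg]] := @continuous_bounded_extension T R normalT S clS
        (fun x => p (F x ij.1 ij.2)) M M0.
    - apply/subspace_continuousP => x Sx; apply: cp.
      by move/subspace_continuousP : cF => /(_ x Sx)/cvg_mxP; exact.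
    - move=> x Sx; apply: le_trans (bp _) _; apply: bounded_by_nrm (bF x Sx).
      exact: ltW.
    - by exists g; split=> // x Sx; rewrite gE // inE.
  by exists e.
have [re reP] := ext (@complex.Re R) (fun A G FG f l => @cvg_Re R A G FG f l) (@ler_Re_nrm R).
have [im imP] := ext (@complex.Im R) (fun A G FG f l => @cvg_Im R A G FG f l) (@ler_Im_nrm R).
exists (fun x => \matrix_(i, j) (re (i, j) x +i* im (i, j) x)%C); split.
- move=> x Sx; apply/matrixP => i j; rewrite mxE.
  have [-> // _ _] := reP (i, j); have [-> // _ _] := imP (i, j).
  by rewrite /=; case: (F x i j).
- move=> x; apply/cvg_mxP => i j; rewrite mxE; under eq_fun do rewrite mxE.
  by apply: cvg_Cx => /=; [case: (reP (i, j)) => _ c _|case: (imP (i, j)) => _ c _];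
     exact: c.
- exists (\sum_(i < n) \sum_(j < n) (M + M) ^+ 2) => x; apply: ler_sum => i _.
  apply: ler_sum => j _; rewrite mxE ler_sqr ?nnegrE ?nrm_ge0 ?addr_ge0 ?(ltW M0) //.
  apply: le_trans (nrm_le_ReIm _) _ => /=.
  by apply: lerD; [case: (reP (i, j))|case: (imP (i, j))].
Qed.

(* Instead of averaging a Tietze extension [g] over the unitary group, which
   would need Haar measure, take the Chebyshev center of the compact set of all
   matrices [U^-1.g(U.x)]; it depends equivariantly and continuously on [x]. *)
Lemma equivariant_extension (S : set T) (F : T -> 'M[C]_n) (M : R) : 0 < M ->
  closed S -> S `<=` Tn ->
  (forall x (U : 'M[C]_n), S x -> U \is unitarymx ->
     S (act U x) /\ F (act U x) = uconj U (F x)) ->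
  {within S, continuous F} -> (forall x, S x -> bounded_by M (F x)) ->
  exists G : T -> 'M[C]_n, [/\ {within Tn, continuous G},
    forall x (U : 'M[C]_n), Tn x -> U \is unitarymx -> G (act U x) = uconj U (G x),
    forall x, S x -> G x = F x & forall x, bounded_by M (G x)].
Proof.
move=> M0 clS ST eqF cF bF; have M0' := ltW M0.
have [g [gF cg [r0 gr0]]] := tietze_matrix M0 clS cF bF.
pose orb x := [set uconj (invmx U) (g (act U x)) | U in [set U : 'M[C]_n | U \is unitarymx]].
have orb0 x : orb x !=set0.
  by exists (uconj (invmx 1%:M) (g (act (1%:M : 'M[C]_n) x))), 1%:M => //; exact: unitarymx1.
have orbr x X : orb x X -> hs X <= r0.
  by move=> [U uU <-]; rewrite (hs_uconj _ (unitary_inv uU)).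
have [G GP] := choice (fun x => chebyshev_exists M0' (orb0 x) (@orbr x)).
have Guniq x c : chebyshev M (orb x) c -> G x = c.
  move=> [bc [r rc rmin]]; have [bG [r' rG rmin']] := GP x.
  have e : r' = r by apply/eqP; rewrite eq_le (rmin _ _ bG rG) (rmin' _ _ bc rc).
  by rewrite e in rG; exact: chebyshev_unique rG rc rmin.
exists G; split; last by move=> x; case: (GP x).
- have exr x : exists r, hs_enclosed (orb x) (G x) r /\
      (forall c' r', bounded_by M c' -> hs_enclosed (orb x) c' r' -> r <= r').
    by case: (GP x) => _ [r]; exists r.
  have [rr rrP] := choice exr.
  apply: within_ultraP => H x0 HU HT Tx0 Hx0; have PH : ProperFilter H by exact _.
  have [|c Hc] := @bounded_ultra_cvg R _ H n n G M HU.
    by apply: filterE => x i j; apply: bounded_by_nrm => //; case: (GP x).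
  (* Since centers are unique, continuity at x0 follows once the limit c of the centers is shown to
     be optimal for the orbit set of x0. *)
  suff -> : G x0 = c by [].
  have bc : bounded_by M c.
    by apply: bounded_by_cvg Hc; apply: filterE => x; case: (GP x).
  have clim (u : T -> 'M[C]_n) (U X0 : 'M[C]_n) (f : T -> 'M[C]_n) :
      (forall x, u x \is unitarymx) -> U \is unitarymx -> u @ H --> U -> f @ H --> X0 ->
      (fun x => hs (uconj (invmx (u x)) (g (act (u x) x)) - f x)) @ H -->
        hs (uconj (invmx U) (g (act U x0)) - X0).
    move=> uu uU uH fH; apply: cvg_hs; apply: cvg_mxB fH.
    apply: cvg_uconj; first exact: unitary_inv.
    - by move=> x; exact: (unitary_inv (uu x)).
    - apply: cvg_invmx uH; first exact: unitarymx_unit.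
      by move=> x; exact: (unitarymx_unit (uu x)).
    - apply: (cvg_comp (fun x => act (u x) x) g); last exact: cg.
      exact: act_cvg.
  (* Upper semicontinuity of the optimal radius. Where it fails, [G x0] is too far from some element
     of [orb x], given by a unitary; a limit of these unitaries yields an element of [orb x0] that
     is too far as well. *)
  have rlim e : 0 < e -> H [set x | rr x <= rr x0 + e].
    move=> e0; have [//|Hn] := in_ultra_setVsetC [set x | rr x <= rr x0 + e] HU.
    have far x : exists U : 'M[C]_n, U \is unitarymx /\ (rr x0 + e < rr x ->
        rr x0 + e < hs (uconj (invmx U) (g (act U x)) - G x0)).
      have [lt|ge] := ltP (rr x0 + e) (rr x); last first.
        by exists 1%:M; split; [exact: unitarymx1|].
      apply: contrapT => nU; have [_ rmin] := rrP x.
      have : rr x <= rr x0 + e; last by rewrite leNgt lt.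
      apply: (rmin (G x0)); first by case: (GP x0).
      move=> _ [U uU <-]; rewrite leNgt; apply/negP => lt'; apply: nU.
      by exists U.
    have [u uP] := choice far.
    have uu x : u x \is unitarymx by case: (uP x).
    have [|U uU uH] := @unitary_ultra_cvg R _ H n u HU; first exact: filterE.
    have cG : (fun=> G x0) @ H --> G x0 by exact: cvg_cst.
    have lim := clim u U (G x0) (fun=> G x0) uu uU uH cG.
    have := (rrP x0).1 (uconj (invmx U) (g (act U x0))).
    move=> /(_ (ex_intro2 _ _ U uU erefl)) le0.
    suff : rr x0 + e <= hs (uconj (invmx U) (g (act U x0)) - G x0) by lra.
    rewrite -lerN2; apply: (cvg_upper_bound PH (cvgN lim)).
    apply: filterS Hn => x /= /negP; rewrite -ltNge => lt.
    by rewrite lerN2 ltW //; case: (uP x) => _; apply.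
  have [r0P rmin0] := rrP x0; have bG0 : bounded_by M (G x0) by case: (GP x0).
  apply: (chebyshev_unique (orb0 x0) bG0 bc r0P _ rmin0).
  move=> _ [U uU <-]; apply/ler_addgt0Pr => e e0.
  have cU : (fun=> U) @ H --> U by exact: cvg_cst.
  have lim := clim (fun=> U) U c G (fun=> uU) uU cU Hc.
  apply: (cvg_upper_bound PH lim); apply: filterS (rlim e e0) => x /= le.
  by apply: le_trans le; apply: (rrP x).1; exists U.
- move=> x V dx uV; apply: Guniq; have uVi := unitary_inv uV.
  (* Substituting U V for U in the orbit turns the action on the point into a conjugation of the
     set. *)
  suff -> : orb (act V x) = uconj V @` orb x by exact: chebyshev_uconj.
  apply/seteqP; split=> [_ [U uU <-]|_ [_ [U uU <-] <-]].
    have uUV := mul_unitarymx uU uV.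
    exists (uconj (invmx (U *m V)) (g (act (U *m V) x))); first by exists (U *m V).
    rewrite (actM uU uV dx) -(uconj_comp _ uV (unitary_inv uUV)) (invmxM uU uV).
    by rewrite mulKVmx // unitarymx_unit.
  have uW := mul_unitarymx uU uVi; exists (U *m invmx V) => //.
  rewrite (actM uU uVi (deg_act uV dx)) (act_inv uV dx) (invmxM uU uVi).
  by rewrite (uconj_comp _ (unitary_inv uVi) (unitary_inv uU)) invmxK.
(* Over S the map is already equivariant, so the orbit set is the single matrix [F x], its own
   center with radius 0. *)
- move=> x Sx; apply: Guniq; have oE : orb x = [set F x].
    apply/seteqP; split=> [_ [U uU <-]|_ ->].
      have [SUx eU] := eqF x U Sx uU.
      by rewrite /= gF // eU uconjK.
    exists 1%:M; first exact: unitarymx1.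
    by rewrite act1 ?(ST _ Sx) // invmx1 uconj1 gF.
  split; first exact: bF.
  rewrite oE; exists 0 => [_ ->|c' r' _ Sc']; first by rewrite subrr hs0.
  by apply: le_trans (hs_ge0 (F x - c')) _; exact: Sc'.
Qed.

End EquivariantExtension.

Lemma filter_meet (A : Type) (F : set_system A) (D E : set A) :
  ProperFilter F -> F D -> F E -> exists a, D a /\ E a.
Proof. by move=> PF FD FE; apply: (@filter_ex _ F PF); exact: filterI. Qed.

(** * Constructing elements of the algebra of a tower *)

Section Sections.
Variables (R : realType) (T : tower R).
Local Notation C := (Cx R).
Implicit Types (f g : msection T) (x y : T).

Lemma value_in_deg f x : value_in (deg x) f x = f x.
Proof. exact: conform_mx_id. Qed.

Lemma value_in_pfun n f x (X : 'M[C]_n) : pfun f x = mkpv x X -> value_in n f x = X.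
Proof.
move=> /(congr1 (fun p => conform_mx (0 : 'M[C]_n) (pmx p))) /=.
by rewrite conform_mx_id.
Qed.

Lemma pfun_value_in n f x : deg x = n -> pfun f x = mkpv x (value_in n f x).
Proof. by move=> dx; case: n / dx; rewrite value_in_deg. Qed.

Lemma pfun_inj f g x : pfun f x = pfun g x -> f x = g x.
Proof. by move=> /mkpv_inj[]. Qed.

Lemma eq_value_in n f g x : f x = g x -> value_in n f x = value_in n g x.
Proof. by rewrite /value_in => ->. Qed.

Lemma value_in_act n f x (U : 'M[C]_n) : equiv_additive f -> U \is unitarymx ->
  deg x = n -> value_in n f (act U x) = uconj U (value_in n f x).
Proof.
move=> [ef _] + dx; case: n / dx in U * => uU.
by apply: value_in_pfun; rewrite value_in_deg -(ef x U uU).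
Qed.

Lemma value_in_tsum n k f x y : equiv_additive f -> deg x = n -> deg y = k ->
  value_in (n + k)%N f (tsum x y) = dirsum (value_in n f x) (value_in k f y).
Proof.
move=> [_ af] dx dy; case: n / dx; case: k / dy; rewrite !value_in_deg.
by apply: value_in_pfun; rewrite af.
Qed.

Lemma bounded_by_value_in n f x M : deg x = n ->
  bounded_by M (value_in n f x) <-> bounded_by M (f x).
Proof. by move=> dx; case: n / dx; rewrite value_in_deg. Qed.

Lemma bounded_by_pfun f x p M : pfun f x = p -> bounded_by M (pmx p) ->
  bounded_by M (f x).
Proof. by move=> <-. Qed.

Lemma equiv_additive_bounded f M : equiv_additive f ->
  (forall y, irreducible y -> bounded_by M (f y)) -> forall x, bounded_by M (f x).
Proof.
move=> [ef af] h; elim/tower_ind => [//|a b ba bb|x y [U uU <-] bx].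
  by apply: bounded_by_pfun (af a b) _; exact: bounded_by_dirsum.
by apply: bounded_by_pfun (esym (ef x U uU)) _; exact: bounded_by_uconj.
Qed.

Lemma in_CstarP f : in_Cstar f <->
  [/\ forall n, {within [set x | deg x = n], continuous (value_in n f)},
      equiv_additive f
    & exists2 M, 0 <= M & forall x, bounded_by M (f x)].
Proof.
split=> [[cf ef af [M bf]]|[cf [ef af] [M M0 bf]]].
  split=> //.
    split=> [x U uU|x y].
      rewrite (pfun_value_in f (deg_act uU (erefl (deg x)))) (ef x U uU).
      by rewrite /pact /uconj.
    by rewrite (pfun_value_in f (deg_tsum x y)) af.
  exists (Num.max 0 M); first by rewrite le_max lexx.
  move=> x; apply/opnorm_leP; first by rewrite le_max lexx.
  by apply: le_trans (bf x) _; rewrite le_max lexx orbT.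
split=> // [x U uU|x y|].
- by rewrite (value_in_act (conj ef af) uU) // value_in_deg.
- by rewrite value_in_tsum // !value_in_deg.
- by exists M => x; apply/opnorm_leP.
Qed.

Lemma open_deg n : open [set x : T | deg x = n].
Proof.
have : open (@deg R T @^-1` [set n]).
  by apply: open_comp => [x _|]; [exact: deg_continuous | exact: discrete_open].
by [].
Qed.

Lemma deg_ultra_cvg (F : set_system T) x n : ProperFilter F ->
  F [set x | deg x = n] -> F --> x -> deg x = n.
Proof.
move=> PF Fn Fx; have /Fx Fd : nbhs x [set y | deg y = deg x].
  by apply: open_nbhs_nbhs; split=> //; exact: open_deg.
by have [y [/= <- ->]] := filter_meet _ Fn Fd.
Qed.

End Sections.

(** * Limits of reducible elements *)

Section DegreeRecursion.
Variables (R : realType) (T : tower R) (hT : mtower T).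
Local Notation C := (Cx R).
Implicit Types (f g : msection T) (x y : T).

Lemma cvg_dirsum (A : Type) (F : set_system A) n k (f : A -> 'M[C]_n) (g : A -> 'M[C]_k)
    (X : 'M[C]_n) (Z : 'M[C]_k) : Filter F -> f @ F --> X -> g @ F --> Z ->
  (fun a => dirsum (f a) (g a)) @ F --> dirsum X Z.
Proof.
move=> FF /cvg_mxP fX /cvg_mxP gZ; apply/cvg_mxP => i j.
rewrite -(splitK i) -(splitK j).
case: (fintype.split i) => i'; case: (fintype.split j) => j' /=.
- by rewrite /dirsum block_mxEul; under eq_fun do rewrite block_mxEul; exact: fX.
- rewrite /dirsum block_mxEur; under eq_fun do rewrite block_mxEur.
  exact: (cvg_cst ((0 : 'M[C]_(n, k)) i' j')).
- rewrite /dirsum block_mxEdl; under eq_fun do rewrite block_mxEdl.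
  exact: (cvg_cst ((0 : 'M[C]_(k, n)) i' j')).
- by rewrite /dirsum block_mxEdr; under eq_fun do rewrite block_mxEdr; exact: gZ.
Qed.

(** Both halves of the closed embedding in (T1): closedness makes the limit a sum, and the embedding
    makes the summands converge. *)
Lemma tsum_ultra_cvg (A : Type) (F : set_system A) (a b : A -> T) k (z : T) :
  UltraFilter F -> F [set s | deg (a s) = k] ->
  (fun s => tsum (a s) (b s)) @ F --> z ->
  exists a0 b0, [/\ z = tsum a0 b0, deg a0 = k, a @ F --> a0 & b @ F --> b0].
Proof.
move=> FU Fk Fz; have [_ inj emb cl] := @tsum_closed_embedding R T k.
set D := [set p : T * T | deg p.1 = k] in inj emb cl.
have [[a0 b0] da0 ez] : ((fun p => tsum p.1 p.2) @` D) z.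
  apply: cl => B zB; have FB : F [set s | B (tsum (a s) (b s))] := Fz _ zB.
  have [s [ds Bs]] := filter_meet _ Fk FB.
  by exists (tsum (a s) (b s)); split=> //; exists (a s, b s).
have Fab : (fun s => (a s, b s)) @ F --> (a0, b0).
  move=> B; rewrite nbhsE => -[W [oW Wab] WB]; have [V oV eV] := emb W oW.
  have [_ Vz] : (D `&` (fun p => tsum p.1 p.2) @^-1` V) (a0, b0) by rewrite -eV.
  have FV : F [set s | V (tsum (a s) (b s))].
    by apply: Fz; apply: open_nbhs_nbhs; split; rewrite // -ez.
  suff : F [set s | B (a s, b s)] by [].
  apply: filterS (filterI Fk FV) => s [ds Vs]; apply: WB.
  have : (D `&` (fun p => tsum p.1 p.2) @^-1` V) (a s, b s) by [].
  by rewrite -eV => -[].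
exists a0, b0; split=> //.
  exact: (cvg_comp (fun s => (a s, b s)) fst Fab cvg_fst).
exact: (cvg_comp (fun s => (a s, b s)) snd Fab cvg_snd).
Qed.

(** The part of degree N where the next section may not change: reducible elements, whose values
    come from lower degrees, and the orbits of the chosen points. *)
Definition prescribed (ys : seq T) (N : nat) : set T :=
  [set x | deg x = N /\ (reducible x \/ exists2 y, y \in ys & tequiv y x)].

(** Choose for each x a unitary that splits it. The unitaries converge, hence so do the sums and
    then the summands; the values follow by continuity in lower degrees. *)
Lemma reducible_ultra_cvg f (N : nat) (H : set_system T) x0 : equiv_additive f ->
  (forall k, (k < N)%N -> {within [set x | deg x = k], continuous (value_in k f)}) ->
  UltraFilter H -> H [set x | deg x = N /\ reducible x] -> H --> x0 ->
  reducible x0 /\ value_in N f @ H --> value_in N f x0.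
Proof.
move=> ef cf HU Hred Hx0; have PH : ProperFilter H by exact _.
have HN : H [set x | deg x = N] by apply: filterS Hred => x [].
have dx0 := deg_ultra_cvg PH HN Hx0.
pose D k := [set x : T | deg x = N /\ exists (U : 'M[C]_N) a b,
  [/\ U \is unitarymx, deg a = k & act U x = tsum a b]].
(* The first summand has one of finitely many degrees, and the ultrafilter fixes one of them. *)
have [k _ HD] : exists2 k, k \in iota 0 N.+1 & H (D k).
  apply: ultra_bigcup; apply: filterS Hred => x [dx [V [a [b [uV e]]]]].
  exists (deg a).
    rewrite mem_iota /= add0n ltnS -dx -(deg_act uV erefl) e deg_tsum.
    exact: leq_addr.
  by split=> //; rewrite -dx; exists V, a, b.
have ex x : exists Uab : 'M[C]_N * T * T, Uab.1.1 \is unitarymx /\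
    (D k x -> deg Uab.1.2 = k /\ act Uab.1.1 x = tsum Uab.1.2 Uab.2).
  have [[dx [U [a [b [uU da e]]]]]|nD] := pselect (D k x).
    by exists (U, a, b).
  by exists (1%:M, x, x); split=> //; exact: unitarymx1.
have [uab uabP] := choice ex.
pose u x := (uab x).1.1; pose a x := (uab x).1.2; pose b x := (uab x).2.
have uu x : u x \is unitarymx := (uabP x).1.
have abP x : D k x -> deg (a x) = k /\ act (u x) x = tsum (a x) (b x) := (uabP x).2.
have [|U0 uU0 uH] := @unitary_ultra_cvg R _ H N u HU; first exact: filterE.
have zH : (fun x => act (u x) x) @ H --> act U0 x0 by exact: (act_cvg _ uu uU0 HN dx0 uH).
have abH : (fun x => tsum (a x) (b x)) @ H --> act U0 x0.
  apply: cvg_trans zH; apply: near_eq_cvg.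
  by apply: filterS HD => x /abP[_].
have [|a0 [b0 [ez da0 aH bH]]] := tsum_ultra_cvg (k := k) HU _ abH.
  by apply: filterS HD => x /abP[].
have eN : N = (k + deg b0)%N.
  by rewrite -da0 -deg_tsum -ez deg_act.
have red0 : reducible x0.
  by apply: (@reducibleI _ _ _ a0 b0); rewrite -ez; exact: tequivI.
split; first exact: red0.
have [l db0] : exists l, deg b0 = l by exists (deg b0).
rewrite db0 in eN.
have k0 : (0 < k)%N by rewrite -da0 deg_gt0.
have l0 : (0 < l)%N by rewrite -db0 deg_gt0.
rewrite eN in dx0; subst N.
have kN : (k < k + l)%N by rewrite -[X in (X < _)%N]addn0 ltn_add2l.
have lN : (l < k + l)%N by rewrite -[X in (X < _)%N]add0n ltn_add2r.
have HDb : H [set x | [/\ deg x = (k + l)%N, deg (a x) = k, deg (b x) = l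
                       & act (u x) x = tsum (a x) (b x)]].
  apply: filterS HD => x Dx; have [da e] := abP x Dx; have [dx _] := Dx; split=> //.
  apply/eqP; rewrite -(eqn_add2l k) -{1}da -deg_tsum -e (deg_act (uu x) dx).
  exact: eqxx.
have val x : [/\ deg x = (k + l)%N, deg (a x) = k, deg (b x) = l
                       & act (u x) x = tsum (a x) (b x)] ->
   uconj (invmx (u x)) (dirsum (value_in k f (a x)) (value_in l f (b x))) =
     value_in (k + l)%N f x.
  move=> [dx da db e]; rewrite -(value_in_tsum ef da db) -e.
  by rewrite (value_in_act ef (uu x) dx) (uconjK _ (uu x)).
have val0 : uconj (invmx U0) (dirsum (value_in k f a0) (value_in l f b0)) =
     value_in (k + l)%N f x0.
  rewrite -(value_in_tsum ef da0 db0) -ez (value_in_act ef uU0 dx0).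
  by rewrite (uconjK _ uU0).
rewrite -val0.
have : (fun x => uconj (invmx (u x)) (dirsum (value_in k f (a x)) (value_in l f (b x)))) @ H
    --> uconj (invmx U0) (dirsum (value_in k f a0) (value_in l f b0)).
  apply: cvg_uconj; first exact: unitary_inv.
  - by move=> x; exact: (unitary_inv (uu x)).
  - apply: cvg_invmx uH; first exact: unitarymx_unit.
    by move=> x; exact: (unitarymx_unit (uu x)).
  - apply: cvg_dirsum.
      apply: (cvg_comp_within _ (cf k kN) _ da0 aH).
      by apply: filterS HDb => x [].
    apply: (cvg_comp_within _ (cf l lN) _ db0 bH).
    by apply: filterS HDb => x [].
apply: cvg_trans; apply: near_eq_cvg.
by apply: filterS HDb => x; exact: val.
Qed.

(** Orbits are compact images of the unitary group, and on an orbit the value is one fixed matrix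
    conjugated by the moving unitary. *)
Lemma orbit_ultra_cvg f (N : nat) (H : set_system T) x0 y : equiv_additive f ->
  UltraFilter H -> deg y = N -> H [set x | tequiv y x] -> H --> x0 ->
  tequiv y x0 /\ value_in N f @ H --> value_in N f x0.
Proof.
move=> ef HU dy; case: N / dy => Hy Hx0; have PH : ProperFilter H by exact _.
have ex x : exists U : 'M[C]_(deg y), U \is unitarymx /\ (tequiv y x -> act U y = x).
  have [[U uU e]|ny] := pselect (tequiv y x); first by exists U.
  by exists 1%:M; split=> //; exact: unitarymx1.
have [u uP] := choice ex; have uu x : u x \is unitarymx := (uP x).1.
have [|U0 uU0 uH] := @unitary_ultra_cvg R _ H (deg y) u HU; first exact: filterE.
have yH : (fun x => act (u x) y) @ H --> act U0 y.
  by apply: (act_cvg _ uu uU0 _ erefl uH (cvg_cst y)); exact: filterE.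
have ex0 : x0 = act U0 y.
  apply: (@cvg_unique _ (@tower_hausdorff R T) H _ _ _ Hx0).
  apply: cvg_trans yH; apply: near_eq_cvg.
  by apply: filterS Hy => x yx; rewrite (uP x).2.
split; first by rewrite ex0; exact: tequivI.
rewrite ex0 (value_in_act ef uU0 erefl).
have : (fun x => uconj (u x) (value_in (deg y) f y)) @ H -->
    uconj U0 (value_in (deg y) f y).
  exact: (cvg_uconj uU0 uu uH (cvg_cst (value_in (deg y) f y))).
apply: cvg_trans; apply: near_eq_cvg.
by apply: filterS Hy => x yx; rewrite -(value_in_act ef (uu x) erefl) (uP x).2.
Qed.

Lemma prescribed_ultra_cvg f (ys : seq T) (N : nat) (H : set_system T) x0 :
  equiv_additive f ->
  (forall k, (k < N)%N -> {within [set x | deg x = k], continuous (value_in k f)}) ->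
  UltraFilter H -> H (prescribed ys N) -> H --> x0 ->
  prescribed ys N x0 /\ value_in N f @ H --> value_in N f x0.
Proof.
move=> ef cf HU Hp Hx0; have PH : ProperFilter H by exact _.
have HN : H [set x | deg x = N] by apply: filterS Hp => x [].
have dx0 := deg_ultra_cvg PH HN Hx0.
have [Hr|Hr] := in_ultra_setVsetC [set x : T | reducible x] HU.
  have [|r0 c] := reducible_ultra_cvg ef cf HU _ Hx0.
    by apply: filterS (filterI HN Hr) => x [].
  split; last exact: c.
  by split; [exact: dx0 | left].
have [|y yys Hy] := @ultra_bigcup T T H ys (fun y => [set x | tequiv y x]) HU.
  by apply: filterS (filterI Hp Hr) => x [[_ [rx nr|//]]]; case: (nr rx).
have dy : deg y = N.
  by have [x [/= <- /tequiv_deg]] := filter_meet _ HN Hy.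
have [yx0 c] := orbit_ultra_cvg ef HU dy Hy Hx0.
split; last exact: c.
by split; [exact: dx0 | right; exists y].
Qed.

End DegreeRecursion.

(** * Continuous sections with prescribed values *)

Section CstarExtension.
Variables (R : realType) (T : tower R) (hT : mtower T).
Local Notation C := (Cx R).
Implicit Types (f g : msection T) (x y : T).

Lemma mtower_normal : normal_space T.
Proof.
by apply: (property_sigma_normal R); [exact: tower_hausdorff|exact: mtower_sigma].
Qed.

Lemma within_eq (X Y : topologicalType) (A : set X) (f g : X -> Y) :
  (forall s, A s -> f s = g s) -> {within A, continuous f} ->
  {within A, continuous g}.
Proof.
move=> fg cf; apply: subspace_eq_continuous cf.
by move=> s; rewrite inE => /fg.
Qed.

Lemma prescribed_tequiv (ys : seq T) N x z : prescribed ys N x -> tequiv x z ->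
  prescribed ys N z.
Proof.
move=> [dx px] xz; split; first by rewrite (tequiv_deg xz).
case: px => [[V [a [b [uV e]]]]|[y yys yx]]; last first.
  by right; exists y => //; exact: tequiv_trans xz.
by left; apply: (@reducibleI _ _ _ a b); apply: tequiv_trans (tequiv_sym xz) _; exists V.
Qed.

Lemma reducible_split x : reducible x -> exists a b,
  [/\ tequiv (tsum a b) x, (deg a < deg x)%N & (deg b < deg x)%N].
Proof.
move=> [V [a [b [uV e]]]]; have xab : tequiv x (tsum a b) by exists V.
exists a, b; split; first exact: tequiv_sym.
  by rewrite -(tequiv_deg xab) ltn_deg_tsuml.
by rewrite -(tequiv_deg xab) ltn_deg_tsumr.
Qed.

Lemma pfun_eq_tequiv f g x z : equiv_additive f -> equiv_additive g ->
  tequiv x z -> f x = g x -> f z = g z.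
Proof.
move=> [ef _] [eg _] [U uU <-] fg; apply: pfun_inj.
by rewrite -(ef x U uU) -(eg x U uU) /pfun fg.
Qed.

Lemma pfun_eq_tsum f g a b : equiv_additive f -> equiv_additive g ->
  f a = g a -> f b = g b -> f (tsum a b) = g (tsum a b).
Proof.
move=> [_ af] [_ ag] fga fgb; apply: pfun_inj.
by rewrite af ag /pfun fga fgb.
Qed.

(** One step of the recursion: continuity is gained in degree N at the cost of the values in higher
    degrees, except at the irreducible points of ys. *)
Lemma degree_step (ys : seq T) (M : R) (N : nat) f : 0 < M ->
  equiv_additive f -> (forall x, bounded_by M (f x)) ->
  (forall k, (k < N)%N -> {within [set x | deg x = k], continuous (value_in k f)}) ->
  exists g, [/\ equiv_additive g, forall x, bounded_by M (g x),
    forall k, (k < N.+1)%N -> {within [set x | deg x = k], continuous (value_in k g)},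
    forall x, (deg x < N)%N -> g x = f x
  & {in ys, forall y, irreducible y -> g y = f y}].
Proof.
move=> M0 ef bf cf; pose S := prescribed ys N.
have key H x0 := @prescribed_ultra_cvg R T f ys N H x0 ef cf.
have [|||||G [cG eG GF bG]] := @equivariant_extension R T N mtower_normal S
    (value_in N f) M M0.
- by apply: closed_ultraP => H x HU HS Hx; case: (key H x HU HS Hx).
- by move=> x [].
- move=> x U Sx uU; have dx : deg x = N by case: Sx.
  split; last exact: value_in_act ef uU dx.
  by apply: prescribed_tequiv Sx _; exact: tequivI uU dx.
- apply: within_ultraP => H x HU HS Sx Hx.
  by case: (key H x HU HS Hx).
- by move=> x [dx _]; apply/(bounded_by_value_in _ _ dx).
(* Above degree N, [phi] keeps f on the core, so the values at ys survive; the reducible points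
   there are recomputed by [core_extension]. *)
pose phi : msection T := fun x => if deg x == N then conform_mx 0 (G x) else f x.
have phiN x : deg x = N -> value_in N phi x = G x.
  move=> dx; rewrite /value_in /phi (introT eqP dx).
  by move: (deg x) dx => k ->; rewrite !conform_mx_id.
have phiNN x : deg x != N -> phi x = f x by rewrite /phi => /negbTE ->.
have bphi x : bounded_by M (phi x).
  have [dx|nx] := eqVneq (deg x) N; last by rewrite phiNN.
  by apply/(bounded_by_value_in _ _ dx); rewrite phiN.
have ephi y (U : 'M[C]_(deg y)) : irreducible y -> U \is unitarymx ->
    @pact R T (pfun phi y) U = pfun phi (act U y).
  move=> iy uU; have dU := deg_act uU (erefl (deg y)).
  have [dy|ny] := eqVneq (deg y) N; last first.
    case: (ef) => ef1 _.
    by rewrite /pfun !phiNN ?dU // -/(pfun f y) -/(pfun f (act U y)) ef1.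
  rewrite (pfun_value_in phi dU) /pact /=; congr mkpv.
  suff h n (V : 'M[C]_n) : deg y = n -> n = N -> V \is unitarymx ->
      uconj V (value_in n phi y) = value_in n phi (act V y).
    by rewrite -(h _ _ erefl dy uU) value_in_deg.
  move=> dn eN; move: V; rewrite eN => V uV.
  by rewrite (phiN _ dy) (phiN _ (deg_act uV dy)) (eG _ _ dy uV).
have [g eg [gphi _]] := core_extension hT ephi.
exists g.
have gf x : (deg x < N)%N -> g x = f x.
  elim/tower_ind: x => [y iy lt|a b IHa IHb lt|x z xz IH lt].
  - by rewrite gphi // phiNN // ltn_eqF.
  - apply: pfun_eq_tsum => //; [apply: IHa|apply: IHb]; apply: ltn_trans lt.
      exact: ltn_deg_tsuml.
    exact: ltn_deg_tsumr.
  - by apply: (pfun_eq_tequiv eg ef xz); apply: IH; rewrite -(tequiv_deg xz).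
split=> //.
- by apply: equiv_additive_bounded => // y iy; rewrite gphi.
- move=> k; rewrite ltnS leq_eqVlt => /orP[/eqP->|kN].
    (* At a reducible x of degree N both g and G take the old value [f x]: G by prescription, g
       because it agrees with f at summands of smaller degree. *)
    apply: within_eq cG => x dx; have [rx|ix] := pselect (reducible x); last first.
      by rewrite -(phiN x dx); apply: eq_value_in; rewrite gphi.
    rewrite GF; last by split=> //; left.
    apply: eq_value_in; have [a [b [abx la lb]]] := reducible_split rx.
    apply: (pfun_eq_tequiv ef eg abx); apply: pfun_eq_tsum => //.
      by rewrite gf // -dx.
    by rewrite gf // -dx.
  apply: within_eq (cf k kN) => x dx; apply: eq_value_in; rewrite gf //.
  by rewrite dx.
- move=> y yys iy; rewrite gphi //; have [dy|ny] := eqVneq (deg y) N; last exact: phiNN.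
  have : value_in N phi y = value_in N f y.
    by rewrite phiN // GF //; split=> //; right; exists y => //; exact: tequiv_refl.
  by move: (dy) => <-; rewrite !value_in_deg.
Qed.

(** The sections produced by [degree_step] are eventually constant at each point, so their limit is
    continuous in every degree. *)
Lemma Cstar_extension (ys : seq T) (M : R) f : 0 < M ->
  equiv_additive f -> (forall x, bounded_by M (f x)) ->
  exists2 g, in_Cstar g & {in ys, forall y, irreducible y -> g y = f y}.
Proof.
move=> M0 ef bf.
pose P N g := [/\ equiv_additive g, forall x, bounded_by M (g x),
  forall k, (k < N)%N -> {within [set x | deg x = k], continuous (value_in k g)}
  & {in ys, forall y, irreducible y -> g y = f y}].
pose Q N g g' := forall x, (deg x < N)%N -> g' x = g x :> 'M[C]_(deg x).
have P0 : P 0%N f by [].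
have [N g [eg bg cg yg]|u uP] := @dependent_sequence _ P Q f P0.
  have [g' [eg' bg' cg' gg' yg']] := degree_step ys M0 eg bg cg.
  by exists g' => //; split=> // y yys iy; rewrite yg' ?yg.
have stable m N x : (deg x < N)%N -> (N <= m)%N -> u m x = u N x.
  move=> dx; elim: m => [|m IH]; first by rewrite leqn0 => /eqP ->.
  rewrite leq_eqVlt => /orP[/eqP-> //|]; rewrite ltnS => Nm.
  by rewrite -IH //; case: (uP m) => _ /(_ x); apply; exact: leq_trans Nm.
(* The shift by one is needed since [u N] is known to be continuous and final only in degrees below
   N. *)
pose g : msection T := fun x => u (deg x).+1 x.
have gE N x : (deg x < N)%N -> g x = u N x.
  by move=> lt; rewrite /g (stable N (deg x).+1).
have gu N x : (deg x < N)%N -> pfun g x = pfun (u N) x.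
  by move=> lt; rewrite /pfun (gE N).
exists g; last first.
  by move=> y yys iy; rewrite /g; case: (uP (deg y).+1) => -[_ _ _ h] _; exact: h.
apply/in_CstarP; split.
- move=> k; have [[_ _ ck _] _] := uP k.+1.
  by apply: within_eq (ck k (ltnSn k)) => x /= dx; apply: eq_value_in; rewrite (gE k.+1) // dx.
- split=> [x U uU|x y].
    have [[[eu _] _ _ _] _] := uP (deg x).+1.
    by rewrite (gu (deg x).+1 (act U x)) ?(deg_act uU) //; exact: eu.
  have [[[_ au] _ _ _] _] := uP (deg (tsum x y)).+1.
  rewrite (gu (deg (tsum x y)).+1) // au (gu (deg (tsum x y)).+1 x).
    rewrite (gu (deg (tsum x y)).+1 y) //.
    by rewrite ltnS ltnW // ltn_deg_tsumr.
  by rewrite ltnS ltnW // ltn_deg_tsuml.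
- exists M; first exact: ltW.
  by move=> x; rewrite /g; case: (uP (deg x).+1) => -[_ bu _ _] _; exact: bu.
Qed.

(** The one-fold case of (mT4): the stabilizer consists of scalars. Only the value of [phi] at y
    matters, so a constant section is taken. *)
Lemma irreducible_stab y (X U : 'M[C]_(deg y)) : irreducible y ->
  U \is unitarymx -> act U y = y -> uconj U X = X.
Proof.
move=> iy uU eU; pose phi : msection T := fun x => conform_mx 0 X.
have := @prigid_pnsum R T hT phi y 1 isT iy; rewrite pnsum1 => /(_ U uU eU).
by rewrite /pfun /phi /pmx /= conform_mx_id.
Qed.

Lemma mkpv_conform n n' (z : T) (X : 'M[C]_n) : n = n' ->
  mkpv z (conform_mx (0 : 'M[C]_n') X) = mkpv z X.
Proof. by move=> <-; rewrite conform_mx_id. Qed.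

(** Carries X along the orbit of y; the result does not depend on the chosen unitary, by
    [irreducible_stab]. *)
Lemma orbit_section y (X : 'M[C]_(deg y)) : irreducible y ->
  exists phi : msection T,
    [/\ forall U : 'M[C]_(deg y), U \is unitarymx ->
          pfun phi (act U y) = @pact R T (mkpv y X) U,
        forall z, ~ tequiv y z -> phi z = 0
      & forall z (V : 'M[C]_(deg z)), V \is unitarymx ->
          @pact R T (pfun phi z) V = pfun phi (act V z)].
Proof.
move=> iy; pose phi : msection T := fun z =>
  if pselect (tequiv y z) is left h then
    conform_mx (0 : 'M[C]_(deg z)) (uconj (projT1 (cid2 h)) X) else 0.
have phi0 z : ~ tequiv y z -> phi z = 0 by rewrite /phi; case: pselect.
have phiU (U : 'M[C]_(deg y)) : U \is unitarymx ->
    pfun phi (act U y) = @pact R T (mkpv y X) U.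
  move=> uU; have yU : tequiv y (act U y) by exists U.
  rewrite /pfun /phi; case: pselect => // h; case: cid2 => V uV eV /=.
  rewrite mkpv_conform; last by rewrite deg_act.
  rewrite /pact; congr mkpv; apply: (uconj_inj (unitary_inv uU)).
  rewrite (uconjK _ uU) -(uconj_comp _ (unitary_inv uU) uV).
  apply: (irreducible_stab _ iy (mul_unitarymx (unitary_inv uU) uV)).
  by rewrite (actM (unitary_inv uU) uV erefl) eV (act_inv uU).
exists phi; split=> // z; have [[U uU <-]|nz] := pselect (tequiv y z).
  pose E p := forall V : 'M[C]_(pdim p), V \is unitarymx ->
    @pact R T p V = pfun phi (act V (ppt p)).
  suff : E (pfun phi (act U y)) by [].
  rewrite (phiU U uU) => V uV; rewrite /= -(actM uV uU erefl).
  rewrite (phiU _ (mul_unitarymx uV uU)) /pact /= (actM uV uU erefl).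
  by rewrite (uconj_comp _ uV uU).
move=> V uV; have dV := deg_act uV (erefl (deg z)).
rewrite /pact /pfun /= phi0 //; have -> : phi (act V z) = 0.
  apply: phi0 => yz; apply: nz; apply: tequiv_trans yz _; apply: tequiv_sym.
  exact: tequivI.
rewrite /uconj mulmx0 mul0mx; move: (act V z) (deg (act V z)) dV => w k ->.
by [].
Qed.

(** The section supported on the orbit of y is extended from the core without regard to continuity
    and then repaired by [Cstar_extension], which keeps its values at y and at ys. *)
Lemma Cstar_separation (ys : seq T) y (X : 'M[C]_(deg y)) : irreducible y ->
  {in ys, forall z, irreducible z /\ ~ tequiv y z} ->
  exists f, [/\ in_Cstar f, f y = X & {in ys, forall z, f z = 0}].
Proof.
move=> iy hys; have [phi [phiU phi0 ephi]] := orbit_section X iy.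
have [N N0 bX] := bounded_by_ex X.
have M0 : 0 < N + 1 by rewrite ltr_wpDl.
have bX1 : bounded_by (N + 1) X by apply: bounded_by_le bX; rewrite ?lerDl.
have [f0 ef0 [f0phi _]] := core_extension hT (fun z V _ uV => ephi z V uV).
have phiy : phi y = X.
  have := phiU 1%:M (unitarymx1 _ _); rewrite /pact /= act1 // uconj1.
  by case/mkpv_inj.
have bf0 : forall x, bounded_by (N + 1) (f0 x).
  apply: equiv_additive_bounded => // z iz; rewrite f0phi //.
  have [[U uU <-]|nz] := pselect (tequiv y z).
    by apply: bounded_by_pfun (phiU U uU) _; exact: bounded_by_uconj.
  by rewrite phi0 //; exact: bounded_by0.
have [f Cf fE] := Cstar_extension (y :: ys) M0 ef0 bf0.
exists f; split=> //; first by rewrite fE ?mem_head // f0phi.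
move=> z zys; have [iz nz] := hys z zys.
by rewrite fE ?inE ?zys ?orbT // f0phi // phi0.
Qed.

End CstarExtension.

(** * Operations and evaluations *)

Section CstarAlgebra.
Variables (R : realType) (T : tower R).
Local Notation C := (Cx R).
Implicit Types (f g : msection T) (x y : T).

Lemma mkpv_dim n (X : 'M[C]_n) f x : mkpv x X = pfun f x -> n = deg x.
Proof. by move=> /(congr1 (@pdim R T)). Qed.

Section PointwiseOperation.
Variable o : forall n, 'M[C]_n -> 'M[C]_n -> 'M[C]_n.

Lemma mkpv_op n (X Y : 'M[C]_n) f g x : mkpv x X = pfun f x -> mkpv x Y = pfun g x ->
  mkpv x (o X Y) = pfun (fun x => o (f x) (g x)) x.
Proof.
move=> eX; have en := mkpv_dim eX; move: X Y eX; rewrite en => X Y.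
by move=> /mkpv_inj[_ ->] /mkpv_inj[_ ->].
Qed.

Lemma value_in_op n f g x : deg x = n ->
  value_in n (fun x => o (f x) (g x)) x = o (value_in n f x) (value_in n g x).
Proof. by move=> <-; rewrite !value_in_deg. Qed.

Hypothesis o_uconj : forall n (U X Y : 'M[C]_n), U \is unitarymx ->
  o (uconj U X) (uconj U Y) = uconj U (o X Y).
Hypothesis o_dirsum : forall n k (X Y : 'M[C]_n) (X' Y' : 'M[C]_k),
  o (dirsum X X') (dirsum Y Y') = dirsum (o X Y) (o X' Y').

Lemma equiv_additive_op f g : equiv_additive f -> equiv_additive g ->
  equiv_additive (fun x => o (f x) (g x)).
Proof.
move=> [ef af] [eg ag]; split=> [x U uU|x y].
  rewrite /pact /= -o_uconj //.
  by apply: mkpv_op; [exact: ef | exact: eg].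
rewrite /psum /= -o_dirsum; apply/esym.
by apply: mkpv_op; apply/esym; [exact: af | exact: ag].
Qed.

Hypothesis o_cvg : forall n (F : set_system T) (f g : T -> 'M[C]_n) (X Y : 'M[C]_n),
  Filter F -> f @ F --> X -> g @ F --> Y -> (fun x => o (f x) (g x)) @ F --> o X Y.
Hypothesis o_bounded : forall M N : R, 0 <= M -> 0 <= N -> exists2 r, 0 <= r &
  forall n (X Y : 'M[C]_n), bounded_by M X -> bounded_by N Y -> bounded_by r (o X Y).

(** Treats all pointwise operations at once; a unary one is passed as a binary one that ignores its
    second argument. *)
Lemma in_Cstar_op f g : in_Cstar f -> in_Cstar g -> in_Cstar (fun x => o (f x) (g x)).
Proof.
move=> /in_CstarP[cf ef [M M0 bf]] /in_CstarP[cg eg [N N0 bg]]; apply/in_CstarP.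
split; last 2 first.
- exact: equiv_additive_op.
- by have [r r0 br] := o_bounded M0 N0; exists r => // x; apply: br.
move=> n; apply: (@within_eq _ _ _ (fun x => o (value_in n f x) (value_in n g x))).
  by move=> x /= dx; rewrite value_in_op.
apply/subspace_continuousP => x dx; apply: o_cvg.
  by move/subspace_continuousP : (cf n); apply.
by move/subspace_continuousP : (cg n); apply.
Qed.

End PointwiseOperation.

Lemma uconjD n (U X Y : 'M[C]_n) : uconj U (X + Y) = uconj U X + uconj U Y.
Proof. by rewrite /uconj mulmxDr mulmxDl. Qed.

Lemma uconjM n (U X Y : 'M[C]_n) : U \is unitarymx ->
  uconj U (X *m Y) = uconj U X *m uconj U Y.
Proof.
by move=> uU; rewrite /uconj !mulmxA mulmxKV // unitarymx_unit.
Qed.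

Lemma uconjZ n (U X : 'M[C]_n) c : uconj U (c *: X) = c *: uconj U X.
Proof. by rewrite /uconj -scalemxAr -scalemxAl. Qed.

Lemma uconj_tC n (U X : 'M[C]_n) : U \is unitarymx ->
  uconj U (X^t*) = (uconj U X)^t*.
Proof.
move=> uU; rewrite /uconj (invmx_unitary uU).
by rewrite (tCM (U *m X)) (tCM U) (trmxCK U) mulmxA.
Qed.

Lemma dirsumD n k (X Y : 'M[C]_n) (X' Y' : 'M[C]_k) :
  dirsum X X' + dirsum Y Y' = dirsum (X + Y) (X' + Y').
Proof. by rewrite /dirsum add_block_mx !addr0. Qed.

Lemma dirsumZ n k c (X : 'M[C]_n) (X' : 'M[C]_k) :
  c *: dirsum X X' = dirsum (c *: X) (c *: X').
Proof. by rewrite /dirsum scale_block_mx !scaler0. Qed.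

Lemma in_CstarD f g : in_Cstar f -> in_Cstar g -> in_Cstar (fun x => f x + g x).
Proof.
apply: (@in_Cstar_op (fun n X Y => X + Y)) => [n U X Y _|n k X Y X' Y'|n F u v X Y FF uX vY|M N M0 N0].
- by rewrite uconjD.
- exact: dirsumD.
- exact: cvg_mxD uX vY.
- exists (M *+ 2 + N *+ 2); first by rewrite addr_ge0 // mulrn_wge0.
  by move=> n X Y; exact: bounded_byD.
Qed.

Lemma in_CstarM f g : in_Cstar f -> in_Cstar g -> in_Cstar (fun x => f x *m g x).
Proof.
apply: (@in_Cstar_op (fun n X Y => X *m Y)) => [n U X Y uU|n k X Y X' Y'|n F u v X Y FF uX vY|M N M0 N0].
- by rewrite uconjM.
- exact: dirsumM.
- exact: cvg_mxM uX vY.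
- by exists (M * N); [exact: mulr_ge0|move=> n X Y; exact: bounded_byM].
Qed.

Lemma in_CstarZ c f : in_Cstar f -> in_Cstar (fun x => c *: f x).
Proof.
move=> Cf; apply: (@in_Cstar_op (fun n X Y => c *: X) _ _ _ _ f f Cf Cf) => [n U X Y _|n k X Y X' Y'|n F u v X Y FF uX vY|M N M0 N0].
- by rewrite uconjZ.
- exact: dirsumZ.
- exact: cvg_mxZ uX.
- exists (ComplexField.Normc.normc c * M); first by rewrite mulr_ge0 ?nrm_ge0.
  by move=> n X Y bX _; exact: bounded_byZ.
Qed.

Lemma in_Cstar_tC f : in_Cstar f -> in_Cstar (fun x => (f x)^t*).
Proof.
move=> Cf; apply: (@in_Cstar_op (fun n X Y => X^t*) _ _ _ _ f f Cf Cf) => [n U X Y uU|n k X Y X' Y'|n F u v X Y FF uX vY|M N M0 N0].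
- by rewrite uconj_tC.
- exact: dirsum_tC.
- exact: cvg_mx_tC uX.
- exists (M + 1); first by rewrite addr_ge0.
  move=> n X Y bX _; apply: bounded_by_tC; first by rewrite ltr_wpDl.
  by apply: bounded_by_le bX; rewrite ?lerDl.
Qed.

Lemma in_Cstar_scalar c : in_Cstar (fun x : T => c%:M).
Proof.
apply/in_CstarP; split.
- move=> n; apply: (@within_eq _ _ _ (fun=> c%:M)).
    by move=> x /= dx; case: n / dx; rewrite value_in_deg.
  by move=> x; exact: cvg_cst.
- split=> [x U uU|x y].
    rewrite /pact /pfun /uconj /= scalar_mxC mulmxK ?unitarymx_unit //.
    by rewrite (deg_act uU).
  by rewrite /psum /pfun /= /dirsum -scalar_mx_block deg_tsum.
- have [M M0 bM] := bounded_by_ex (c%:M : 'M[C]_1).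
  exists (ComplexField.Normc.normc c); first exact: nrm_ge0.
  by move=> x; rewrite -scalemx1 -[X in bounded_by X _]mulr1; apply: bounded_byZ; exact: bounded_by1.
Qed.

Lemma in_Cstar0P f : in_Cstar0 f <-> in_Cstar f /\ forall e : R, 0 < e ->
  exists K : set T, [/\ compact K, K `<=` closure (core T)
    & forall t, (closure (core T) `\` K) t -> bounded_by e (f t)].
Proof.
split=> -[Cf h]; split=> // e e0; have [K [cK Kc hK]] := h e e0; exists K; split=> // t /hK.
  by move/opnorm_leP; apply; exact: ltW.
by move=> bt; apply/opnorm_leP => //; exact: ltW.
Qed.

Lemma in_Cstar0W f : in_Cstar0 f -> in_Cstar f. Proof. by case. Qed.

Lemma in_Cstar0D f g : in_Cstar0 f -> in_Cstar0 g -> in_Cstar0 (fun x => f x + g x).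
Proof.
move=> /in_Cstar0P[Cf hf] /in_Cstar0P[Cg hg]; apply/in_Cstar0P.
split=> [|e e0]; first exact: in_CstarD.
(* A quarter each, because [bounded_byD] doubles both bounds. *)
have e4 : 0 < e / 4 by rewrite divr_gt0.
have eE : e = (e / 4) *+ 2 + (e / 4) *+ 2 by lra.
have [K [cK Kc hK]] := hf _ e4; have [L [cL Lc hL]] := hg _ e4.
exists (K `|` L); split; first exact: compactU.
  by move=> x [/Kc|/Lc].
move=> t [ct nKL]; rewrite eE.
apply: (bounded_byD (ltW e4) (ltW e4)).
  by apply: hK; split=> // h; apply: nKL; left.
by apply: hL; split=> // h; apply: nKL; right.
Qed.

Lemma in_Cstar0Ml f g : in_Cstar f -> in_Cstar0 g -> in_Cstar0 (fun x => f x *m g x).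
Proof.
move=> Cf /in_Cstar0P[Cg hg]; have /in_CstarP[_ _ [M M0 bf]] := Cf.
apply/in_Cstar0P; split=> [|e e0]; first exact: in_CstarM.
have M1 : 0 < M + 1 by rewrite ltr_wpDl.
have [K [cK Kc hK]] := hg (e / (M + 1)) (divr_gt0 e0 M1).
exists K; split=> // t /hK bt; have -> : e = (M + 1) * (e / (M + 1)).
  by rewrite mulrC divfK // gt_eqF.
by apply: bounded_byM bt; apply: bounded_by_le (bf t); rewrite ?lerDl.
Qed.

Lemma in_Cstar0Mr f g : in_Cstar0 f -> in_Cstar g -> in_Cstar0 (fun x => f x *m g x).
Proof.
move=> /in_Cstar0P[Cf hf] Cg; have /in_CstarP[_ _ [M M0 bg]] := Cg.
apply/in_Cstar0P; split=> [|e e0]; first exact: in_CstarM.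
have M1 : 0 < M + 1 by rewrite ltr_wpDl.
have [K [cK Kc hK]] := hf (e / (M + 1)) (divr_gt0 e0 M1).
exists K; split=> // t /hK bt; have -> : e = (e / (M + 1)) * (M + 1).
  by rewrite divfK // gt_eqF.
by apply: (bounded_byM bt); apply: bounded_by_le (bg t); rewrite ?lerDl.
Qed.

Lemma in_Cstar0M f g : in_Cstar0 f -> in_Cstar0 g -> in_Cstar0 (fun x => f x *m g x).
Proof. by move=> /in_Cstar0W; exact: in_Cstar0Ml. Qed.

Lemma in_Cstar0Z c f : in_Cstar0 f -> in_Cstar0 (fun x => c *: f x).
Proof.
move=> h; have := in_Cstar0Ml (in_Cstar_scalar c) h.
by rewrite (_ : (fun x => _) = (fun x => c *: f x)) //; apply/functional_extensionality_dep => x; rewrite mul_scalar_mx.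
Qed.

Lemma in_Cstar0_tC f : in_Cstar0 f -> in_Cstar0 (fun x => (f x)^t*).
Proof.
move=> /in_Cstar0P[Cf hf]; apply/in_Cstar0P; split=> [|e e0]; first exact: in_Cstar_tC.
by have [K [cK Kc hK]] := hf e e0; exists K; split=> // t /hK; exact: bounded_by_tC.
Qed.

Lemma in_Cstar0_0 : in_Cstar0 (fun x : T => 0).
Proof.
apply/in_Cstar0P; split=> [|e e0].
  have := in_Cstar_scalar 0; rewrite (_ : (fun x => _) = (fun x : T => 0)) //.
  by apply/functional_extensionality_dep => x; rewrite scalemx0 || rewrite raddf0.
exists set0; split=> // [|t _]; first exact: compact0.
exact: bounded_by0.
Qed.

Lemma in_Cstar_inv f (M : R) : in_Cstar f -> 0 <= M ->
  (forall x (v : 'cV[C]_(deg x)), hs v <= M ^+ 2 * hs (f x *m v)) ->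
  in_Cstar (fun x => invmx (f x)).
Proof.
move=> /in_CstarP[cf ef _] M0 low.
have uf x : f x \in unitmx by case: (bounded_below_inv M0 (low x)).
have uv n x : deg x = n -> value_in n f x \in unitmx.
  by move=> dx; case: n / dx; rewrite value_in_deg.
apply/in_CstarP; split; last first.
- by exists M => // x; case: (bounded_below_inv M0 (low x)).
- split=> [x U uU|x y].
    case: (ef) => /(_ x U uU) efx _; rewrite /pact /=.
    have -> : uconj U (invmx (f x)) = invmx (uconj U (f x)).
      have uc : uconj U (f x) \in unitmx.
        by rewrite /uconj !unitmx_mul unitmx_inv uf !unitarymx_unit.
      apply: (can_inj (mulKmx uc)); rewrite mulmxV // -uconjM // mulmxV //.
      by rewrite /uconj mulmx1 mulmxV // unitarymx_unit.
    exact: (@mkpv_op (fun n X Y => invmx X) _ _ _ f f _ efx efx).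
  case: (ef) => _ /(_ x y) afx; rewrite /psum /=.
  have -> : dirsum (invmx (f x)) (invmx (f y)) = invmx (dirsum (f x) (f y)).
    have e : dirsum (f x) (f y) *m dirsum (invmx (f x)) (invmx (f y)) = 1%:M.
      by rewrite dirsumM !mulmxV // dirsum1.
    have [uc _] := mulmx1_unit e.
    by apply: (can_inj (mulKmx uc)); rewrite e mulmxV.
  apply/esym; exact: (@mkpv_op (fun n X Y => invmx X) _ _ _ f f _ (esym afx) (esym afx)).
(* The default 1 off degree n makes every value invertible, as [cvg_invmx] requires. *)
move=> n; pose f' (x : T) := if deg x == n then value_in n f x else 1%:M.
apply: (@within_eq _ _ _ (fun x => invmx (f' x))).
  move=> x /= dx; rewrite /f' (introT eqP dx).
  by rewrite (@value_in_op (fun n X Y => invmx X) n f f x dx).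
have uf' x : f' x \in unitmx.
  by rewrite /f'; case: eqP => [dx|_]; [exact: uv | exact: unitmx1].
have cf' : {within [set x | deg x = n], continuous f'}.
  by apply: within_eq (cf n) => x /= dx; rewrite /f' (introT eqP dx).
apply/subspace_continuousP => x dx; apply: cvg_invmx => //.
by move/subspace_continuousP : cf'; apply.
Qed.

End CstarAlgebra.

(** * Values at a point and its decomposition *)

Section Evaluation.
Variables (R : realType) (T : tower R) (hT : mtower T).
Local Notation C := (Cx R).
Implicit Types (f g : msection T) (x y z w t a b : T).

Lemma in_Cstar_equiv f : in_Cstar f -> equiv_additive f.
Proof. by move=> /in_CstarP[]. Qed.

Lemma eq_tprec f g a z : equiv_additive f -> equiv_additive g -> tprec a z ->
  f z = g z -> f a = g a.
Proof.
move=> ef eg [az|[c [b [ac zcb]]]] fg.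
  by apply: (pfun_eq_tequiv ef eg (tequiv_sym az)).
apply: (pfun_eq_tequiv ef eg (tequiv_sym ac)).
have fg' := pfun_eq_tequiv ef eg zcb fg.
have := value_in_tsum ef (erefl (deg c)) (erefl (deg b)).
rewrite (eq_value_in _ fg') (value_in_tsum eg erefl erefl) !value_in_deg.
by move=> /dirsum_inj[].
Qed.

(** Reduces vanishing at w to vanishing at finitely many irreducible points, to which
    [Cstar_separation] applies. *)
Lemma components w : exists ys : seq T,
  {in ys, forall z, irreducible z /\ tprec z w} /\
  forall f, equiv_additive f -> {in ys, forall z, f z = 0} -> f w = 0.
Proof.
have e0 : equiv_additive (fun x : T => 0 : 'M[C]_(deg x)).
  by apply: in_Cstar_equiv; apply: in_Cstar0W; exact: in_Cstar0_0.
elim/tower_ind: w => [y iy|a b [r [rP r0]] [s [sP s0]]|x z xz [r [rP r0]]].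
- exists [:: y]; split=> [z|f _ h]; last exact: h (mem_head _ _).
  by rewrite inE => /eqP ->; split=> //; exact: tprec_refl.
- exists (r ++ s); split=> [z|f ef h].
    rewrite mem_cat => /orP[/rP|/sP] [iz zp]; split=> //.
      exact: tprec_suml.
    exact: tprec_sumr.
  apply: (pfun_eq_tsum ef e0); [apply: r0 => // z zr|apply: s0 => // z zs];
    by apply: h; rewrite mem_cat ?zr ?zs ?orbT.
- exists r; split=> [z' /rP[iz zp]|f ef h].
    by split=> //; exact: tprec_tequivr xz.
  by apply: (pfun_eq_tequiv ef e0 xz); exact: r0.
Qed.

Lemma Cstar_separation_disjoint y w (X : 'M[C]_(deg y)) : irreducible y ->
  tdisjoint y w -> exists f, [/\ in_Cstar f, f y = X & f w = 0].
Proof.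
move=> iy yw; have [ys [ysP ys0]] := components w.
have [|f [Cf fy f0]] := @Cstar_separation R T hT ys y X iy.
  move=> z /ysP[iz zw]; split=> // yz; have [h _] := irreducible_disjointP w iy.
  by move/(irreducible_disjointP w iy) : yw; apply; exact: tprec_tequivl zw.
by exists f; split=> //; apply: ys0 => //; exact: in_Cstar_equiv.
Qed.

Lemma Cstar_value y (X : 'M[C]_(deg y)) : irreducible y ->
  exists2 f, in_Cstar f & f y = X.
Proof. by move=> iy; have [//|f [Cf fy _]] := @Cstar_separation R T hT [::] y X iy; exists f. Qed.

(* [C*_0(T)] is an ideal, and the only ideals of [M_d] are [0] and [M_d]. *)
Lemma Cstar0_value y (X : 'M[C]_(deg y)) : irreducible y -> ~ vanishing T y ->
  exists2 f, in_Cstar0 f & f y = X.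
Proof.
move=> iy ny.
have [f Af fy] : exists2 f, in_Cstar0 f & f y != 0.
  apply: contrapT => h; apply: ny => f Af; apply/eqP; apply: contrapT => /negP fy.
  by apply: h; exists f.
have [[a b] fab] : exists ij : 'I_(deg y) * 'I_(deg y), f y ij.1 ij.2 != 0.
  apply: contrapT => h; move: fy; rewrite (_ : f y = 0) ?eqxx //.
  apply/matrixP => i j; rewrite mxE; apply/eqP; apply: contrapT => /negP fij.
  by apply: h; exists (i, j).
pose S := [set Z : 'M[C]_(deg y) | exists2 g, in_Cstar0 g & g y = Z].
suff : S X by [].
have SD Y Z : S Y -> S Z -> S (Y + Z).
  by move=> [g Ag <-] [h Ah <-]; exists (fun x => g x + h x); first exact: in_Cstar0D Ag Ah.
have S0 : S 0 by exists (fun x => 0); first exact: in_Cstar0_0.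
have SZ c Z : S Z -> S (c *: Z).
  by move=> [g Ag <-]; exists (fun x => c *: g x); first exact: in_Cstar0Z.
have SM P Z Q : S Z -> S (P *m Z *m Q).
  move=> [g Ag <-]; have [p Cp <-] := Cstar_value P iy; have [q Cq <-] := Cstar_value Q iy.
  by exists (fun x => p x *m g x *m q x); first exact: in_Cstar0Mr (in_Cstar0Ml Cp Ag) Cq.
(* E_ia Z E_bj = Z_ab E_ij, applied to Z = [f y] and a nonzero entry of it. *)
have Sd i j : S (delta_mx i j).
  have : S ((f y a b)^-1 *: (delta_mx i a *m f y *m delta_mx b j)).
    by apply: SZ; apply: SM; exists f.
  rewrite (_ : delta_mx i a *m f y *m delta_mx b j = f y a b *: delta_mx i j).
    by rewrite scalerA mulVf ?scale1r.
  rewrite -(mul_delta_mx (0 : 'I_1) i a) -(mul_delta_mx (0 : 'I_1) b j).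
  have mid : delta_mx (0 : 'I_1) a *m f y *m delta_mx b (0 : 'I_1) = (f y a b)%:M.
    by rewrite -rowE -colE [LHS]mx11_scalar !mxE.
  transitivity (delta_mx i (0 : 'I_1) *m
      (delta_mx (0 : 'I_1) a *m f y *m delta_mx b (0 : 'I_1)) *m delta_mx (0 : 'I_1) j).
    by rewrite !mulmxA.
  by rewrite mid mul_mx_scalar -scalemxAl mul_delta_mx.
rewrite (matrix_sum_delta X).
by apply: big_ind => // i _; apply: big_ind => // j _; exact: SZ.
Qed.

Lemma pfun_nsum f y m : equiv_additive f -> (0 < m)%N ->
  pfun f (nsum y m) = pnsum f y m.
Proof.
move=> [_ af]; case: m => // m _; elim: m => [|m IH]; first by rewrite pnsum1.
by rewrite -pnsumS // -IH -af.
Qed.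

Lemma value_in_nsum f y m : equiv_additive f -> (0 < m)%N ->
  value_in (m * deg y)%N f (nsum y m) = (1%:M : 'M[C]_m) *t f y.
Proof. by move=> ef m0; apply: value_in_pfun; rewrite pfun_nsum. Qed.

(** The splitting of generated pairs, applied to the zero section, where only the points carry
    information. *)
Lemma point_split y t : irreducible y -> tprec y t ->
  exists2 m, (0 < m)%N & tequiv t (nsum y m) \/
    exists2 w, tdisjoint y w & tequiv t (tsum (nsum y m) w).
Proof.
move=> iy yt; have e0 : equiv_additive (fun x : T => 0 : 'M[C]_(deg x)).
  by apply: in_Cstar_equiv; apply: in_Cstar0W; exact: in_Cstar0_0.
have h z (U : 'M[C]_(deg z)) : irreducible z -> U \is unitarymx ->
    @pact R T (pfun (fun=> 0) z) U = pfun (fun=> 0) (act U z).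
  by move=> _ uU; case: e0 => ef _; exact: ef.
have [p gp pt] := pgen_exists (fun x : T => 0 : 'M[C]_(deg x)) t.
have yp : tprec y (ppt p) by rewrite pt.
have wp := pgen_wf gp.
have [m m0 [e|[q [gq yq e]]]] := pgen_split hT h iy gp yp; exists m => //.
  by left; rewrite -pt; exact: psim_tequiv wp e.
by right; exists (ppt q) => //; rewrite -pt; exact: psim_tequiv wp e.
Qed.

(** The commutant of 1 tensor M_d is M_m tensor 1. Commuting with the matrix units gives [key]; its
    case j = q = [i0] says that the entry of V at (a,i), (b,p) is 0 unless i = p and is otherwise
    independent of i. *)
Lemma tens_commutant m d (V : 'M[C]_(m * d)) : (0 < d)%N -> V \is unitarymx ->
  (forall X : 'M[C]_d, V *m ((1%:M : 'M[C]_m) *t X) = ((1%:M : 'M[C]_m) *t X) *m V) ->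
  exists2 W : 'M[C]_m, W \is unitarymx & V = W *t (1%:M : 'M[C]_d).
Proof.
move=> d0 uV comm.
pose ix (a : 'I_m) (i : 'I_d) : 'I_(m * d) := mxtens_index (a, i).
have ent (c : 'I_m) (k : 'I_d) (b : 'I_m) (j p q : 'I_d) : ((1%:M : 'M[C]_m) *t delta_mx p q) (ix c k) (ix b j) =
    ((c == b) && ((k == p) && (j == q)))%:R.
  by rewrite tensmxE !mxE -natrM mulnb.
have lhs (a : 'I_m) (i : 'I_d) (b : 'I_m) (j p q : 'I_d) : (V *m ((1%:M : 'M[C]_m) *t delta_mx p q)) (ix a i) (ix b j) =
    V (ix a i) (ix b p) *+ (j == q).
  rewrite mxE (bigD1 (ix b p)) //= big1 => [|kk].
    by rewrite addr0 ent !eqxx /= mulr_natr.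
  case: (mxtens_indexP kk) => c k ne; rewrite -/(ix c k) ent.
  case: eqP => [cb|_]; last by rewrite mulr0.
  case: eqP => [kp|_]; last by rewrite mulr0.
  by rewrite cb kp eqxx in ne.
have rhs (a : 'I_m) (i : 'I_d) (b : 'I_m) (j p q : 'I_d) : (((1%:M : 'M[C]_m) *t delta_mx p q) *m V) (ix a i) (ix b j) =
    V (ix a q) (ix b j) *+ (i == p).
  rewrite mxE (bigD1 (ix a q)) //= big1 => [|kk].
    by rewrite addr0 ent !eqxx /= andbT mulr_natl.
  case: (mxtens_indexP kk) => c k ne; rewrite -/(ix c k) ent.
  have [kq|_] := eqVneq k q; last by rewrite !andbF mul0r.
  have [ac|_] := eqVneq a c; last by rewrite mul0r.
  by rewrite -ac kq eqxx in ne.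
have key (a : 'I_m) (i : 'I_d) (b : 'I_m) (j p q : 'I_d) : V (ix a i) (ix b p) *+ (j == q) = V (ix a q) (ix b j) *+ (i == p).
  by rewrite -lhs -rhs comm.
pose i0 := Ordinal d0; pose W : 'M[C]_m := \matrix_(r, s) V (ix r i0) (ix s i0).
have eV : V = W *t (1%:M : 'M[C]_d).
  apply/matrixP => k l; case: (mxtens_indexP k) => a i; case: (mxtens_indexP l) => b p.
  rewrite tensmxE !mxE -/(ix a i) -/(ix b p) mulr_natr.
  by have := key a i b i0 p i0; rewrite eqxx mulr1n.
exists W => //; apply/unitarymxP; move/unitarymxP: (uV).
have -> : V^t* = (W^t*) *t (1%:M : 'M[C]_d).
  by rewrite eV trmx_tens map_mxT trmx1 map_mx1.
rewrite eV tensmx_mul mulmx1 => e; apply/matrixP => a b.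
have := congr1 (fun M : 'M[C]_(m * d) => M (ix a i0) (ix b i0)) e.
rewrite /= tensmxE !mxE eqxx mulr1 => ->; rewrite (can_eq (@mxtens_indexK _ _)).
by rewrite xpair_eqE eqxx andbT.
Qed.

Lemma commute_unit_dirsum n k (V : 'M[C]_(n + k)) : V \is unitarymx ->
  V *m dirsum 1%:M 0 = dirsum 1%:M 0 *m V ->
  exists U W, [/\ U \is unitarymx, W \is unitarymx & V = dirsum U W].
Proof.
move=> uV; rewrite -(submxK V) /dirsum !mulmx_block !(mul0mx, mulmx0, addr0, add0r, mulmx1, mul1mx).
move=> /eq_block_mx[_ er el _]; exists (ulsubmx V), (drsubmx V).
have eV : V = dirsum (ulsubmx V) (drsubmx V) by rewrite -[LHS]submxK -er el.
move/unitarymxP: (uV); rewrite {1 2}eV dirsum_tC dirsumM -dirsum1.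
case/dirsum_inj => eU eW; split; [exact/unitarymxP | exact/unitarymxP |].
by rewrite submxK.
Qed.

(** Separation of points is the case V = 1. The twist by V makes the property invariant under
    equivalence and lets it pass from summands to sums. *)
Definition Cstar_separates n t t' := forall V : 'M[C]_n, V \is unitarymx ->
  (forall f, in_Cstar f -> uconj V (value_in n f t) = value_in n f t') -> act V t = t'.

Lemma Cstar_separates_tequiv n t t' s s' : deg t = n -> deg t' = n ->
  tequiv t s -> tequiv t' s' -> Cstar_separates n s s' -> Cstar_separates n t t'.
Proof.
move=> dt dt' [U + eU] [U' + eU'] sep V uV h.
rewrite dt in U eU *; rewrite dt' in U' eU' * => uU uU'.
have uVU := mul_unitarymx uV (unitary_inv uU).
have uW := mul_unitarymx uU' uVU.
have : act (U' *m (V *m invmx U)) s = s'.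
  apply: sep => // f Cf; have ef := in_Cstar_equiv Cf.
  rewrite -eU -eU' (value_in_act ef uU dt) (value_in_act ef uU' dt') -(h f Cf).
  rewrite (uconj_comp _ uU' uVU) (uconj_comp _ uV (unitary_inv uU)).
  by rewrite (uconjK _ uU).
have ds : deg s = n by rewrite -eU deg_act.
rewrite (actM uU' uVU ds) (actM uV (unitary_inv uU) ds) -eU (act_inv uU dt) -eU'.
move=> /(congr1 (act (invmx U'))); rewrite !(act_inv uU') //.
by rewrite deg_act.
Qed.

End Evaluation.

(** * Separating points by evaluations *)

Section Separation.
Variables (R : realType) (T : tower R) (hT : mtower T).
Local Notation C := (Cx R).
Implicit Types (f g : msection T) (x y z w t a b : T).

Lemma equiv_additive_scalar (c : C) : equiv_additive (fun x : T => c%:M : 'M[C]_(deg x)).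
Proof. by apply: in_Cstar_equiv; exact: in_Cstar_scalar. Qed.

Lemma scalar_mx_tprec f (c : C) a z : equiv_additive f -> tprec a z ->
  f z = c%:M -> f a = c%:M.
Proof. by move=> ef az fz; exact: (eq_tprec ef (equiv_additive_scalar c) az fz). Qed.

Lemma scalar_mx_deg_inj (c c' : C) x : (c%:M : 'M[C]_(deg x)) = c'%:M -> c = c'.
Proof.
move=> /matrixP/(_ (Ordinal (deg_gt0 x)) (Ordinal (deg_gt0 x))).
by rewrite !mxE eqxx !mulr1n.
Qed.

Lemma value_in_scalar n f x (c : C) : deg x = n ->
  (value_in n f x = c%:M) <-> (f x = c%:M).
Proof. by move=> dx; case: n / dx; rewrite value_in_deg. Qed.

Lemma uconj_scalar n (V : 'M[C]_n) c : V \is unitarymx -> uconj V c%:M = c%:M.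
Proof.
by move=> uV; rewrite /uconj scalar_mxC mulmxK // unitarymx_unit.
Qed.

Lemma tens_mx1 m d : (1%:M : 'M[C]_m) *t (1%:M : 'M[C]_d) = 1%:M.
Proof.
apply/matrixP => i j; case: (mxtens_indexP i) => a k; case: (mxtens_indexP j) => b l.
by rewrite tensmxE !mxE -natrM mulnb (can_eq (@mxtens_indexK _ _)) xpair_eqE.
Qed.

Lemma mxrank_uconj n (V X : 'M[C]_n) : V \is unitarymx -> \rank (uconj V X) = \rank X.
Proof.
move=> uV; rewrite /uconj mxrankMfree; last first.
  by rewrite row_free_unit unitmx_inv (unitarymx_unit uV).
rewrite -mxrank_tr trmx_mul mxrankMfree ?mxrank_tr //.
by rewrite row_free_unit unitmx_tr (unitarymx_unit uV).
Qed.

(** Recovers the multiplicity of y from a value, in a form invariant under conjugation. *)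
Lemma rank_value_in f y w m n : equiv_additive f -> (0 < m)%N ->
  deg (tsum (nsum y m) w) = n -> f y = 1%:M -> f w = 0 ->
  \rank (value_in n f (tsum (nsum y m) w)) = (m * deg y)%N.
Proof.
move=> ef m0 <- fy fw; rewrite deg_tsum (deg_nsum y m0).
rewrite (value_in_tsum ef (deg_nsum y m0) erefl) (value_in_nsum y ef m0) fy.
rewrite value_in_deg fw /dirsum rank_diag_block_mx mxrank0 addn0.
by rewrite tens_mx1 mxrank1.
Qed.

(** V commutes with all [1 *t X], hence is of the form [W *t 1] and stabilizes the sum by (mT4). *)
Lemma separates_nsum y m : (0 < m)%N -> irreducible y ->
  Cstar_separates (m * deg y) (nsum y m) (nsum y m).
Proof.
move=> m0 iy V uV h.
have [|W uW eV] := tens_commutant (deg_gt0 y) uV.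
  move=> X; have [f Cf fy] := Cstar_value hT X iy; have ef := in_Cstar_equiv Cf.
  by have := h f Cf; rewrite (value_in_nsum y ef m0) fy => /(uconj_fix _ uV).
have : stab (m * deg y)%N (nsum y m) V by rewrite (stab_nsum hT iy m0); exists W.
by case.
Qed.

(** A section that is 1 at y and 0 at w and w' takes the projection onto the first block as its
    value at both sums; V commutes with it and is therefore block-diagonal. *)
Lemma separates_tsum y m w w' l : (0 < m)%N -> irreducible y ->
  tdisjoint y w -> tdisjoint y w' -> deg w = l -> deg w' = l ->
  Cstar_separates l w w' ->
  Cstar_separates (m * deg y + l) (tsum (nsum y m) w) (tsum (nsum y m) w').
Proof.
move=> m0 iy yw yw' dw dw' sep V uV h.
have dm := deg_nsum y m0.
have val f : in_Cstar f -> uconj V (dirsum ((1%:M : 'M[C]_m) *t f y) (value_in l f w)) =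
    dirsum ((1%:M : 'M[C]_m) *t f y) (value_in l f w').
  move=> Cf; have ef := in_Cstar_equiv Cf; have := h f Cf.
  by rewrite (value_in_tsum ef dm dw) (value_in_tsum ef dm dw') (value_in_nsum y ef m0).
have [f [Cf fy fww]] := Cstar_separation_disjoint hT 1%:M iy (tdisjoint_tsum hT yw yw').
have ef := in_Cstar_equiv Cf.
have z x : tprec x (tsum w w') -> deg x = l -> value_in l f x = 0.
  move=> xw dx; have e0 := equiv_additive_scalar 0.
  have fx : f x = 0.
    by have := @scalar_mx_tprec f 0 x _ ef xw; rewrite !raddf0; apply.
  by case: l / dx {sep h V uV dw dw' val}; rewrite value_in_deg.
have := val f Cf; rewrite fy !z //; [|exact: tprec_sumr (tprec_refl w')|exact: tprec_suml (tprec_refl w)].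
rewrite tens_mx1 => /(uconj_fix _ uV) comm.
have [U [W [uU uW eV]]] := commute_unit_dirsum uV comm.
have sepm := separates_nsum m0 iy.
rewrite eV act_tsum //; congr tsum.
  apply: sepm => // g Cg; have := val g Cg; rewrite eV uconj_dirsum // => /dirsum_inj[].
  by rewrite (value_in_nsum y (in_Cstar_equiv Cg) m0).
apply: sep => // g Cg; have := val g Cg; rewrite eV uconj_dirsum // => /dirsum_inj[] //.
Qed.

(** Induction on the degree: an irreducible y below t is also below t', its multiplicities agree by
    a rank count, and the rests are handled by the induction hypothesis. *)
Lemma Cstar_separates_all n t t' : deg t = n -> deg t' = n -> Cstar_separates n t t'.
Proof.
have [k] := ubnP n; elim: k n t t' => // k IH n t t'; rewrite ltnS => lenk dt dt'.
move=> V uV h; have [y iy yt] := ex_irreducible_tprec t.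
have yt' : tprec y t'.
  apply: contrapT => /(irreducible_disjointP _ iy) yt'.
  have [f [Cf fy ft']] := Cstar_separation_disjoint hT 1%:M iy yt'.
  have ef := in_Cstar_equiv Cf.
  have ft : f t = 0%:M.
    apply/(value_in_scalar _ _ dt); apply: (uconj_inj uV); rewrite (h f Cf).
    rewrite uconj_scalar //; apply/(value_in_scalar _ _ dt').
    by rewrite ft' raddf0.
  have := scalar_mx_tprec ef yt ft; rewrite fy => /scalar_mx_deg_inj/eqP.
  by rewrite oner_eq0.
(* Excludes that one point is a pure multiple of y while the other has a part w disjoint from y: a
   section that is 1 at y and 0 at w would have the value 1 at s. *)
have mixed m s w (W : 'M[C]_n) : (0 < m)%N -> tdisjoint y w -> deg s = n ->
    tprec w s -> deg (nsum y m) = n -> W \is unitarymx ->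
    ~ (forall f, in_Cstar f -> uconj W (value_in n f (nsum y m)) = value_in n f s).
  move=> m0 yw ds ws dm uW hW.
  have [f [Cf fy fw]] := Cstar_separation_disjoint hT 1%:M iy yw.
  have ef := in_Cstar_equiv Cf.
  have fs : f s = 1%:M.
    apply/(value_in_scalar _ _ ds); rewrite -(hW f Cf) -[RHS](uconj_scalar 1 uW).
    congr uconj; rewrite deg_nsum // in dm; case: n / dm {IH t t' lenk dt dt' V uV h yt yt' ds W uW hW}.
    by rewrite (value_in_nsum y ef m0) fy tens_mx1.
  have := scalar_mx_tprec ef ws fs; rewrite fw -(raddf0 (@scalar_mx C (deg w))).
  by move=> /scalar_mx_deg_inj/eqP; rewrite eq_sym oner_eq0.
have [m m0 st] := point_split hT iy yt; have [m' m0' st'] := point_split hT iy yt'.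
have [s ts [ds eqs]] : exists2 s, tequiv t s & deg s = n /\
    (s = nsum y m \/ exists2 w, tdisjoint y w & s = tsum (nsum y m) w).
  case: st => [ts|[w yw ts]].
    by exists (nsum y m) => //; split; [rewrite (tequiv_deg ts) | left].
  by exists (tsum (nsum y m) w) => //; split; [rewrite (tequiv_deg ts) | right; exists w].
have [s' ts' [ds' eqs']] : exists2 s, tequiv t' s & deg s = n /\
    (s = nsum y m' \/ exists2 w, tdisjoint y w & s = tsum (nsum y m') w).
  case: st' => [ts'|[w yw ts']].
    by exists (nsum y m') => //; split; [rewrite (tequiv_deg ts') | left].
  by exists (tsum (nsum y m') w) => //; split; [rewrite (tequiv_deg ts') | right; exists w].
apply: (Cstar_separates_tequiv dt dt' ts ts' _ uV h).
case: eqs eqs' => [es|[w yw es]] [es'|[w' yw' es']]; subst s s'.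
- have mm : m = m'.
    move: ds ds'; rewrite !deg_nsum // => <- /eqP; rewrite eqn_pmul2r ?deg_gt0 //.
    by move/eqP.
  move: (ds); rewrite -mm deg_nsum // => <-; exact: separates_nsum.
- move=> W uW hW; exfalso.
  exact: (mixed m _ w' W m0 yw' ds' (tprec_sumr _ (tprec_refl w')) ds uW hW).
- move=> W uW hW; exfalso.
  apply: (mixed m' _ w _ m0' yw ds (tprec_sumr _ (tprec_refl w)) ds' (unitary_inv uW)).
  by move=> f Cf; rewrite -(hW f Cf) (uconjK _ uW).
move=> W uW hW.
have [f [Cf fy fww]] := Cstar_separation_disjoint hT 1%:M iy (tdisjoint_tsum hT yw yw').
have ef := in_Cstar_equiv Cf.
have f0 x : tprec x (tsum w w') -> f x = 0.
  by move=> xw; have := @scalar_mx_tprec f 0 x _ ef xw; rewrite !raddf0; apply.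
have fw := f0 w (tprec_suml _ (tprec_refl w)).
have fw' := f0 w' (tprec_sumr _ (tprec_refl w')).
have rk := rank_value_in ef m0 ds fy fw.
have rk' := rank_value_in ef m0' ds' fy fw'.
have mm : m = m'.
  apply/eqP; rewrite -(eqn_pmul2r (deg_gt0 y)) -rk -rk' -(hW f Cf).
  by rewrite (mxrank_uconj _ uW).
have dwn : (m * deg y + deg w)%N = n by rewrite -ds deg_tsum deg_nsum.
have dw' : deg w' = deg w.
  apply/eqP; rewrite -(eqn_add2l (m * deg y)) dwn -ds' deg_tsum deg_nsum //.
  by rewrite mm.
have sep : Cstar_separates (m * deg y + deg w) (tsum (nsum y m) w) (tsum (nsum y m) w').
  apply: (separates_tsum m0 iy yw yw' erefl dw'); apply: IH => //; apply: leq_trans lenk.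
  by rewrite -dwn -[X in (X < _)%N]add0n ltn_add2r muln_gt0 m0 deg_gt0.
rewrite dwn in sep; rewrite -mm in hW *; exact: (sep W uW hW).
Qed.

End Separation.

(** * Nondegenerate representations *)

Section StarAlgebra.
Variable R : realType.
Local Notation C := (Cx R).

Lemma mx_kernel_vector m n (D : 'M[C]_(m, n)) : (\rank D < n)%N ->
  exists2 v : 'cV[C]_n, v != 0 & D *m v = 0.
Proof.
move=> rD; have : cokermx D != 0 by rewrite -mxrank_eq0 mxrank_coker subn_eq0 -ltnNge.
move=> cD; have [j cj] : exists j, col j (cokermx D) != 0.
  apply: contrapT => h; move/eqP : cD; apply; apply/matrixP => i j; rewrite !mxE.
  have : col j (cokermx D) = 0 by apply/eqP; apply: contrapT => /negP cj; apply: h; exists j.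
  by move/matrixP/(_ i 0); rewrite !mxE.
by exists (col j (cokermx D)) => //; rewrite colE mulmxA mulmx_coker mul0mx.
Qed.

Lemma injective_unitmx n (X : 'M[C]_n) :
  (forall v : 'cV[C]_n, X *m v = 0 -> v = 0) -> X \in unitmx.
Proof.
move=> h; rewrite -row_full_unit /row_full eqn_leq rank_leq_col leqNgt.
by apply/negP => /mx_kernel_vector[v v0 /h ev]; rewrite ev eqxx in v0.
Qed.

(** First an invertible h = D^* D in B is found, a sum of terms b^* b stacked as the rows of D; then
    Cayley-Hamilton writes 1 as a polynomial in h without constant term. *)
Lemma star_algebra_unit n (B : set 'M[C]_n) :
  B 0 -> (forall X Y, B X -> B Y -> B (X + Y)) -> (forall c X, B X -> B (c *: X)) ->
  (forall X Y, B X -> B Y -> B (X *m Y)) -> (forall X, B X -> B (X^t*)) ->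
  (forall v : 'cV[C]_n, (forall X, B X -> X *m v = 0) -> v = 0) -> B 1%:M.
Proof.
move=> B0 BD BZ BM BS Bv.
have [m [D [BD' rD]]] : exists m (D : 'M[C]_(m, n)), B (D^t* *m D) /\ \rank D = n.
  suff h k : (k <= n)%N ->
      exists m (D : 'M[C]_(m, n)), B (D^t* *m D) /\ (k <= \rank D)%N.
    by have [m [D [BD' rD]]] := h n (leqnn n); exists m, D; split=> //; apply/eqP; rewrite eqn_leq rank_leq_col.
  (* While D kills some v, an element b of B with b v <> 0 is appended, and the rank grows. *)
  elim: k => [_|k IH kn]; first by exists 0%N, 0; rewrite mulmx0.
  have [m [D [BD' rD]]] := IH (ltnW kn).
  have [kD|Dk] := ltnP k (\rank D); first by exists m, D.
  have [v v0 Dv] : exists2 v : 'cV[C]_n, v != 0 & D *m v = 0.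
    by apply: mx_kernel_vector; exact: leq_ltn_trans Dk kn.
  have [b Bb bv] : exists2 b, B b & b *m v != 0.
    apply: contrapT => h; move/eqP: v0; apply; apply: Bv => X BX.
    by apply/eqP; apply: contrapT => /negP Xv; apply: h; exists X.
  exists (m + n)%N, (col_mx D b); split.
    by rewrite tr_col_mx map_row_mx mul_row_col; apply: BD => //; apply: BM => //; exact: BS.
  apply: (leq_ltn_trans rD); rewrite ltnNge; apply/negP => le.
  have Dc : (D <= col_mx D b)%MS by rewrite -addsmxE addsmxSl.
  have /submxP[P eP] : (b <= D)%MS.
    apply: submx_trans (_ : (b <= col_mx D b)%MS) _; first by rewrite -addsmxE addsmxSr.
    by have := geq_leqif (mxrank_leqif_sup Dc); rewrite le.
  by move: bv; rewrite eP -mulmxA Dv mulmx0 eqxx.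
have hu : D^t* *m D \in unitmx.
  apply: injective_unitmx => v e.
  apply/eqP; apply: contrapT => /negP v0.
  have Dv : D *m v = 0.
    apply: hs_eq0; apply: complexI; rewrite hs_trace tCM.
    by rewrite -mulmxA (mulmxA (D^t*)) e mulmx0 mxtrace0.
  have : (v^T <= kermx D^T)%MS.
    by apply/sub_kermxP; rewrite -trmx_mul Dv trmx0.
  have : row_free D^T by rewrite /row_free mxrank_tr rD.
  rewrite -kermx_eq0 => /eqP ->; rewrite submx0 => /eqP e0.
  by move: v0; rewrite -[v]trmxK e0 trmx0 eqxx.
move: (D^t* *m D) hu BD' => h hu Bh {m D rD}.
(* Polynomials are evaluated at matrices of positive size, so size 0 is treated apart. *)
case: n B B0 BD BZ BM {BS Bv} h hu Bh => [|n] B B0 BD BZ BM h hu Bh.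
  by rewrite (flatmx0 1%:M).
have Bq q : B (h *m horner_mx h q).
  elim/poly_ind: q => [|q c IH]; first by rewrite rmorph0 mulmx0.
  rewrite rmorphD rmorphM /= horner_mx_X horner_mx_C mulmxDr mul_mx_scalar.
  by apply: (BD _ _ _ (BZ c _ Bh)); rewrite -mulmxE mulmxA; exact: BM.
suff key p : horner_mx h p = 0 -> p`_0 != 0 -> B 1%:M.
  apply: (key (char_poly h)); first exact: Cayley_Hamilton.
  by rewrite char_poly_det mulf_neq0 ?signr_eq0 // -unitfE -unitmxE.
elim/poly_ind: p => [|q c _]; first by rewrite coef0 eqxx.
rewrite coefD coefMX coefC /= add0r => + c0.
rewrite rmorphD rmorphM /= horner_mx_X horner_mx_C => e.
have -> : 1%:M = - c^-1 *: (h *m horner_mx h q) :> 'M[C]_n.+1.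
  have -> : h *m horner_mx h q = - c%:M.
    apply/eqP; rewrite -addr_eq0 -[X in _ == X]e; apply/eqP; congr (_ + _).
    exact: (comm_mx_horner q (comm_mx_refl h)).
  by rewrite scalerN scaleNr opprK scale_scalar_mx mulVf.
exact: BZ.
Qed.

End StarAlgebra.

Section Representations.
Variables (R : realType) (T : tower R).
Local Notation C := (Cx R).
Implicit Types (f g : msection T) (x y z w t a b : T).

Lemma representation0_B n (pi : msection T -> 'M[C]_n) f g : representation0 pi ->
  in_Cstar0 f -> in_Cstar0 g -> in_Cstar0 (fun x => f x - g x) /\
  pi (fun x => f x - g x) = pi f - pi g.
Proof.
move=> rp Af Ag; have Ag' := in_Cstar0Z (-1) Ag.
have -> : (fun x => f x - g x) = (fun x => f x + -1 *: g x).
  by apply/functional_extensionality_dep => x; rewrite scaleN1r.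
by split; [exact: in_Cstar0D Af Ag' | rewrite (repD rp Af Ag') (repZ rp) // scaleN1r].
Qed.

Lemma representation0_0 n (pi : msection T -> 'M[C]_n) : representation0 pi ->
  pi (fun x => 0) = 0.
Proof.
move=> rp; have A0 := @in_Cstar0_0 R T.
have [_ e] := representation0_B rp A0 A0.
by move: e; rewrite subrr (_ : (fun x => _) = fun x : T => 0) //;
  apply/functional_extensionality_dep => x; rewrite subrr.
Qed.

(** Stated for a *-subalgebra J, since it is applied both to C*_0(T) and to the sections vanishing
    at a point. *)
Lemma representation0_unit n (pi : msection T -> 'M[C]_n) (J : set (msection T)) :
  representation0 pi -> (forall f, J f -> in_Cstar0 f) ->
  J (fun x => 0) -> (forall f g, J f -> J g -> J (fun x => f x + g x)) ->
  (forall c f, J f -> J (fun x => c *: f x)) ->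
  (forall f g, J f -> J g -> J (fun x => f x *m g x)) ->
  (forall f, J f -> J (fun x => (f x)^t*)) ->
  (forall v : 'cV[C]_n, (forall f, J f -> pi f *m v = 0) -> v = 0) ->
  exists2 e, J e & pi e = 1%:M.
Proof.
move=> rp JA J0 JD JZ JM JS Jv.
apply: (@star_algebra_unit R n [set X | exists2 e, J e & pi e = X]).
- by exists (fun x => 0) => //; exact: representation0_0.
- by move=> _ _ [f Jf <-] [g Jg <-]; eexists; [exact: JD Jf Jg | exact: (repD rp (JA f Jf) (JA g Jg))].
- by move=> c _ [f Jf <-]; eexists; [exact: JZ c _ Jf | exact: (repZ rp c (JA f Jf))].
- by move=> _ _ [f Jf <-] [g Jg <-]; eexists; [exact: JM Jf Jg | exact: (repM rp (JA f Jf) (JA g Jg))].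
- by move=> _ [f Jf <-]; eexists; [exact: JS Jf | exact: (repStar rp (JA f Jf))].
by move=> v h; apply: Jv => f Jf; apply: h; exists f.
Qed.

Lemma nondegenerate0P n (pi : msection T -> 'M[C]_n) : representation0 pi ->
  nondegenerate0 pi <-> exists2 e, in_Cstar0 e & pi e = 1%:M.
Proof.
move=> rp; split=> [nd|[e Ae pe] v]; last first.
  by exists 1%N, (fun=> e), (fun=> v); split=> //; rewrite big_ord1 pe mul1mx.
apply: (@representation0_unit n pi (@in_Cstar0 R T) rp) => [f //||||||v hv].
- exact: in_Cstar0_0.
- by move=> f g; exact: in_Cstar0D.
- by move=> c f; exact: in_Cstar0Z.
- by move=> f g; exact: in_Cstar0M.
- by move=> f; exact: in_Cstar0_tC.
have [k [f [xi [Af ev]]]] := nd v.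
(* A vector killed by every [pi f] is orthogonal to all ranges, as the algebra is closed under
   adjoints; expanding one factor of v^* v makes it orthogonal to itself. *)
apply: hs_eq0; apply: complexI; rewrite hs_trace {2}ev mulmx_sumr raddf_sum big1 //= => i _.
have := hv _ (in_Cstar0_tC (Af i)); rewrite (repStar rp (Af i)) => e.
by rewrite mulmxA -[pi (f i)](trmxCK) -tCM e trmx0 map_mx0 mul0mx mxtrace0.
Qed.

End Representations.

(** * Locating an irreducible point in the support of a representation *)

Section SupportPoint.
Variables (R : realType) (T : tower R).
Local Notation C := (Cx R).
Local Notation nrm := ComplexField.Normc.normc.
Implicit Types (f g : msection T) (x y z w t a b : T).

Lemma nbhs_bounded_by f x (e : R) : in_Cstar f -> f x = 0 -> 0 < e ->
  nbhs x [set z | bounded_by e (f z)].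
Proof.
move=> /in_CstarP[cf _ _] fx e0; set n := deg x.
have dn : nbhs x [set z : T | deg z = n].
  by apply: open_nbhs_nbhs; split=> //; exact: open_deg.
have /cvg_mxP cv : value_in n f @ within [set z | deg z = n] (nbhs x) --> (0 : 'M[C]_n).
  have <- : value_in n f x = 0 by rewrite value_in_deg.
  by move/subspace_continuousP : (cf n); apply.
have cs : (fun z => \sum_i \sum_j nrm (value_in n f z i j)) @
    within [set z | deg z = n] (nbhs x) --> \sum_(i < n) \sum_(j < n) nrm ((0 : 'M[C]_n) i j).
  by apply: cvg_bigsum => i; apply: cvg_bigsum => j; apply: cvg_nrm; exact: cv.
rewrite big1 in cs; last by move=> i _; rewrite big1 // => j _; rewrite mxE nrm0.
move/cvgrPdist_lt : cs => /(_ e e0) cs.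
apply: filterS2 dn cs => z dz /(_ dz); rewrite sub0r normrN => lt.
apply/(bounded_by_value_in _ _ dz); apply: bounded_by_le (bounded_by_sum_nrm _).
  by apply: sumr_ge0 => i _; apply: sumr_ge0 => j _; exact: nrm_ge0.
by apply: ltW; apply: le_lt_trans lt; exact: ler_norm.
Qed.

Lemma mxtrace_tC n (X : 'M[C]_n) : \tr (X^t*) = (\tr X)^*.
Proof. by rewrite trace_map_mx mxtrace_tr. Qed.

(** With a = X v, the inequality 0 <= |a - v/4|^2 = |a|^2 + |v|^2/16 - r/2 and |v|^2/8 <= r/2 give
    the bound; this replaces Cauchy-Schwarz. *)
Lemma hs_le_of_form n (X : 'M[C]_n) (v : 'cV[C]_n) (r : R) :
  \tr (v^t* *m (X *m v)) = r%:C%C -> hs v <= 4 * r -> hs v <= 4 ^+ 2 * hs (X *m v).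
Proof.
move=> tr vr; set a := X *m v in tr *.
have tr' : \tr (a^t* *m v) = r%:C%C.
  rewrite -[a^t* *m v](trmxCK) mxtrace_tC (tCM (a^t*)) (trmxCK a) tr.
  by apply/eqP; rewrite eq_complex /= oppr0 !eqxx.
have c4 : ((4^-1)%:C%C : C)^* = (4^-1)%:C%C.
  by apply/eqP; rewrite eq_complex /= oppr0 !eqxx.
have e : (hs (a - ((4^-1)%:C%C : C) *: v))%:C%C = (hs a + 4^-1 * (4^-1 * hs v) - 4^-1 * (r + r))%:C%C :> C.
  by rewrite rmorphB !rmorphD !rmorphM /= rmorphD !hs_trace trace_subZ // tr tr'.
have := hs_ge0 (a - ((4^-1)%:C%C : C) *: v); rewrite (complexI e) => h2.
lra.
Qed.

(** From |v|^2 <= 2 |(1 - X) v|^2 + 2 |X v|^2, whose last term is at most |v|^2/2. *)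
Lemma hs_half_complement n (X : 'M[C]_n) (v : 'cV[C]_n) : bounded_by 2^-1 X ->
  hs v <= 4 * hs ((1%:M - X) *m v).
Proof.
move=> /(_ v) bX; have := hsD_le ((1%:M - X) *m v) (X *m v).
rewrite -mulmxDl subrK mul1mx => h; rewrite exprVn in bX.
lra.
Qed.

Section Cover.
Variables (I : eqType) (r : seq I) (G : I -> msection T).
Hypothesis AG : forall i, in_Cstar0 (G i).

(** The positive sections (1 - G i)^* (1 - G i) need not vanish at infinity, so pi is applied to
    their differences from 1, which are the terms of [w]. *)
Let w : msection T := fun x =>
  \sum_(i <- r) (G i x + (G i x)^t* - (G i x)^t* *m G i x).
Let v : msection T := fun x => (size r)%:R%:M - w x.

Lemma cover_defect x : v x = \sum_(i <- r) (1%:M - G i x)^t* *m (1%:M - G i x).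
Proof.
rewrite /v /w; elim: r => [|i s IH]; first by rewrite !big_nil raddf0 subr0.
rewrite !big_cons -IH /= -natr1 raddfD /= [_%:M + 1%:M]addrC opprD addrACA.
congr (_ + _); rewrite tCB trmx1 map_mx1 mulmxBl mul1mx mulmxBr mulmx1.
by rewrite -addrA opprD addrA.
Qed.

Lemma cover_term n (pi : msection T -> 'M[C]_n) i : representation0 pi ->
  pi (G i) = 1%:M ->
  in_Cstar0 (fun x => G i x + (G i x)^t* - (G i x)^t* *m G i x) /\
  pi (fun x => G i x + (G i x)^t* - (G i x)^t* *m G i x) = 1%:M.
Proof.
move=> rp p1; have As := in_Cstar0_tC (AG i).
have AD := in_Cstar0D (AG i) As; have AM := in_Cstar0M As (AG i).
have [AB ->] := representation0_B rp AD AM; split=> //.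
rewrite (repD rp (AG i) As) (repM rp As (AG i)) (repStar rp (AG i)) p1.
by rewrite trmx1 map_mx1 mulmx1 addrK.
Qed.

Lemma cover_sum n (pi : msection T -> 'M[C]_n) : representation0 pi ->
  (forall i, pi (G i) = 1%:M) -> in_Cstar0 w /\ pi w = (size r)%:R%:M.
Proof.
move=> rp p1; rewrite /w; elim: r => [|i s [IA IP]].
  rewrite (_ : (fun x => _) = fun x : T => 0); last first.
    by apply/functional_extensionality_dep => x; rewrite big_nil.
  by split; [exact: in_Cstar0_0 | rewrite (representation0_0 rp) raddf0].
have [Ai pi1] := cover_term rp (p1 i); have AD := in_Cstar0D Ai IA.
have eD := repD rp Ai IA; rewrite pi1 IP in eD.
rewrite (_ : (fun x => _) = fun x => (G i x + (G i x)^t* - (G i x)^t* *m G i x) +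
    \sum_(i <- s) (G i x + (G i x)^t* - (G i x)^t* *m G i x)); last first.
  by apply/functional_extensionality_dep => x; rewrite big_cons.
by split=> //; rewrite eD /= -natr1 raddfD /= addrC.
Qed.

Lemma trace_cover x (u : 'cV[C]_(deg x)) :
  \tr (u^t* *m (v x *m u)) = (\sum_(i <- r) hs ((1%:M - G i x) *m u))%:C%C.
Proof.
rewrite cover_defect mulmx_suml mulmx_sumr raddf_sum rmorph_sum /=.
by apply: eq_bigr => i _; rewrite hs_trace tCM !mulmxA.
Qed.

Lemma cover_lower : equiv_additive v ->
  (forall y, irreducible y -> exists2 i, i \in r & bounded_by 2^-1 (G i y)) ->
  forall x (u : 'cV[C]_(deg x)), hs u <= 4 ^+ 2 * hs (v x *m u).
Proof.
move=> [ev av] cov.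
pose Q (p : pval T) := forall u : 'cV[C]_(pdim p), hs u <= 4 ^+ 2 * hs (pmx p *m u).
suff h x : Q (pfun v x) by [].
elim/tower_ind: x => [y iy u|x z bx bz|x z [U uU <-] bx].
- have [i ir bi] := cov y iy.
  apply: hs_le_of_form (trace_cover u) _; apply: le_trans (hs_half_complement u bi) _.
  rewrite ler_wpM2l // (big_rem i) //= lerDl; apply: sumr_ge0 => j _; exact: hs_ge0.
- rewrite av => u; rewrite /= -[u]vsubmxK /dirsum mul_block_col !mul0mx addr0 add0r.
  by rewrite !hs_col_mx mulrDr lerD //.
- rewrite -(ev x U uU) => u; rewrite /= /uconj -!mulmxA hs_unitaryl //.
  apply: le_trans (bx _); rewrite (hs_unitaryl _ (unitary_inv uU)) //.
Qed.

(* With [v] the sum of the [(1 - G i)^* (1 - G i)], bounded below by 1/4, and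
   [w = size r - v] in [C*_0(T)], the section [h = v^-1 w] satisfies [v h = w];
   but [pi w = size r] forces [pi] to send [v h = size r *: h - w h] to 0. *)
Lemma cover_contradiction n (pi : msection T -> 'M[C]_n) : (0 < n)%N ->
  representation0 pi -> (forall i, pi (G i) = 1%:M) -> (0 < size r)%N ->
  ~ (forall y, irreducible y -> exists2 i, i \in r & bounded_by 2^-1 (G i y)).
Proof.
move=> n0 rp p1 r0 cov; have [Aw pw] := cover_sum rp p1.
have Cv : in_Cstar v.
  have Cm := in_Cstar_scalar T (size r)%:R.
  have Cw := in_CstarZ (-1) (in_Cstar0W Aw).
  have := in_CstarD Cm Cw; rewrite (_ : (fun x => _) = v) //.
  by apply/functional_extensionality_dep => x; rewrite scaleN1r.
have low := cover_lower (in_Cstar_equiv Cv) cov.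
have Ah := in_Cstar0Ml (in_Cstar_inv Cv (ler0n R 4) low) Aw.
set h := (fun x => _) in Ah.
have [AB eB] := representation0_B rp (in_Cstar0Z (size r)%:R Ah) (in_Cstar0M Aw Ah).
have : pi w = 0.
  rewrite (_ : w = fun x => (size r)%:R *: h x - w x *m h x).
    rewrite eB (repZ rp _ Ah) (repM rp Aw Ah) pw mul_scalar_mx.
    exact: subrr.
  apply/functional_extensionality_dep => x.
  rewrite -mul_scalar_mx -mulmxBl -/(v x) /h mulmxA mulmxV ?mul1mx //.
  by case: (bounded_below_inv (ler0n R 4) (low x)).
rewrite pw => /matrixP/(_ (Ordinal n0) (Ordinal n0)).
rewrite !mxE eqxx mulr1n => /eqP; rewrite pnatr_eq0 => /eqP e.
by rewrite e in r0.
Qed.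

End Cover.

(** Otherwise every point has a section g of C*_0(T) vanishing there with pi(g) = 1. Finitely many
    of them are small on neighborhoods covering the compact set off which e is small; together with
    e they contradict [cover_contradiction]. *)
Lemma support_point n (pi : msection T -> 'M[C]_n) e : (0 < n)%N ->
  representation0 pi -> in_Cstar0 e -> pi e = 1%:M ->
  exists2 y, irreducible y & forall g, in_Cstar0 g -> g y = 0 -> pi g <> 1%:M.
Proof.
move=> n0 rp Ae pe; apply: contrapT => hn.
have hi y : irreducible y -> exists g, [/\ in_Cstar0 g, g y = 0 & pi g = 1%:M].
  move=> iy; apply: contrapT => h; apply: hn; exists y => // g Ag gy pg.
  by apply: h; exists g.
have e0 : equiv_additive (fun x : T => 0 : 'M[C]_(deg x)).
  by apply: in_Cstar_equiv; apply: in_Cstar0W; exact: in_Cstar0_0.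
(* Reducible points are needed too, because the compact set lies in the closure of the core; at a
   sum the product of two sections vanishes. *)
have hx x : exists g, [/\ in_Cstar0 g, g x = 0 & pi g = 1%:M].
  elim/tower_ind: x => [//|a b [g [Ag ga pg]] [h [Ah hb ph]]|x z xz [g [Ag gx pg]]].
    have Agh := in_Cstar0M Ag Ah; exists (fun x => g x *m h x).
    split=> //; last by rewrite (repM rp Ag Ah) pg ph mulmx1.
    apply: (pfun_eq_tsum (in_Cstar_equiv (in_Cstar0W Agh)) e0).
      by rewrite ga mul0mx.
    by rewrite hb mulmx0.
  exists g; split=> //.
  exact: (pfun_eq_tequiv (in_Cstar_equiv (in_Cstar0W Ag)) e0 xz gx).
have [G hG] := choice hx.
have /in_Cstar0P[_ /(_ 2^-1)] := Ae; rewrite invr_gt0 ltr0n => /(_ isT)[K [cK Kc Ke]].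
have [x Kx|s sK cov] := compact_finite_cover
  (W := fun x => [set z | bounded_by 2^-1 (G x z)]) cK.
  have [Ag gx _] := hG x.
  by apply: (nbhs_bounded_by (in_Cstar0W Ag) gx); rewrite invr_gt0.
(* [None] stands for e, which takes care of the irreducible points outside K. *)
pose G' (i : option T) := if i is Some x then G x else e.
have AG' i : in_Cstar0 (G' i) by case: i => [x|]; [case: (hG x) | exact: Ae].
have pG' i : pi (G' i) = 1%:M by case: i => [x|]; [case: (hG x) | exact: pe].
apply: (@cover_contradiction _ (None :: map Some s) G' AG' n pi n0 rp pG' isT).
move=> y iy; have [Ky|nK] := pselect (K y).
  have [x xs bx] := cov y Ky; exists (Some x) => //.
  by rewrite inE map_f ?orbT.
exists None; first exact: mem_head.
by apply: Ke; split=> //; exact: subset_closure.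
Qed.

End SupportPoint.

(** * Splitting off evaluations *)

Section Existence.
Variables (R : realType) (T : tower R) (hT : mtower T).
Local Notation C := (Cx R).
Local Notation nrm := (@ComplexField.Normc.normc R).
Implicit Types (f g : msection T) (x y z w t a b : T).

Lemma killed_vector n (pi : msection T -> 'M[C]_n) y : representation0 pi ->
  (forall g, in_Cstar0 g -> g y = 0 -> pi g <> 1%:M) ->
  exists2 v : 'cV[C]_n, v != 0 & forall g, in_Cstar0 g -> g y = 0 -> pi g *m v = 0.
Proof.
move=> rp ny; apply: contrapT => h.
have [] := @representation0_unit R T n pi [set f | in_Cstar0 f /\ f y = 0] rp.
- by move=> f [].
- by split; [exact: in_Cstar0_0 | ].
- by move=> f g [Af fy] [Ag gy]; split; [exact: in_Cstar0D | rewrite fy gy addr0].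
- by move=> c f [Af fy]; split; [exact: in_Cstar0Z | rewrite fy scaler0].
- by move=> f g [Af fy] [Ag gy]; split; [exact: in_Cstar0M | rewrite fy mul0mx].
- by move=> f [Af fy]; split; [exact: in_Cstar0_tC | rewrite fy trmx0 map_mx0].
- move=> v kv; apply/eqP; apply: contrapT => /negP v0; apply: h; exists v => // g Ag gy.
  by apply: kv.
by move=> e [Ae ey] pe; exact: (ny e Ae ey pe).
Qed.

(** As v is killed by the sections vanishing at y, [pi f *m v] depends only on [f y]; this gives a
    map of left modules [rho] from M_d to C^n, and V is a rescaled restriction of it to one column
    of M_d. *)
Lemma intertwining_isometry n (pi : msection T -> 'M[C]_n) e : (0 < n)%N ->
  representation0 pi -> in_Cstar0 e -> pi e = 1%:M ->
  exists y (V : 'M[C]_(n, deg y)), V^t* *m V = 1%:M /\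
    forall f, in_Cstar0 f -> pi f *m V = V *m f y.
Proof.
move=> n0 rp Ae pe; have [y iy ny] := support_point n0 rp Ae pe.
have [v v0 kv] := killed_vector rp ny.
have nvy : ~ vanishing T y by move=> vy; exact: (ny e Ae (vy e Ae) pe).
have hL (X : 'M[C]_(deg y)) : exists f, in_Cstar0 f /\ f y = X.
  by have [f Af fy] := Cstar0_value hT X iy nvy; exists f.
have [L LP] := choice hL.
have rhoE f g : in_Cstar0 f -> in_Cstar0 g -> f y = g y -> pi f *m v = pi g *m v.
  move=> Af Ag fg; have [AB eB] := representation0_B rp Af Ag.
  have := kv _ AB; rewrite eB fg subrr mulmxBl => /(_ erefl)/eqP.
  by rewrite subr_eq0 => /eqP.
pose rho X := pi (L X) *m v.
have rhoM f X : in_Cstar0 f -> pi f *m rho X = rho (f y *m X).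
  move=> Af; have [AL LX] := LP X; have [AL' LX'] := LP (f y *m X).
  rewrite /rho mulmxA -(repM rp Af AL); apply: (rhoE _ _ (in_Cstar0M Af AL) AL').
  by rewrite LX LX'.
have rhoD X Y : rho (X + Y) = rho X + rho Y.
  have [AX LX] := LP X; have [AY LY] := LP Y; have [AZ LZ] := LP (X + Y).
  rewrite /rho -mulmxDl -(repD rp AX AY); apply: (rhoE _ _ AZ (in_Cstar0D AX AY)).
  by rewrite LZ LX LY.
have rhoZ c X : rho (c *: X) = c *: rho X.
  have [AX LX] := LP X; have [AZ LZ] := LP (c *: X).
  rewrite /rho scalemxAl -(repZ rp c AX); apply: (rhoE _ _ AZ (in_Cstar0Z c AX)).
  by rewrite LZ LX.
have rho0 : rho 0 = 0 by rewrite -(scale0r (0 : 'M[C]_(deg y))) rhoZ scale0r.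
have rho_sum (I : finType) (F : I -> 'M[C]_(deg y)) : rho (\sum_i F i) = \sum_i rho (F i).
  by apply: (big_morph rho rhoD rho0).
(* If every matrix unit went to 0, so would [rho (e y)], which is v because pi(e) = 1. *)
have [k [j rkj]] : exists k j, rho (delta_mx k j) != 0.
  apply: contrapT => h; move/eqP : v0; apply.
  have -> : v = rho (e y).
    by have [AL LX] := LP (e y); rewrite -[v]mul1mx -pe; exact: rhoE.
  rewrite (matrix_sum_delta (e y)) rho_sum big1 // => k _; rewrite rho_sum big1 // => j _.
  rewrite rhoZ; apply/eqP; rewrite scaler_eq0; apply/orP; right.
  by apply: contrapT => /negP r0; apply: h; exists k, j.
pose V : 'M[C]_(n, deg y) := \matrix_(a, l) rho (delta_mx l j) a 0.
have colV l : col l V = rho (delta_mx l j).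
  by apply/matrixP => a b; rewrite !mxE (ord1 b).
have comV f : in_Cstar0 f -> pi f *m V = V *m f y.
  move=> Af; apply/matrixP => a l.
  have -> : (pi f *m V) a l = (pi f *m rho (delta_mx l j)) a 0.
    by rewrite -colV !mxE; apply: eq_bigr => b _; rewrite !mxE.
  rewrite (rhoM _ _ Af).
  have -> : f y *m delta_mx l j = \sum_i f y i l *: delta_mx i j.
    apply/matrixP => p q; rewrite summxE mxE (bigD1 l) //= [X in _ + X]big1 => [|c cl].
      rewrite (bigD1 p) //= [X in _ = _ + X]big1 => [|c cp].
        by rewrite !mxE !eqxx.
      by rewrite !mxE (eq_sym p) (negbTE cp) mulr0.
    by rewrite !mxE (negbTE cl) mulr0.
  rewrite rho_sum summxE mxE; apply: eq_bigr => i _.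
  by rewrite rhoZ !mxE mulrC.
pose c : R := hs (rho (delta_mx k j)).
have gramE : V^t* *m V = c%:C%C%:M.
  (* Taking adjoints, V^* intertwines in the other direction, so V^* V commutes with all of M_d and
     must be a scalar. *)
  have comm X : (V^t* *m V) *m X = X *m (V^t* *m V).
    have [AX LX] := LP X; have AX' := in_Cstar0_tC AX.
    rewrite -mulmxA -{1}LX -(comV _ AX) mulmxA.
    have := comV _ AX'; rewrite (repStar rp AX) LX => /(congr1 (fun M => M^t*)).
    by rewrite !tCM !trmxCK mulmxA => ->.
  apply/matrixP => p q; have := comm (delta_mx q k) => /matrixP/(_ p k).
  rewrite mxE (bigD1 q) //= [X in _ + X]big1 => [|i iq]; last first.
    by rewrite [delta_mx _ _ _ _]mxE (negbTE iq) mulr0.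
  rewrite [delta_mx _ _ _ _]mxE !eqxx mulr1 addr0 => ->.
  rewrite [LHS]mxE (bigD1 k) //= [X in _ + X]big1 => [|i ik]; last first.
    by rewrite [delta_mx _ _ _ _]mxE (negbTE ik) andbF mul0r.
  rewrite [delta_mx _ _ _ _]mxE eqxx andbT addr0 [RHS]mxE mulr_natl /c hs_trace.
  congr (_ *+ _); rewrite -colV /mxtrace big_ord1 !mxE.
  by apply: eq_bigr => i _; rewrite !mxE.
have c0 : 0 < c.
  rewrite lt_neqAle hs_ge0 andbT eq_sym; apply: contraNneq rkj => c0.
  by rewrite (hs_eq0 c0).
exists y, ((((Num.sqrt c)^-1)%:C%C : C) *: V); split=> [|f Af]; last first.
  by rewrite -scalemxAr (comV _ Af) scalemxAl.
have cc : nrm (((Num.sqrt c)^-1)%:C%C : C) ^+ 2 * c = 1.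
  by rewrite nrm_sq /= expr0n addr0 exprVn sqr_sqrtr ?mulVf ?gt_eqF // ltW.
by rewrite tCZ -scalemxAl -scalemxAr scalerA -nrm_sqC gramE scale_scalar_mx -rmorphM cc.
Qed.

Lemma unitary_complement d n (M : 'M[C]_(d, n)) : M *m M^t* = 1%:M ->
  exists k (Q : 'M[C]_(k, n)), [/\ (d + k)%N = n, Q *m Q^t* = 1%:M,
    M *m Q^t* = 0 & M^t* *m M + Q^t* *m Q = 1%:M].
Proof.
move=> /unitarymxP uM; have rM : \rank M = d by exact: mxrank_unitary.
pose K := kermx (M^t*); pose Q := schmidt (row_base K).
have uQ : Q \is unitarymx by apply: schmidt_unitarymx; rewrite rank_leq_col.
have QM : Q *m M^t* = 0.
  by apply/sub_kermxP; rewrite eqmx_schmidt_free ?row_base_free // eq_row_base.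
have dk : (d + \rank K)%N = n.
  by rewrite mxrank_ker mxrank_map mxrank_tr rM subnKC // -rM rank_leq_col.
have MQ : M *m Q^t* = 0 by rewrite -[M *m _](trmxCK) tCM trmxCK QM trmx0 map_mx0.
exists _, Q; split=> //; first exact/unitarymxP.
have sq p (A : 'M[C]_(p, n)) : p = n -> A *m A^t* = 1%:M -> A^t* *m A = 1%:M.
  by move=> e; subst p => /mulmx1C.
rewrite -mul_row_col -map_row_mx -tr_col_mx sq // tr_col_mx map_row_mx mul_col_row.
rewrite (unitarymxP uM) (unitarymxP uQ) MQ QM.
by rewrite -scalar_mx_block.
Qed.

(** The second hypothesis says that Y maps the range of Q^* into itself, where the compression is a
    restriction. *)
Lemma compressM d k n (M : 'M[C]_(d, n)) (Q : 'M[C]_(k, n)) (X Y : 'M[C]_n) :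
  M^t* *m M + Q^t* *m Q = 1%:M -> M *m Y *m Q^t* = 0 ->
  Q *m (X *m Y) *m Q^t* = Q *m X *m Q^t* *m (Q *m Y *m Q^t*).
Proof.
move: (M^t*) (Q^t*) => M' Q' PQ MY.
have -> : Q *m X *m Q' *m (Q *m Y *m Q') = Q *m X *m ((Q' *m Q) *m (Y *m Q')).
  by rewrite !mulmxA.
have -> : Q' *m Q = 1%:M - M' *m M by rewrite -PQ addrC addKr.
rewrite mulmxBl mul1mx -(mulmxA M') (mulmxA M) MY mulmx0 subr0.
by rewrite !mulmxA.
Qed.

Definition evaluated_at n (pi : msection T -> 'M[C]_n) s := deg s = n /\
  forall f, in_Cstar0 f -> pi f = value_in n f s.

Lemma evaluated_at_uconj n (pi pi' : msection T -> 'M[C]_n) (U : 'M[C]_n) s :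
  U \is unitarymx -> evaluated_at pi' s ->
  (forall f, in_Cstar0 f -> uconj U (pi f) = pi' f) -> evaluated_at pi (act (invmx U) s).
Proof.
move=> uU [ds ev] h; split; first exact: deg_act (unitary_inv uU) ds.
move=> f Af; rewrite (value_in_act (in_Cstar_equiv (in_Cstar0W Af)) (unitary_inv uU) ds).
by rewrite -(ev f Af) -(h f Af) (uconjK _ uU).
Qed.

Lemma representation0_evaluation n (pi : msection T -> 'M[C]_n) e : (0 < n)%N ->
  representation0 pi -> in_Cstar0 e -> pi e = 1%:M -> exists s, evaluated_at pi s.
Proof.
have [l] := ubnP n; elim: l n pi => // l IH n pi; rewrite ltnS => len n0 rp Ae pe.
have [y [V [VV comV]]] := intertwining_isometry n0 rp Ae pe.
pose M := V^t*; have MM : M *m M^t* = 1%:M by rewrite /M trmxCK.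
have comM f : in_Cstar0 f -> M *m pi f = f y *m M.
  move=> Af; have := comV _ (in_Cstar0_tC Af); rewrite (repStar rp Af).
  by move=> /(congr1 (fun X => X^t*)); rewrite !tCM !trmxCK.
have [k [Q [dk QQ MQ PQ]]] := unitary_complement MM.
have QM : Q *m M^t* = 0 by rewrite -[Q *m _](trmxCK) tCM trmxCK MQ trmx0 map_mx0.
have cross f : in_Cstar0 f -> M *m pi f *m Q^t* = 0.
  by move=> Af; rewrite (comM _ Af) -mulmxA MQ mulmx0.
(* An empty complement is a separate case, since no point of the tower has degree 0. *)
have [k0|k0] := posnP k.
  have dn : deg y = n by rewrite -dk k0 addn0.
  case: n / dn pi rp pe n0 len V VV comV M MM comM Q dk QQ MQ PQ QM cross =>
    pi rp pe n0 len V VV comV M MM comM *.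
  have uM : M \is unitarymx by apply/unitarymxP.
  exists (act (invmx M) y); apply: (@evaluated_at_uconj _ _ (fun f => f y) M y uM).
    by split=> // f _; rewrite value_in_deg.
  by move=> f Af; rewrite /uconj (comM _ Af) mulmxK // unitarymx_unit.
have rp2 : representation0 (fun f => Q *m pi f *m Q^t*).
  split.
  - by move=> f g Af Ag; rewrite (repD rp Af Ag) mulmxDr mulmxDl.
  - by move=> c f Af; rewrite (repZ rp c Af) -scalemxAr -scalemxAl.
  - by move=> f g Af Ag; rewrite (repM rp Af Ag); exact: compressM PQ (cross _ Ag).
  - by move=> f Af; rewrite (repStar rp Af) !tCM trmxCK mulmxA.
have lk : (k < l)%N.
  by apply: leq_trans len; rewrite -dk -[X in (X < _)%N]add0n ltn_add2r deg_gt0.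
(* The same e is a unit for the compression, because Q Q^* = 1. *)
have [|s [ds ev]] := IH k _ lk k0 rp2 Ae.
  by rewrite pe mulmx1.
case: n / dk pi rp pe n0 len V VV comV M MM comM Q QQ MQ PQ QM cross rp2 ev =>
    pi rp pe n0 len V VV comV M MM comM Q QQ MQ PQ QM cross rp2 ev.
pose U := col_mx M Q.
have uU : U \is unitarymx.
  apply/unitarymxP; rewrite tr_col_mx map_row_mx mul_col_row MM MQ QM QQ.
  by rewrite -scalar_mx_block.
exists (act (invmx U) (tsum y s)).
apply: (@evaluated_at_uconj _ _ (fun f => dirsum (f y) (value_in k f s)) U _ uU).
  split; first by rewrite deg_tsum ds.
  move=> f Af; rewrite (value_in_tsum (in_Cstar_equiv (in_Cstar0W Af)) erefl ds).
  by rewrite value_in_deg.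
move=> f Af; rewrite /uconj (invmx_unitary uU) tr_col_mx map_row_mx mul_col_mx mul_col_row.
rewrite -(ev f Af) (cross f Af) (comM f Af) -mulmxA MM mulmx1.
have -> : Q *m pi f *m M^t* = 0; last by [].
rewrite -[Q *m _ *m _](trmxCK) (tCM (Q *m pi f)) (tCM Q) (trmxCK M).
rewrite -(repStar rp Af) mulmxA.
by rewrite (cross _ (in_Cstar0_tC Af)) trmx0 map_mx0.
Qed.

End Existence.

Section Converse.
Variables (R : realType) (T : tower R) (hT : mtower T).
Local Notation C := (Cx R).
Implicit Types (f g : msection T) (x y z w t a b : T).

(** An irreducible point disjoint from the vanishing tower is not in it, as it is not disjoint from
    itself; hence some section has value 1 there. Disjointness passes to summands and to equivalent
    points. *)
Lemma evaluation_injective t n (v : 'cV[C]_n) :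
  (forall z, vanishing T z -> tdisjoint t z) -> deg t = n ->
  (forall f, in_Cstar0 f -> value_in n f t *m v = 0) -> v = 0.
Proof.
elim/tower_ind: t n v => [y iy|a b IHa IHb|x z xz IH] n v nt.
- move=> dy; case: n / dy v => v kv.
  have ny : ~ vanishing T y.
    by move=> vy; apply: (nt y vy); exists y; exact: tprec_refl.
  have [f Af fy] := Cstar0_value hT 1%:M iy ny.
  by have := kv f Af; rewrite value_in_deg fy mul1mx.
- rewrite deg_tsum => dn; case: n / dn v => v kv.
  have kab f : in_Cstar0 f -> f a *m usubmx v = 0 /\ f b *m dsubmx v = 0.
    move=> Af; have := kv f Af.
    rewrite (value_in_tsum (in_Cstar_equiv (in_Cstar0W Af)) erefl erefl) !value_in_deg.
    rewrite -{1}[v]vsubmxK /dirsum mul_block_col !mul0mx addr0 add0r.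
    by rewrite -col_mx0 => /eq_col_mx.
  rewrite -[v]vsubmxK (IHa _ (usubmx v) _ erefl) => [|z vz|f Af].
  + rewrite (IHb _ (dsubmx v) _ erefl) ?col_mx0 // => [z vz|f Af].
      by apply: tdisjoint_precl (nt z vz); apply: tprec_sumr; exact: tprec_refl.
    by rewrite value_in_deg; case: (kab f Af).
  + by apply: tdisjoint_precl (nt z vz); apply: tprec_suml; exact: tprec_refl.
  by rewrite value_in_deg; case: (kab f Af).
- move=> dz kv; have dx : deg x = n by rewrite -dz (tequiv_deg xz).
  have nx z' : vanishing T z' -> tdisjoint x z'.
    by move=> /nt; apply: tdisjoint_precl; left.
  case: xz => U + eU; rewrite dx in U eU * => uU.
  have uVU := unitarymx_unit uU; rewrite -[v](mulKVmx uVU).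
  rewrite (IH n (invmx U *m v) nx dx) ?mulmx0 // => f Af.
  have := kv f Af; rewrite -eU (value_in_act (in_Cstar_equiv (in_Cstar0W Af)) uU dx).
  move=> /(congr1 (mulmx (invmx U))); rewrite /uconj mulmx0 -!mulmxA => <-.
  by rewrite (mulKmx uVU).
Qed.

End Converse.

Theorem corollary4p9 (R : realType) (T : tower R)
    (hT : mtower T) (hlc : essentially_locally_compact T) :
  (forall (n : nat) (pi : msection T -> 'M[Cx R]_n),
     (0 < n)%N -> representation0 pi -> nondegenerate0 pi ->
     exists s : T,
       unique (fun s => deg s = n /\
                        forall f, in_Cstar0 f -> pi f = value_in n f s) s /\
       (forall z, vanishing T z -> tdisjoint s z)) /\
  (forall t : T,
     (forall z, vanishing T z -> tdisjoint t z) ->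
     representation0 (fun f : msection T => f t) /\
     nondegenerate0 (fun f : msection T => f t)).
Proof.
split=> [n pi n0 rp /(nondegenerate0P rp)[e Ae pe]|t nt].
  have [s [ds ev]] := representation0_evaluation hT n0 rp Ae pe.
  have es : value_in n e s = 1%:M by rewrite -(ev e Ae).
  exists s; split=> [|z vz [a as_ az]].
    split=> // s' [ds' ev']; rewrite -(act1 ds).
    apply: (Cstar_separates_all hT ds ds' (unitarymx1 R n)) => f Cf.
    have Afe := in_Cstar0Ml Cf Ae; have es' : value_in n e s' = 1%:M by rewrite -(ev' e Ae).
    have := ev _ Afe; rewrite (ev' _ Afe).
    rewrite (@value_in_op R T (fun n X Y => X *m Y) n f e s' ds') es' mulmx1.
    rewrite (@value_in_op R T (fun n X Y => X *m Y) n f e s ds) es mulmx1 uconj1.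
    by move=> ->.
  (* A common part a of s and of some z in the vanishing tower would have [e a] equal both to 1 and
     to 0. *)
  have ee := in_Cstar_equiv (in_Cstar0W Ae).
  have ea : e a = 1%:M by apply: (scalar_mx_tprec ee as_); apply/(value_in_scalar e 1 ds).
  have : e a = 0%:M by apply: (scalar_mx_tprec ee az); rewrite raddf0; exact: vz.
  by rewrite ea => /scalar_mx_deg_inj/eqP; rewrite oner_eq0.
have rp : representation0 (fun f : msection T => f t) by split.
split=> //; apply/(nondegenerate0P rp).
apply: (@representation0_unit R T _ _ (@in_Cstar0 R T) rp) => [f //||||||v kv].
- exact: in_Cstar0_0.
- by move=> f g; exact: in_Cstar0D.
- by move=> c f; exact: in_Cstar0Z.
- by move=> f g; exact: in_Cstar0M.
- by move=> f; exact: in_Cstar0_tC.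
by apply: (evaluation_injective hT nt erefl) => f Af; rewrite value_in_deg kv.
Qed.
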